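(* Let $\Lambda$ be a finite-dimensional algebra over a field and let $\mathcal{K}_\Lambda=\mathcal{K}^{[-1,0]}(\operatorname{proj}\Lambda)$. There are explicit bijections between (i) isomorphism classes of basic silting objects in $\mathcal{K}_\Lambda$; (ii) complete cotorsion pairs in $\mathcal{K}_\Lambda$; (iii) thick subcategories of $\mathcal{K}_\Lambda$ with enough injectives; given by $\Psi$ from (ii) to (i), by $(\mathcal{X},\mathcal{Y})\mapsto\beta(\mathcal{X})$ from (ii) to (iii), and by $U\mapsto\operatorname{thick}(U_\rho)$ from (i) to (iii). These bijections commute with each other, i.e. $\beta(\mathcal{X})=\operatorname{thick}(U_\rho)$ for $U=\Psi((\mathcal{X},\mathcal{Y}))$, and they are compatible with the known bijections in $\operatorname{mod}\Lambda$ and between $\mathcal{K}_\Lambda$ and $\operatorname{mod}\Lambda$: for every complete cotorsion pair $(\mathcal{X},\mathcal{Y})$ with $U=\Psi((\mathcal{X},\mathcal{Y}))$ and $M=H^0(U)$, $$\Phi((\mathcal{X},\mathcal{Y}))=(\operatorname{Fac}(M),M^\perp),\qquad \mathscr{W}(\beta(\mathcal{X}))=\alpha(\Phi((\mathcal{X},\mathcal{Y}))),$$ $$\mathscr{W}(\operatorname{thick}(U_\rho))=M_\rho^\perp\cap\operatorname{Fac}(M)=\alpha((\operatorname{Fac}(M),M^\perp)).$$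
   Context: $\operatorname{mod}\Lambda$ is the category of finitely generated $\Lambda$-modules and $\mathcal{K}_\Lambda=\mathcal{K}^{[-1,0]}(\operatorname{proj}\Lambda)$ is the full subcategory of $\mathcal{K}^b(\operatorname{proj}\Lambda)\subset\mathcal{D}^b(\operatorname{mod}\Lambda)$ of complexes of finitely generated projectives concentrated in degrees $-1$ and $0$, $X=(X^{-1}\xrightarrow{x}X^0)$, up to homotopy. It is extriangulated with $\mathbb{E}(X,Y)=\operatorname{Hom}_{\mathcal{D}^b(\operatorname{mod}\Lambda)}(X,Y[1])$. A sequence $X\xrightarrow{f}Y\xrightarrow{g}Z$ in $\mathcal{K}_\Lambda$ is a conflation, written $X\rightarrowtail Y\twoheadrightarrow Z$, if it extends to a triangle $(f,g,h)$, $h:Z\to X[1]$, in $\mathcal{D}^b(\operatorname{mod}\Lambda)$. All subcategories are full and closed under isomorphisms. $\Lambda$ also denotes the complex $0\to\Lambda$, and $\Lambda[1]$ the complex $\Lambda\to0$. A subcategory $\mathcal{T}\subset\mathcal{K}_\Lambda$ is thick if it is closed under direct summands and, for every conflation, if two of the terms lie in $\mathcal{T}$ then so does the third; $\operatorname{thick}(\mathcal{C})$ is the smallest thick subcategory containing $\mathcal{C}$. An object $I\in\mathcal{T}$ is injective in $\mathcal{T}$ if $\mathbb{E}(X,I)=0$ for all $X\in\mathcal{T}$; $\mathcal{T}$ has enough injectives if each $X\in\mathcal{T}$ admits a conflation $X\rightarrowtail I\twoheadrightarrow X''$ with $I$ injective in $\mathcal{T}$ and $X''\in\mathcal{T}$.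 A cotorsion pair is a pair $(\mathcal{X},\mathcal{Y})$ of full additive subcategories of $\mathcal{K}_\Lambda$ with $\mathcal{Y}=\{Y\mid\mathbb{E}(X,Y)=0\ \forall X\in\mathcal{X}\}$ and $\mathcal{X}=\{X\mid\mathbb{E}(X,Y)=0\ \forall Y\in\mathcal{Y}\}$; it is complete if every $Z\in\mathcal{K}_\Lambda$ fits into conflations $Y\rightarrowtail X\twoheadrightarrow Z$ and $Z\rightarrowtail Y'\twoheadrightarrow X'$ with $X,X'\in\mathcal{X}$, $Y,Y'\in\mathcal{Y}$. An object $U\in\mathcal{K}_\Lambda$ is silting if $\operatorname{Hom}(U,U[i])=0$ for all $i>0$ and $\operatorname{thick}(\operatorname{add}U)=\mathcal{K}_\Lambda$. For a complete cotorsion pair, $\Psi((\mathcal{X},\mathcal{Y}))$ is the basic silting object $U$ with $\operatorname{add}U=\mathcal{X}\cap\mathcal{Y}$. For a basic silting object $U$ there is a conflation $\Lambda\xrightarrow{f}U_0\to U_1\overset{g}{\dashrightarrow}\Lambda[1]$ with $f$ a minimal left $\operatorname{add}U$-approximation and $g$ a minimal right $\operatorname{add}U$-approximation; $U_\rho$ is the basic direct summand of $U$ with $\operatorname{add}U_\rho=\operatorname{add}U_1$. $\beta(\mathcal{X})=\{X\in\mathcal{X}\mid\text{for every conflation }X\rightarrowtail X'\twoheadrightarrow X''\text{ with }X'\in\mathcal{X}\text{, one has }X''\in\mathcal{X}\}$. In $\operatorname{mod}\Lambda$: for modules or subcategories $\mathcal{S}$, $\mathcal{S}^\perp=\{N\mid\operatorname{Hom}(S,N)=0\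 \forall S\in\mathcal{S}\}$, and $\operatorname{Fac}(M)$ is the class of quotients of objects of $\operatorname{add}M$. $\Phi((\mathcal{X},\mathcal{Y}))=(H^0(\mathcal{Y}),H^0(\mathcal{Y})^\perp)$. For a torsion pair, $\alpha((\mathcal{T},\mathcal{F}))=\{M\in\mathcal{T}\mid\text{for every }g:N\to M\text{ with }N\in\mathcal{T},\ \ker g\in\mathcal{T}\}$. If $\Lambda\to M_0\to M_1\to0$ is exact with $\Lambda\to M_0$ a minimal left $\operatorname{add}M$-approximation, $M_\rho$ is the basic module with $\operatorname{add}M_\rho=\operatorname{add}M_1$. For $\mathcal{C}\subset\mathcal{K}_\Lambda$, $\mathscr{W}(\mathcal{C})$ is the subcategory of all $N\in\operatorname{mod}\Lambda$ such that $x^*:\operatorname{Hom}(X^0,N)\to\operatorname{Hom}(X^{-1},N)$ is an isomorphism for all $X=(X^{-1}\xrightarrow{x}X^0)\in\mathcal{C}$. The known bijections are: $H^0$ from basic silting objects of $\mathcal{K}_\Lambda$ to basic support $\tau$-tilting modules (up to isomorphism); $\Phi$ from complete cotorsion pairs to functorially finite torsion pairs; $M\mapsto(\operatorname{Fac}(M),M^\perp)$ from basic support $\tau$-tilting modules to functorially finite torsion pairs; $\alpha$ from functorially finite torsion pairs to left finite wide subcategories (wide subcategories whose smallest containing torsion class is functorially finite); and $M\mapsto M_\rho^\perp\cap\operatorname{Fac}(M)$ from basic support $\tau$-tilting modules to left finite wide subcategories. *)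

(* Defs.v *)
From HB Require Import structures.
From mathcomp Require Import all_boot all_algebra all_field.

Set Implicit Arguments.
Unset Strict Implicit.
Unset Printing Implicit Defensive.

Import GRing.Theory.
Local Open Scope ring_scope.

(* Subcategories are predicates on objects, and isomorphism classes are
   identified with the corresponding predicates.  (The type [set] of
   mathcomp-classical lives in too small a universe: it must sit below the
   universe of the carriers of lmodType.)                                     *)
Definition class (T : Type) : Type := T -> Prop.

Definition single (T : Type) (x : T) : class T := fun y => y = x.

Definition inter (T : Type) (C D : class T) : class T := fun x => C x /\ D x.

Definition bij_between (S T : Type) (A : class S) (B : class T) (f : S -> T) :
  Prop :=
  [/\ forall x, A x -> B (f x),
      forall x y, A x -> A y -> f x = f y -> x = y
    & forall y, B y -> exists2 x, A x & f x = y].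

(* Notions that make sense in any additive category, given by its objects, the
   isomorphism relation, a zero object and binary direct sums.                *)
Section AdditiveCategory.
Variables (T : Type) (iso : T -> T -> Prop) (zero : T) (sum : T -> T -> T).

Definition iso_closed (C : class T) : Prop :=
  forall X Y, iso X Y -> C X -> C Y.

Definition additive_subcat (C : class T) : Prop :=
  [/\ iso_closed C, C zero & forall X Y, C X -> C Y -> C (sum X Y)].

Definition summand (X Y : T) : Prop := exists X', iso Y (sum X X').

Definition add_of (U : T) : class T :=
  fun X : T => exists n, summand X (iter n (sum U) zero).

Definition indecomposable (X : T) : Prop :=
  ~ iso X zero /\
  forall Y Z, iso X (sum Y Z) -> iso Y zero \/ iso Z zero.

Definition basic (U : T) : Prop :=
  forall V V' W, indecomposable V -> indecomposable V' ->
    iso U (sum (sum V V') W) -> ~ iso V V'.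

End AdditiveCategory.

Section PairMap.
Variables (R : nzRingType) (M M' N N' : lmodType R).
Variables (f : {linear M -> N}) (f' : {linear M' -> N'}).

Definition pair_map (u : (M * M')%type) : (N * N')%type := (f u.1, f' u.2).

Fact pair_map_is_linear : linear pair_map.
Proof. by move=> a u v; rewrite /pair_map /= !linearP. Qed.

HB.instance Definition _ :=
  GRing.isLinear.Build R (M * M')%type (N * N')%type *:%R pair_map
    pair_map_is_linear.

End PairMap.

Section Modules.
Variable R : nzRingType.

Definition fin_gen (M : lmodType R) : Prop :=
  exists s : seq M, forall m : M, exists c : nat -> R,
    m = \sum_(i < size s) c i *: s`_i.

Definition surjective (M N : lmodType R) (f : {linear M -> N}) : Prop :=
  forall y, exists x, f x = y.

Definition projective (P : lmodType R) : Prop :=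
  forall (M N : lmodType R) (p : {linear M -> N}) (f : {linear P -> N}),
    surjective p -> exists g : {linear P -> M}, p \o g =1 f.

Definition fg_projective (P : lmodType R) : Prop := fin_gen P /\ projective P.

Definition zmod0 : lmodType R := 'rV[R]_0.

Fact fin_gen0 : fin_gen zmod0.
Proof. by exists [::] => m; exists (fun _ => 0); apply/rowP => -[]. Qed.

Fact fin_gen_sum (M N : lmodType R) :
  fin_gen M -> fin_gen N -> fin_gen (M * N)%type.
Proof.
move=> [s sP] [t tP].
exists ([seq (x, 0) | x <- s] ++ [seq (0, y) | y <- t]) => -[m n].
have [c ->] := sP m; have [d ->] := tP n.
exists (fun i => if (i < size s)%N then c i else d (i - size s)%N).
rewrite size_cat !size_map big_split_ord /=.
under [X in _ = X + _]eq_bigr => i _ do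
  rewrite ltn_ord nth_cat size_map ltn_ord (nth_map 0) //.
under [X in _ = _ + X]eq_bigr => i _ do
  rewrite ltnNge leq_addr /= nth_cat size_map ltnNge leq_addr /= addKn
    (nth_map 0) //.
apply/pair_equal_spec; split.
  rewrite !raddf_sum /= [X in _ + X]big1 ?addr0 // => i _.
  by rewrite scaler0.
rewrite !raddf_sum /= [X in X + _]big1 ?add0r // => i _.
by rewrite scaler0.
Qed.

Fact fin_gen_regular : fin_gen R^o.
Proof.
by exists [:: 1] => m; exists (fun _ => m); rewrite big_ord1 /= -[LHS]mulr1.
Qed.

Fact projective0 : projective zmod0.
Proof.
move=> M N p f _; exists \0 => x /=.
have -> : x = 0 by apply/rowP => -[].
by rewrite !linear0.
Qed.

Definition pair_inl (M N : lmodType R) (x : M) : (M * N)%type := (x, 0).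
Definition pair_inr (M N : lmodType R) (y : N) : (M * N)%type := (0, y).

Fact pair_inl_is_linear (M N : lmodType R) : linear (@pair_inl M N).
Proof.
move=> a x y; apply/pair_equal_spec; split=> //=.
by rewrite scaler0 addr0.
Qed.

Fact pair_inr_is_linear (M N : lmodType R) : linear (@pair_inr M N).
Proof.
move=> a x y; apply/pair_equal_spec; split=> //=.
by rewrite scaler0 addr0.
Qed.

HB.instance Definition _ (M N : lmodType R) :=
  GRing.isLinear.Build R M (M * N)%type *:%R (@pair_inl M N)
    (@pair_inl_is_linear M N).
HB.instance Definition _ (M N : lmodType R) :=
  GRing.isLinear.Build R N (M * N)%type *:%R (@pair_inr M N)
    (@pair_inr_is_linear M N).

Definition pair_case (M N P : lmodType R) (f : {linear M -> P})
  (g : {linear N -> P}) (u : (M * N)%type) : P := f u.1 + g u.2.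

Fact pair_case_is_linear (M N P : lmodType R) (f : {linear M -> P})
  (g : {linear N -> P}) : linear (@pair_case M N P f g).
Proof.
by move=> a u v; rewrite /pair_case /= !linearP scalerDr addrACA.
Qed.

HB.instance Definition _ (M N P : lmodType R) (f : {linear M -> P})
  (g : {linear N -> P}) :=
  GRing.isLinear.Build R (M * N)%type P *:%R (@pair_case M N P f g)
    (@pair_case_is_linear M N P f g).

Fact projective_sum (P Q : lmodType R) :
  projective P -> projective Q -> projective (P * Q)%type.
Proof.
move=> Pp Qp M N p f ps.
have [g gP] := Pp _ _ p (f \o @pair_inl P Q) ps.
have [h hP] := Qp _ _ p (f \o @pair_inr P Q) ps.
exists (pair_case g h) => -[x y] /=.
have /= ex := gP x; have /= ey := hP y.
rewrite /pair_case /= linearD ex ey -linearD; congr (f _).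
by apply/pair_equal_spec; rewrite /= addr0 add0r.
Qed.

Definition regular_act (M : lmodType R) (m : M) (a : R^o) : M := (a : R) *: m.

Fact regular_act_is_linear (M : lmodType R) (m : M) : linear (@regular_act M m).
Proof. by move=> a x y; rewrite /regular_act scalerDl -scalerA. Qed.

HB.instance Definition _ (M : lmodType R) (m : M) :=
  GRing.isLinear.Build R R^o M *:%R (@regular_act M m)
    (@regular_act_is_linear M m).

Fact projective_regular : projective R^o.
Proof.
move=> M N p f /(_ (f 1)) [m mP]; exists (regular_act m) => a /=.
by rewrite /regular_act linearZ /= mP -linearZ; congr (f _); exact: mulr1.
Qed.

Fact fg_projective0 : fg_projective zmod0.
Proof. by split; [exact: fin_gen0 | exact: projective0]. Qed.

Fact fg_projective_sum (P Q : lmodType R) :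
  fg_projective P -> fg_projective Q -> fg_projective (P * Q)%type.
Proof.
by move=> [? ?] [? ?]; split; [exact: fin_gen_sum | exact: projective_sum].
Qed.

Fact fg_projective_regular : fg_projective R^o.
Proof. by split; [exact: fin_gen_regular | exact: projective_regular]. Qed.

(* The category mod R. *)
Record fgmod := FgMod { fgmod_sort :> lmodType R; fgmodP : fin_gen fgmod_sort }.

Definition mod_iso (M N : fgmod) : Prop :=
  exists f : {linear M -> N}, bijective f.
Definition mod_zero : fgmod := FgMod fin_gen0.
Definition mod_sum (M N : fgmod) : fgmod :=
  FgMod (fin_gen_sum (fgmodP M) (fgmodP N)).
Definition mod_regular : fgmod := FgMod fin_gen_regular.

Definition mod_add : fgmod -> class fgmod := add_of mod_iso mod_zero mod_sum.
Definition mod_basic : fgmod -> Prop := basic mod_iso mod_zero mod_sum.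

Definition perp (S : class fgmod) : class fgmod :=
  fun N : fgmod =>
    forall M : fgmod, S M -> forall f : {linear M -> N}, f =1 \0.

Definition Fac (M : fgmod) : class fgmod :=
  fun N : fgmod =>
    exists2 M' : fgmod, mod_add M M' &
      exists p : {linear M' -> N}, surjective p.

(* j exhibits K as the kernel of g (unique up to isomorphism). *)
Definition is_ker (K N M : fgmod) (j : {linear K -> N}) (g : {linear N -> M}) :
  Prop := injective j /\ (forall n, g n = 0 <-> exists k, j k = n).

Definition alpha (TF : class fgmod * class fgmod) : class fgmod :=
  fun M : fgmod => TF.1 M /\
     forall (N : fgmod) (g : {linear N -> M}), TF.1 N ->
       forall (K : fgmod) (j : {linear K -> N}), is_ker j g -> TF.1 K.

Definition mod_left_approx (C : class fgmod) (A B : fgmod)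
  (f : {linear A -> B}) : Prop :=
  C B /\ forall (B' : fgmod) (a : {linear A -> B'}), C B' ->
           exists b : {linear B -> B'}, b \o f =1 a.

Definition mod_left_minimal (A B : fgmod) (f : {linear A -> B}) : Prop :=
  forall e : {linear B -> B}, e \o f =1 f -> bijective e.

Definition is_M_rho (M N : fgmod) : Prop :=
  mod_basic N /\
  exists (M0 M1 : fgmod) (f : {linear mod_regular -> M0})
         (g : {linear M0 -> M1}),
    [/\ mod_left_approx (mod_add M) f, mod_left_minimal f,
        surjective g, (forall x, g x = 0 <-> exists a, f a = x)
      & mod_add N = mod_add M1].

End Modules.

(* Cochain complexes of R-modules, and the triangulated structure of their
   homotopy category.  The bounded complexes of finitely generated projectives
   form the full triangulated subcategory K^b(proj R), on which the homotopy
   category and D^b(mod R) have the same morphisms and triangles.             *)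
Section Complexes.
Variable R : nzRingType.

Record cplx := Cplx {
  cob :> int -> lmodType R;
  cd : forall i, {linear cob i -> cob (i + 1)};
  cdd : forall i x, cd (i + 1) (cd i x) = 0 }.

Record cmap (A B : cplx) := CMap {
  cm :> forall i, {linear A i -> B i};
  cmP : forall i x, cm (i + 1) (cd A i x) = cd B i (cm i x) }.

(* The component of the homotopy in degree i + 1 is h i, so that no transport
   along i - 1 + 1 = i is needed. *)
Definition homotopic (A B : cplx) (f g : cmap A B) : Prop :=
  exists h : forall i, {linear A (i + 1) -> B i},
    forall i x, f (i + 1) x - g (i + 1) x =
                cd B i (h i x) + h (i + 1) (cd A (i + 1) x).

Definition null_homotopic (A B : cplx) (f : cmap A B) : Prop :=
  exists h : forall i, {linear A (i + 1) -> B i},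
    forall i x, f (i + 1) x = cd B i (h i x) + h (i + 1) (cd A (i + 1) x).

Definition cid (A : cplx) : cmap A A :=
  @CMap A A (fun i => idfun : {linear A i -> A i}) (fun i x => erefl).

Fact ccomp_subproof (A B C : cplx) (g : cmap B C) (f : cmap A B) i x :
  (g (i + 1) \o f (i + 1)) (cd A i x) = cd C i ((g i \o f i) x).
Proof. by rewrite /= !cmP. Qed.

Definition ccomp (A B C : cplx) (g : cmap B C) (f : cmap A B) : cmap A C :=
  @CMap A C (fun i => g i \o f i : {linear A i -> C i}) (ccomp_subproof g f).

Definition is_hiso (A B : cplx) (f : cmap A B) : Prop :=
  exists g : cmap B A,
    homotopic (ccomp g f) (cid A) /\ homotopic (ccomp f g) (cid B).

Definition hiso (A B : cplx) : Prop := exists f : cmap A B, is_hiso f.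

Fact shift_subproof (A : cplx) i x :
  (\- cd A (i + 1 + 1)) ((\- cd A (i + 1)) x) = 0.
Proof. by rewrite /= linearN opprK cdd. Qed.

(* A[1] *)
Definition shift (A : cplx) : cplx :=
  @Cplx (fun i => A (i + 1))
        (fun i => \- cd A (i + 1)) (@shift_subproof A).

Fact shift_map_subproof (A B : cplx) (f : cmap A B) i x :
  f (i + 1 + 1) (cd (shift A) i x) = cd (shift B) i (f (i + 1) x).
Proof. by rewrite /= linearN cmP. Qed.

Definition shift_map (A B : cplx) (f : cmap A B) : cmap (shift A) (shift B) :=
  @CMap (shift A) (shift B) (fun i => f (i + 1)) (@shift_map_subproof A B f).

Section Cone.
Variables (A B : cplx) (f : cmap A B).

Definition cone_d (i : int) (u : (A (i + 1)%R * B i)%type) :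
  (A (i + 1 + 1)%R * B (i + 1)%R)%type :=
  (- cd A (i + 1) u.1, f (i + 1) u.1 + cd B i u.2).

Fact cone_d_is_linear (i : int) : linear (@cone_d i).
Proof.
move=> a u v; rewrite /cone_d; apply/pair_equal_spec; split=> /=.
  by rewrite linearP opprD scalerN.
by rewrite !linearP scalerDr addrACA.
Qed.

HB.instance Definition _ (i : int) :=
  GRing.isLinear.Build R (A (i + 1)%R * B i)%type
    (A (i + 1 + 1)%R * B (i + 1)%R)%type *:%R (@cone_d i) (@cone_d_is_linear i).

Fact cone_subproof (i : int) (x : (A (i + 1)%R * B i)%type) :
  cone_d (cone_d x) = 0.
Proof.
rewrite /cone_d /=; apply/pair_equal_spec; split=> /=.
  by rewrite linearN opprK cdd.
by rewrite linearN linearD cdd addr0 cmP addNr.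
Qed.

Definition cone : cplx :=
  @Cplx (fun i => (A (i + 1)%R * B i)%type) (fun i => @cone_d i) cone_subproof.

Fact cone_in_subproof (i : int) (x : B i) :
  @pair_inr R (A (i + 1 + 1)) (B (i + 1)) (cd B i x)
  = cd cone i (@pair_inr R (A (i + 1)) (B i) x).
Proof.
by rewrite /= /cone_d /pair_inr /= !linear0 add0r.
Qed.

Definition cone_in : cmap B cone :=
  @CMap B cone (fun i => @pair_inr R (A (i + 1)) (B i)) cone_in_subproof.

Definition cone_out : cmap cone (shift A) :=
  @CMap cone (shift A)
    (fun i => @fst (A (i + 1)) (B i) : {linear _ -> _}) (fun i x => erefl).

End Cone.

(* (f, g, h) is isomorphic, in the homotopy category, to the standard triangle
   of some mapping cone. *)
Definition distinguished (A B C : cplx)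
  (f : cmap A B) (g : cmap B C) (h : cmap C (shift A)) : Prop :=
  exists (A' B' : cplx) (f' : cmap A' B')
         (a : cmap A A') (b : cmap B B') (c : cmap C (cone f')),
    [/\ is_hiso a, is_hiso b & is_hiso c] /\
    [/\ homotopic (ccomp b f) (ccomp f' a),
        homotopic (ccomp c g) (ccomp (cone_in f') b)
      & homotopic (ccomp (shift_map a) h) (ccomp (cone_out f') c)].

End Complexes.

Section TwoTerm.
Variable R : nzRingType.

(* An object (km1 -> k0) of K^[-1,0](proj R). *)
Record ktwo := KTwo {
  km1 : lmodType R;
  k0 : lmodType R;
  kd : {linear km1 -> k0};
  km1P : fg_projective km1;
  k0P : fg_projective k0 }.

Definition ktwo_ob (X : ktwo) (i : int) : lmodType R :=
  match i with
  | Negz 0 => km1 X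
  | Posz 0 => k0 X
  | _ => zmod0 R
  end.

Definition ktwo_d (X : ktwo) (i : int) :
  {linear ktwo_ob X i -> ktwo_ob X (i + 1)} :=
  match i return {linear ktwo_ob X i -> ktwo_ob X (i + 1)} with
  | Negz 0 => kd X
  | i => \0
  end.

Fact ktwo_dd X i x : ktwo_d X (i + 1) (ktwo_d X i x) = 0.
Proof. by move: x; case: i => [n|[|n]] x //=; rewrite linear0. Qed.

Coercion cplx_of (X : ktwo) : cplx R := Cplx (@ktwo_dd X).

Definition kiso (X Y : ktwo) : Prop := hiso X Y.
Definition kzero : ktwo :=
  @KTwo (zmod0 R) (zmod0 R) \0 (fg_projective0 R) (fg_projective0 R).
Definition ksum (X Y : ktwo) : ktwo :=
  @KTwo (km1 X * km1 Y)%type (k0 X * k0 Y)%type (pair_map (kd X) (kd Y))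
    (fg_projective_sum (km1P X) (km1P Y)) (fg_projective_sum (k0P X) (k0P Y)).
(* The complex 0 -> R. *)
Definition kreg : ktwo :=
  @KTwo (zmod0 R) R^o \0 (fg_projective0 R) (fg_projective_regular R).

Definition kadd : ktwo -> class ktwo := add_of kiso kzero ksum.
Definition kbasic : ktwo -> Prop := basic kiso kzero ksum.
Definition ksummand : ktwo -> ktwo -> Prop := summand kiso ksum.

Definition E_vanish (X Y : ktwo) : Prop :=
  forall f : cmap X (shift Y), null_homotopic f.

Definition conflation (X Y Z : ktwo) : Prop :=
  exists (f : cmap X Y) (g : cmap Y Z) (h : cmap Z (shift X)),
    distinguished f g h.

Definition is_thick (T : class ktwo) : Prop :=
  [/\ additive_subcat kiso kzero ksum T,
      (forall X Y, ksummand X Y -> T Y -> T X)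
    & forall X Y Z, conflation X Y Z ->
        [/\ (T X -> T Y -> T Z), (T X -> T Z -> T Y) & (T Y -> T Z -> T X)]].

Definition thick (C : class ktwo) : class ktwo :=
  fun X : ktwo => forall T, is_thick T -> (forall Y, C Y -> T Y) -> T X.

Definition injective_in (T : class ktwo) (I : ktwo) : Prop :=
  T I /\ forall X, T X -> E_vanish X I.

Definition enough_injectives (T : class ktwo) : Prop :=
  forall X, T X -> exists I X'',
    [/\ conflation X I X'', injective_in T I & T X''].

Definition thick_enough_inj : class (class ktwo) :=
  fun T : class ktwo => is_thick T /\ enough_injectives T.

Definition cotorsion_pair (p : class ktwo * class ktwo) : Prop :=
  [/\ additive_subcat kiso kzero ksum p.1,
      additive_subcat kiso kzero ksum p.2,
      p.2 = (fun Y : ktwo => forall X, p.1 X -> E_vanish X Y)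
    & p.1 = (fun X : ktwo => forall Y, p.2 Y -> E_vanish X Y)].

Definition complete_cotorsion : class (class ktwo * class ktwo) :=
  fun p : class ktwo * class ktwo => cotorsion_pair p /\
     forall Z : ktwo,
       (exists Y X, [/\ conflation Y X Z, p.1 X & p.2 Y]) /\
       (exists Y' X', [/\ conflation Z Y' X', p.1 X' & p.2 Y']).

Definition silting (U : ktwo) : Prop :=
  (forall i : nat, (0 < i)%N ->
     forall f : cmap U (iter i (@shift R) U), null_homotopic f) /\
  thick (kadd U) = (fun _ => True).

(* Isomorphism classes of basic silting objects, a class being the set of the
   objects in it. *)
Definition basic_silting_classes : class (class ktwo) :=
  fun C : class ktwo => exists U, [/\ kbasic U, silting U & C = kiso U].

(* The isomorphism class of the basic silting U with add U = X `&` Y. *)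
Definition Psi (p : class ktwo * class ktwo) : class ktwo :=
  fun U : ktwo => [/\ kbasic U, silting U & kadd U = inter p.1 p.2].

Definition beta (C : class ktwo) : class ktwo :=
  fun X : ktwo => C X /\ forall X' X'', conflation X X' X'' -> C X' -> C X''.

Definition left_approx (C : class ktwo) (A B : ktwo) (f : cmap A B) : Prop :=
  C B /\ forall (B' : ktwo) (a : cmap A B'), C B' ->
           exists b : cmap B B', homotopic (ccomp b f) a.

Definition left_minimal (A B : ktwo) (f : cmap A B) : Prop :=
  forall e : cmap B B, homotopic (ccomp e f) f -> is_hiso e.

Definition right_approx (C : class ktwo) (B : ktwo) (A : cplx R) (g : cmap B A) :
  Prop :=
  C B /\ forall (B' : ktwo) (a : cmap B' A), C B' ->
           exists b : cmap B' B, homotopic (ccomp g b) a.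

Definition right_minimal (B : ktwo) (A : cplx R) (g : cmap B A) : Prop :=
  forall e : cmap B B, homotopic (ccomp g e) g -> is_hiso e.

Definition is_U_rho (U V : ktwo) : Prop :=
  [/\ kbasic V, ksummand V U
    & exists (U0 U1 : ktwo) (f : cmap kreg U0) (p : cmap U0 U1)
             (g : cmap U1 (shift kreg)),
        [/\ distinguished f p g,
            left_approx (kadd U) f /\ left_minimal f,
            right_approx (kadd U) g /\ right_minimal g
          & kadd V = kadd U1]].

(* U |-> thick(U_rho), on isomorphism classes; as U_rho is unique up to
   isomorphism, the union has only one distinct member. *)
Definition thick_rho (C : class ktwo) : class ktwo :=
  fun X : ktwo => exists U V, [/\ C U, is_U_rho U V & thick (single V) X].

(* N is H^0(X), the cokernel of X^{-1} -> X^0. *)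
Definition is_H0 (X : ktwo) (N : fgmod R) : Prop :=
  exists p : {linear k0 X -> N},
    surjective p /\ forall x, p x = 0 <-> exists y, kd X y = x.

Definition H0_image (C : class ktwo) : class (fgmod R) :=
  fun N : fgmod R => exists2 X, C X & is_H0 X N.

Definition Phi (p : class ktwo * class ktwo) :
  class (fgmod R) * class (fgmod R) :=
  (H0_image p.2, perp (H0_image p.2)).

Definition Wcat (C : class ktwo) : class (fgmod R) :=
  fun N : fgmod R => forall X, C X ->
     (forall f f' : {linear k0 X -> N}, f \o kd X =1 f' \o kd X -> f =1 f') /\
     (forall g : {linear km1 X -> N},
        exists f : {linear k0 X -> N}, f \o kd X =1 g).

End TwoTerm.

(* Main.v *)
Require Import Defs.
From HB Require Import structures.
From mathcomp Require Import all_boot all_algebra all_field.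
From Stdlib Require Import ClassicalEpsilon FunctionalExtensionality PropExtensionality
  ProofIrrelevance.
From Stdlib Require Import Setoid Morphisms.

(** Everything can be computed on two-term complexes
    themselves.  A morphism is a pair of linear maps up to homotopy, a class in
    E(C, A) is a linear map e from the degree -1 term of C to the degree 0 term
    of A, and A -> B -> C is a conflation exactly when B is isomorphic to the
    complex kext e for some e (conflE).  Octahedra then amount to rebracketing
    direct sums, and E is right exact on conflations in both variables.

    Silting objects and cotorsion pairs.  Given a silting object U, let Y
    consist of the objects with E(U, Y) = 0 and X of those with E(X, Y) = 0.  The
    universal extension of Z by a power of U, which exists because Hom spaces are
    finite-dimensional, shows that the pair is complete (silt_complete).  The
    crucial point is that E(U, B) = 0 = E(B, U) forces B to be in add U
    (silting_max): the universal map from a power of U to B is a deflation, because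
    the cokernel N that it has on H^0 satisfies Hom(U, N) = 0 = E(U, N), a
    condition that passes from U to the thick subcategory it generates, hence to
    the regular module.  So the intersection of X and Y is add U.  Conversely, the
    coresolution of the regular module by a complete cotorsion pair produces a
    silting object, and the pair is recovered from the intersection (cot_Y).
    Basic objects are determined by their additive closure by the Krull-Schmidt
    property, which follows from Fitting's lemma (fitting).

    The category beta.  Let U0 be the middle term of a conflation from the regular
    module to U1, with minimal connecting map gam from U1 to the shift of the
    regular module.  Every conflation U1 -> X' -> X'' inside X splits, by
    minimality of gam, so U1 is in beta (rho_beta).  Every object of X embeds into
    a power of U1, its degree -1 term being a summand of a free module
    (rho_infl).  Hence every object of beta has a coresolution of length one in
    add U1 (beta_cores), and beta is thick(U1), has enough injectives, and has
    add U1 as its category of injectives.  As Y consists of the objects with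
    E(U1, Y) = 0, the pair can be recovered from beta.

    Surjectivity.  The injectives of a thick subcategory T with enough injectives
    form a presilting class.  A presilting family of pairwise nonisomorphic
    indecomposables has at most as many members as the regular module has
    indecomposable summands, by a rank computation in the Grothendieck group
    (count_presilting), so the injectives form add I for a single I.  The pair
    defined by the Bongartz completion of I has T as its beta (beta_surjective).

    Modules.  For M = H^0(U), the torsion class Fac M is H^0(Y) and equals the
    class of modules N with E(U1, N) = 0 (FacP, H0_image_Y).  Adding the condition
    Hom(U1, N) = 0 gives, on the one hand, the category attached to thick(U1)
    and, on the other hand, the wide subcategory alpha (alphaP).  Finally
    Hom(U1, N) = 0 says that N is in the perpendicular category of M_rho, because
    the minimal approximation of the regular module in add M is the one that U0
    induces on H^0 (M_rho_perp). *)

Set Implicit Arguments.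
Unset Strict Implicit.
Unset Printing Implicit Defensive.
Import GRing.Theory.
Local Open Scope ring_scope.


(** * Linear algebra over a ring, with classical choice *)

(** Equations between sums in an abelian group: both sides are reified over
    one list of atoms, and the integer coefficients of the atoms are compared
    by computation. Atoms are matched up to unification, because the two-term
    complexes below are related by conversions that a syntactic comparison
    would miss. *)
Inductive zexp := ZV of nat | ZA of zexp & zexp | ZO of zexp | Z0 | ZM of zexp & nat.
Fixpoint zeval (V : zmodType) (env : seq V) (e : zexp) : V :=
  match e with
  | ZV n => nth 0 env n | ZA a b => zeval env a + zeval env b
  | ZO a => - zeval env a | Z0 => 0 | ZM a n => zeval env a *+ n end.
Fixpoint zcoef (e : zexp) (i : nat) : int :=
  match e with
  | ZV n => (n == i)%:Z | ZA a b => zcoef a i + zcoef b i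
  | ZO a => - zcoef a i | Z0 => 0 | ZM a n => zcoef a i *+ n end.
Lemma zevalE (V : zmodType) (env : seq V) e :
  zeval env e = \sum_(i < size env) env`_i *~ zcoef e i.
Proof.
elim: e => [n|a IHa b IHb|a IHa||a IHa n] /=.
- have [lt|ge] := ltnP n (size env).
    rewrite (bigD1 (Ordinal lt)) //= eqxx mulr1z big1 ?addr0 // => i ne.
    by rewrite -val_eqE /= eq_sym in ne; rewrite (negbTE ne).
  rewrite nth_default // big1 // => i _; case: eqP => // ?; subst n.
  by have := ltn_ord i; rewrite ltnNge ge.
- by rewrite IHa IHb -big_split; apply: eq_bigr => i _; rewrite mulrzDr.
- by rewrite IHa -sumrN; apply: eq_bigr => i _; rewrite mulrNz.
- by rewrite big1.
- by rewrite IHa -sumrMnl; apply: eq_bigr => i _; rewrite pmulrn -mulrzA -mulr_natr natz.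
Qed.
Lemma abelP (V : zmodType) (env : seq V) e1 e2 :
  all (fun i => zcoef e1 i == zcoef e2 i) (iota 0 (size env)) ->
  zeval env e1 = zeval env e2.
Proof.
move=> /allP h; rewrite !zevalE; apply: eq_bigr => i _.
by rewrite (eqP (h i _)) // mem_iota /=.
Qed.
Ltac abel_find x l :=
  match l with
  | cons x _ => constr:(O)
  | cons ?y _ => let _ := match goal with _ => unify x y end in constr:(O)
  | cons _ ?l' => let n := abel_find x l' in constr:(S n)
  end.
Ltac abel_add x l :=
  match l with
  | _ => let n := abel_find x l in l
  | _ => constr:(cons x l)
  end.
Ltac abel_env V t l :=
  lazymatch t with
  | @GRing.add _ ?a ?b => let l1 := abel_env V a l in abel_env V b l1
  | @GRing.opp _ ?a => abel_env V a l
  | @GRing.zero _ => l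
  | @GRing.natmul _ ?a _ => abel_env V a l
  | _ => abel_add t l
  end.
Ltac abel_reify t l :=
  lazymatch t with
  | @GRing.add _ ?a ?b => let x := abel_reify a l in let y := abel_reify b l in constr:(ZA x y)
  | @GRing.opp _ ?a => let x := abel_reify a l in constr:(ZO x)
  | @GRing.zero _ => constr:(Z0)
  | @GRing.natmul _ ?a ?n => let x := abel_reify a l in constr:(ZM x n)
  | _ => let n := abel_find t l in constr:(ZV n)
  end.
Ltac abel :=
  rewrite ?scale1r ?scaleN1r;
  lazymatch goal with
  | |- @eq ?T ?a ?b =>
    let l := abel_env T a (@nil T) in
    let l := abel_env T b l in
    let x := abel_reify a l in
    let y := abel_reify b l in
    refine (@abelP _ l x y _); vm_compute; reflexivity
  end.

(** Types of morphisms and quotient modules have no decidable equality, so the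
    eqType and choiceType structures that modules require are supplied by
    excluded middle and choice. *)
Section Classical.
Variable T : Type.
Definition classic_eq (x y : T) : bool := if excluded_middle_informative (x =
  y) then true else false.
Lemma classic_eqP : Equality.axiom classic_eq.
Proof. by move=> x y; rewrite /classic_eq; case: excluded_middle_informative => h; constructor. Qed.
Definition classic_hasDecEq := hasDecEq.Build T classic_eqP.
Definition classic_find (P : pred T) (n : nat) : option T :=
  match excluded_middle_informative (exists x, P x) with
  | left h => Some (proj1_sig (constructive_indefinite_description _ h))
  | right _ => None
  end.
Lemma classic_hasChoice : hasChoice T.
Proof.
apply: (@hasChoice.Build T classic_find).
- by move=> P n x; rewrite /classic_find; case: excluded_middle_informative => // h [<-];
  case: constructive_indefinite_description.
- by move=> P h; exists 0%N; rewrite /classic_find; case: excluded_middle_informative.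
- by move=> P Q /functional_extensionality ->.
Qed.
End Classical.

Definition decide (P : Prop) : bool := if excluded_middle_informative P then true else false.
Lemma decideP (P : Prop) : reflect P (decide P).
Proof. by rewrite /decide; case: excluded_middle_informative => h; constructor. Qed.

Lemma class_ext (T : Type) (C D : class T) : (forall x, C x <-> D x) -> C = D.
Proof. by move=> h; apply: functional_extensionality => x; apply: propositional_extensionality. Qed.

Notation lfst A B := (@fst A B : {linear (A * B)%type -> A}).
Notation lsnd A B := (@snd A B : {linear (A * B)%type -> B}).

Section Lin.
Variable R : nzRingType.
Implicit Types A B C P : lmodType R.

Lemma zmod0_eq (x y : zmod0 R) : x = y.
Proof. by apply/rowP => -[]. Qed.
Lemma zmod0_lin A (f : {linear zmod0 R -> A}) x : f x = 0.
Proof. by rewrite (zmod0_eq x 0) linear0. Qed.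

Lemma lin_ext A B (f g : {linear A -> B}) : f =1 g -> f = g.
Proof.
move=> h; have e : (f : A -> B) = g by apply: functional_extensionality.
case: f g h e => f [[f1] [f2]] [g [[g1] [g2]]] /= _ e; subst g.
by rewrite (proof_irrelevance _ f1 g1) (proof_irrelevance _ f2 g2).
Qed.

Definition mklin A B (f : A -> B) (h : linear f) : {linear A -> B} :=
  HB.pack f (GRing.isLinear.Build R A B *:%R f h).

Lemma choose_fun (S T : Type) (P : S -> T -> Prop) :
  (forall a, exists b, P a b) -> exists f, forall a, P a (f a).
Proof.
move=> ex; exists (fun a => proj1_sig (constructive_indefinite_description _ (ex a))) => a.
by case: constructive_indefinite_description.
Qed.

(** Linear maps are most easily described by their graphs: a total,
    single-valued relation that is a submodule is the graph of a linear map.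
    *)
Lemma lin_fun A B (P : A -> B -> Prop) :
  (forall a, exists b, P a b) ->
  (forall a b b', P a b -> P a b' -> b = b') ->
  (forall c a b a' b', P a b -> P a' b' -> P (c *: a + a') (c *: b + b')) ->
  exists f : {linear A -> B}, forall a, P a (f a).
Proof.
move=> /choose_fun [f fP] un li.
have fl : linear f by move=> c a a'; apply: un (fP _) _; apply: li.
by exists (mklin fl) => a; apply: fP.
Qed.

Lemma lin_fact A B C (j : {linear B -> C}) (t : {linear A -> C}) :
  injective j -> (forall a, exists b, j b = t a) ->
  exists f : {linear A -> B}, forall a, j (f a) = t a.
Proof.
move=> inj ex; apply: (@lin_fun A B (fun a b => j b = t a)) => //.
  by move=> a b b' e e'; apply: inj; rewrite e.
by move=> c a b a' b' e e'; rewrite !linearP e e'.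
Qed.

Lemma fact_surj A B C (p : {linear A -> B}) (f : {linear A -> C}) :
  surjective p -> (forall a, p a = 0 -> f a = 0) ->
  exists g : {linear B -> C}, forall a, g (p a) = f a.
Proof.
move=> ps h.
have eqf a a' : p a = p a' -> f a = f a'.
  by move=> e; apply/eqP; rewrite -subr_eq0 -linearB h ?linearB ?e ?subrr.
have [g gP] : exists g : {linear B -> C}, forall b, exists2 a, b = p a & g b = f a.
  apply: (@lin_fun _ _ (fun b c => exists2 a, b = p a & c = f a)).
  - by move=> b; have [a <-] := ps b; exists (f a), a.
  - by move=> b c c' [a -> ->] [a' /eqf e ->].
  - by move=> c b d b' d' [a -> ->] [a' -> ->]; exists (c *: a + a'); rewrite linearP.
by exists g => a; have [a' /eqf e ->] := gP (p a).
Qed.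

Definition lpair A B C (f : {linear A -> B}) (g : {linear A ->
  C}) (a : A) : (B * C)%type := (f a, g a).
Lemma lpair_lin A B C f g : linear (@lpair A B C f g).
Proof. by move=> c x y; rewrite /lpair !linearP. Qed.
HB.instance Definition _ A B C f g := GRing.isLinear.Build R A (B * C)%type *:%R (@lpair A B C f
  g) (@lpair_lin A B C f g).

Section Ker.
Variables (A B : lmodType R) (q : {linear A -> B}).
Record kerm := Kerm { kerm_val : A; kermP : q kerm_val == 0 }.
HB.instance Definition _ := [isSub for kerm_val].
HB.instance Definition _ := [Choice of kerm by <:].
Lemma kerm_submod : subsemimod_closed [pred a | q a == 0].
Proof.
split; first split=> [|a b]; rewrite ?inE ?linear0 //.
  by move=> /eqP ha /eqP hb; rewrite linearD ha hb addr0.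
by move=> c a; rewrite !inE => /eqP ha; rewrite linearZ /= ha scaler0.
Qed.
HB.instance Definition _ := GRing.SubChoice_isSubLmodule.Build R A [pred a | q a == 0] kerm
  kerm_submod.
Definition kinj : {linear kerm -> A} := (\val : {linear kerm -> A}).
Arguments kinj : simpl never.
Lemma kinj_inj : injective kinj. Proof. exact: val_inj. Qed.
Lemma kinjK x : q (kinj x) = 0. Proof. exact/eqP/kermP. Qed.
Lemma kinj_ex a : q a = 0 -> exists x, kinj x = a.
Proof. by move/eqP=> h; exists (Kerm h). Qed.
End Ker.

Lemma ker_lift A B C (q : {linear B -> C}) (t : {linear A -> B}) :
  (forall a, q (t a) = 0) -> exists r : {linear A -> kerm q}, forall a, kinj q (r a) = t a.
Proof. by move=> h; apply: (lin_fact (@kinj_inj _ _ q)) => a; apply: kinj_ex. Qed.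

(** Lifting from a projective along a map that need not be onto, provided its
    image contains the values to be lifted: the projection of the pullback
    onto the projective module is onto, hence has a section. *)
Lemma proj_lift A B P (d : {linear A -> B}) (f : {linear P -> B}) :
  projective P -> (forall x, exists a, d a = f x) ->
  exists g : {linear P -> A}, forall x, d (g x) = f x.
Proof.
move=> pP h; pose q : {linear (P * A)%type -> B} := pair_case f (\- d).
pose p : {linear kerm q -> P} := (lfst P A) \o kinj q.
have ps : surjective p.
  move=> x; have [a e] := h x.
  have [w ew] : exists w, kinj q w = (x, a).
    by apply: kinj_ex; rewrite /q /= /pair_case /= e subrr.
  by exists w; change ((kinj q w).1 = x); rewrite ew.
have [s sP] := pP _ _ p idfun ps.
exists (snd \o kinj q \o s) => x; have sx : (kinj q (s x)).1 = x := sP x.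
have e : f (kinj q (s x)).1 - d (kinj q (s x)).2 = 0 := kinjK (s x).
by rewrite sx in e; apply/esym/eqP; rewrite -subr_eq0; apply/eqP.
Qed.


(** The quotient by a submodule is realised inside the module, as the set of
    chosen representatives, which is a subtype and so inherits its structures.
    *)
Section Quot.
Variables (A : lmodType R) (S : A -> Prop).
Definition submodule := S 0 /\ forall c a b, S a -> S b -> S (c *: a + b).
Hypothesis HS : submodule.
Lemma subm0 : S 0. Proof. by case: HS. Qed.
Lemma submD a b : S a -> S b -> S (a + b).
Proof. by move=> ha hb; rewrite -[a]scale1r; case: HS => _; apply. Qed.
Lemma submZ c a : S a -> S (c *: a).
Proof. by move=> ha; rewrite -[_ *: _]addr0; case: HS => h0; apply. Qed.
Lemma submN a : S a -> S (- a). Proof. by rewrite -scaleN1r; apply: submZ. Qed.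
Lemma submB a b : S a -> S b -> S (a - b). Proof. by move=> ? ?; apply/submD/submN. Qed.
Definition qrep (a : A) : A := epsilon (inhabits 0) (fun b => S (a - b)).
Lemma qrepP a : S (a - qrep a).
Proof.
apply: (epsilon_spec (inhabits 0) (fun b => S (a - b))).
by exists a; rewrite subrr; apply: subm0.
Qed.
Lemma qrep_eq a b : S (a - b) -> qrep a = qrep b.
Proof.
move=> h; rewrite /qrep; congr epsilon; apply: functional_extensionality => c.
apply: propositional_extensionality; split=> hc.
  have -> : b - c = (a - c) - (a - b) by abel.
  exact: submB.
have -> : a - c = (a - b) + (b - c) by abel.
exact: submD.
Qed.
Lemma qrep_idem a : qrep (qrep a) == qrep a.
Proof. by apply/eqP/esym/qrep_eq/qrepP. Qed.
Record qcar := Quotm { qval : A; qvalP : qrep qval == qval }.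
HB.instance Definition _ := [isSub for qval].
HB.instance Definition _ := [Choice of qcar by <:].
(** The proof that S is a submodule is made part of the type, since the module
    structure on the quotient depends on it. *)
Definition quotm := (fun _ : submodule => qcar) HS.
HB.instance Definition _ := Choice.copy quotm qcar.
Definition qpi0 a : quotm := Quotm (qrep_idem a).
Lemma qpi0K (x : quotm) : qpi0 (qval x) = x.
Proof. by apply: val_inj; apply/eqP/qvalP. Qed.
Lemma qpi0E a b : qpi0 a = qpi0 b <-> S (a - b).
Proof.
split=> [[e]|/qrep_eq e]; last exact: val_inj.
have -> : a - b = (a - qrep a) - (b - qrep b) by rewrite e; abel.
by apply: submB; apply: qrepP.
Qed.
Definition qadd (x y : quotm) := qpi0 (qval x + qval y).
Definition qopp (x : quotm) := qpi0 (- qval x).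
Definition qscale (c : R) (x : quotm) := qpi0 (c *: qval x).
Lemma qpi0D a b : qadd (qpi0 a) (qpi0 b) = qpi0 (a + b).
Proof.
apply/qpi0E; rewrite /=.
have -> : qrep a + qrep b - (a + b) = - (a - qrep a) - (b - qrep b) by abel.
by apply: submB; [apply: submN|]; apply: qrepP.
Qed.
Lemma qpi0N a : qopp (qpi0 a) = qpi0 (- a).
Proof.
by apply/qpi0E; rewrite /= opprK addrC; apply: qrepP.
Qed.
Lemma qpi0Z c a : qscale c (qpi0 a) = qpi0 (c *: a).
Proof.
apply/qpi0E; rewrite /= -scalerBr -[_ - _]opprB scalerN.
by apply/submN/submZ/qrepP.
Qed.
Lemma qaddA : associative qadd.
Proof. by move=> x y z; rewrite -[x]qpi0K -[y]qpi0K -[z]qpi0K !qpi0D addrA. Qed.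
Lemma qaddC : commutative qadd.
Proof. by move=> x y; rewrite /qadd addrC. Qed.
Lemma qadd0 : left_id (qpi0 0) qadd.
Proof. by move=> x; rewrite -[x]qpi0K qpi0D add0r. Qed.
Lemma qaddN : left_inverse (qpi0 0) qopp qadd.
Proof. by move=> x; rewrite -[x]qpi0K qpi0N qpi0D addNr. Qed.
HB.instance Definition _ := GRing.isZmodule.Build quotm qaddA qaddC qadd0 qaddN.
Lemma qscaleA a b x : qscale a (qscale b x) = qscale (a * b) x.
Proof. by rewrite -[x]qpi0K !qpi0Z scalerA. Qed.
Lemma qscale1 : left_id 1 qscale.
Proof. by move=> x; rewrite -[x]qpi0K !qpi0Z scale1r. Qed.
Lemma qscaleDr : right_distributive qscale qadd.
Proof. by move=> a x y; rewrite -[x]qpi0K -[y]qpi0K !(qpi0D, qpi0Z) scalerDr. Qed.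
Lemma qscaleDl x a b : qscale (a + b) x = qadd (qscale a x) (qscale b x).
Proof. by rewrite -[x]qpi0K !(qpi0D, qpi0Z) scalerDl. Qed.
HB.instance Definition _ := GRing.Zmodule_isLmodule.Build R quotm qscaleA qscale1 qscaleDr qscaleDl.
Lemma qpi0_lin : linear qpi0.
Proof. by move=> c a b; rewrite -qpi0D -qpi0Z. Qed.
Definition qpi : {linear A -> quotm} := mklin qpi0_lin.
Lemma qpi_surj : surjective qpi.
Proof. by move=> x; exists (qval x); apply: qpi0K. Qed.
Lemma qpi_eqE a b : qpi a = qpi b <-> S (a - b).
Proof. exact: qpi0E. Qed.
Lemma qpi_eq0 a : qpi a = 0 <-> S a.
Proof. by rewrite -[a in S a]subr0 -qpi0E. Qed.
End Quot.
End Lin.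
#[global] Arguments kinj {R A B} q : simpl never.
#[global] Arguments qpi {R A S} HS : simpl never.
#[global] Arguments qpi_surj {R A S} HS y.
#[global] Arguments qpi_eq0 {R A S} HS a.
#[global] Arguments qpi_eqE {R A S} HS a b.

(** * Two-term complexes: morphisms and homotopies *)

Section TwoTermMaps.
Variable R : nzRingType.
Implicit Types X Y Z W : ktwo R.

Record kmap X Y := KMap {
  m1 : {linear km1 X -> km1 Y};
  m0 : {linear k0 X -> k0 Y};
  mC : forall x, m0 (kd X x) = kd Y (m1 x) }.

Lemma kmap_ext X Y (f g : kmap X Y) : m1 f =1 m1 g -> m0 f =1 m0 g -> f = g.
Proof.
case: f g => f1 f0 fC [g1 g0 gC] /= /lin_ext e1 /lin_ext e0; subst g1 g0.
by rewrite (proof_irrelevance _ fC gC).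
Qed.

HB.instance Definition _ X Y := classic_hasDecEq (kmap X Y).
HB.instance Definition _ X Y := classic_hasChoice (kmap X Y).

Lemma kadd_subproof X Y (f g : kmap X Y) x :
  (m0 f \+ m0 g) (kd X x) = kd Y ((m1 f \+ m1 g) x).
Proof. by rewrite /= !mC linearD. Qed.
Definition kplus X Y (f g : kmap X Y) : kmap X Y :=
  @KMap X Y (m1 f \+ m1 g) (m0 f \+ m0 g) (kadd_subproof f g).
Lemma kopp_subproof X Y (f : kmap X Y) x :
  (\- m0 f) (kd X x) = kd Y ((\- m1 f) x).
Proof. by rewrite /= mC linearN. Qed.
Definition kopp X Y (f : kmap X Y) : kmap X Y :=
  @KMap X Y (\- m1 f) (\- m0 f) (kopp_subproof f).
Lemma knul_subproof X Y x : (\0 : {linear k0 X -> k0 Y}) (kd X x) = kd Y ((\0 : {linear km1 X ->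
  km1 Y}) x).
Proof. by rewrite /= linear0. Qed.
Definition knul X Y : kmap X Y := KMap (@knul_subproof X Y).
Lemma kplusA X Y : associative (@kplus X Y).
Proof. by move=> f g h; apply: kmap_ext => x /=; rewrite addrA. Qed.
Lemma kplusC X Y : commutative (@kplus X Y).
Proof. by move=> f g; apply: kmap_ext => x /=; rewrite addrC. Qed.
Lemma kplus0 X Y : left_id (@knul X Y) (@kplus X Y).
Proof. by move=> f; apply: kmap_ext => x /=; rewrite add0r. Qed.
Lemma kplusN X Y : left_inverse (@knul X Y) (@kopp X Y) (@kplus X Y).
Proof. by move=> f; apply: kmap_ext => x /=; rewrite addNr. Qed.
HB.instance Definition _ X Y :=
  GRing.isZmodule.Build (kmap X Y) (@kplusA X Y) (@kplusC X Y) (@kplus0 X Y) (@kplusN X Y).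

Lemma m1D X Y (f g : kmap X Y) x : m1 (f + g) x = m1 f x + m1 g x. Proof. by []. Qed.
Lemma m0D X Y (f g : kmap X Y) x : m0 (f + g) x = m0 f x + m0 g x. Proof. by []. Qed.
Lemma m1N X Y (f : kmap X Y) x : m1 (- f) x = - m1 f x. Proof. by []. Qed.
Lemma m0N X Y (f : kmap X Y) x : m0 (- f) x = - m0 f x. Proof. by []. Qed.
Lemma m1_0 X Y x : m1 (0 : kmap X Y) x = 0. Proof. by []. Qed.
Lemma m0_0 X Y x : m0 (0 : kmap X Y) x = 0. Proof. by []. Qed.

Definition kid X : kmap X X := @KMap X X (idfun : {linear _ -> _}) (idfun : {linear _ ->
  _}) (fun=> erefl).
Lemma kcomp_subproof X Y Z (g : kmap Y Z) (f : kmap X Y) x :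
  (m0 g \o m0 f) (kd X x) = kd Z ((m1 g \o m1 f) x).
Proof. by rewrite /= !mC. Qed.
Definition kcomp X Y Z (g : kmap Y Z) (f : kmap X Y) : kmap X Z :=
  KMap (kcomp_subproof g f).
Notation "g \k f" := (kcomp g f) (at level 40, left associativity).

Definition mE := (m1D, m0D, m1N, m0N, m1_0, m0_0).

Lemma kcompA X Y Z W (h : kmap Z W) (g : kmap Y Z) (f : kmap X Y) :
  h \k (g \k f) = (h \k g) \k f.
Proof. exact: kmap_ext. Qed.
Lemma kcomp1l X Y (f : kmap X Y) : kid Y \k f = f. Proof. exact: kmap_ext. Qed.
Lemma kcomp1r X Y (f : kmap X Y) : f \k kid X = f. Proof. exact: kmap_ext. Qed.
Lemma kcompDl X Y Z (g g' : kmap Y Z) (f : kmap X Y) : (g + g') \k f = g \k f + g' \k f.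
Proof. exact: kmap_ext. Qed.
Lemma kcompDr X Y Z (g : kmap Y Z) (f f' : kmap X Y) : g \k (f + f') = g \k f + g \k f'.
Proof. by apply: kmap_ext => x; rewrite /= ?mE linearD. Qed.
Lemma kcompNl X Y Z (g : kmap Y Z) (f : kmap X Y) : (- g) \k f = - (g \k f).
Proof. exact: kmap_ext. Qed.
Lemma kcompNr X Y Z (g : kmap Y Z) (f : kmap X Y) : g \k (- f) = - (g \k f).
Proof. by apply: kmap_ext => x; rewrite /= ?mE linearN. Qed.
Lemma kcomp0l X Y Z (f : kmap X Y) : (0 : kmap Y Z) \k f = 0. Proof. exact: kmap_ext. Qed.
Lemma kcomp0r X Y Z (g : kmap Y Z) : g \k (0 : kmap X Y) = 0.
Proof. by apply: kmap_ext => x; rewrite /= linear0. Qed.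

(** A two-term complex sits in two adjacent degrees, so a homotopy has a
    single component, and it occurs in both equations. *)
Definition knull X Y (f : kmap X Y) := exists h : {linear k0 X -> km1 Y},
  (forall x, m1 f x = h (kd X x)) /\ (forall y, m0 f y = kd Y (h y)).
Lemma knull0 X Y : knull (0 : kmap X Y).
Proof. by exists \0; split=> x; rewrite /= ?linear0. Qed.
Lemma knullD X Y (f g : kmap X Y) : knull f -> knull g -> knull (f + g).
Proof.
move=> [h [h1 h0]] [h' [h1' h0']]; exists (h \+ h'); split=> x; rewrite mE.
  by rewrite h1 h1'.
by rewrite h0 h0' linearD.
Qed.
Lemma knullN X Y (f : kmap X Y) : knull f -> knull (- f).
Proof.
move=> [h [h1 h0]]; exists (\- h); split=> x; rewrite mE ?h1 //.
by rewrite h0 linearN.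
Qed.
Lemma knull_l X Y Z (g : kmap Y Z) (f : kmap X Y) : knull f -> knull (g \k f).
Proof.
move=> [h [h1 h0]]; exists (m1 g \o h); split=> x /=; first by rewrite h1.
by rewrite h0 mC.
Qed.
Lemma knull_r X Y Z (g : kmap Y Z) (f : kmap X Y) : knull g -> knull (g \k f).
Proof.
move=> [h [h1 h0]]; exists (h \o m0 f); split=> x /=; first by rewrite h1 mC.
by rewrite h0.
Qed.

Definition khtp X Y (f g : kmap X Y) := knull (f - g).
Lemma khtp_refl X Y (f : kmap X Y) : khtp f f.
Proof. by rewrite /khtp subrr; apply: knull0. Qed.
Lemma khtp_sym X Y (f g : kmap X Y) : khtp f g -> khtp g f.
Proof. by rewrite /khtp -(opprB f g); apply: knullN. Qed.
Lemma khtp_trans X Y (f g h : kmap X Y) : khtp f g -> khtp g h -> khtp f h.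
Proof. by move=> a b; have := knullD a b; rewrite addrA subrK. Qed.
Lemma khtp_comp X Y Z (g g' : kmap Y Z) (f f' : kmap X Y) :
  khtp g g' -> khtp f f' -> khtp (g \k f) (g' \k f').
Proof.
move=> a b; apply: (@khtp_trans _ _ _ (g' \k f)).
  by rewrite /khtp -kcompNl -kcompDl; apply: knull_r.
by rewrite /khtp -kcompNr -kcompDr; apply: knull_l.
Qed.
Lemma khtpD X Y (f f' g g' : kmap X Y) : khtp f f' -> khtp g g' -> khtp (f + g) (f' + g').
Proof. by move=> a b; have := knullD a b; rewrite /khtp opprD addrACA. Qed.
Lemma khtpN X Y (f f' : kmap X Y) : khtp f f' -> khtp (- f) (- f').
Proof. by move=> a; have := knullN a; rewrite /khtp opprD. Qed.
Lemma khtp0 X Y (f : kmap X Y) : khtp f 0 <-> knull f.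
Proof. by rewrite /khtp subr0. Qed.

End TwoTermMaps.
Notation "g \k f" := (kcomp g f) (at level 40, left associativity).
Notation "f ~~ g" := (khtp f g) (at level 70).

#[global] Instance khtp_equiv (R : nzRingType) (X Y : ktwo R) : Equivalence (@khtp R X Y).
Proof. by split; [exact: khtp_refl | exact: khtp_sym | exact: khtp_trans]. Qed.
#[global] Instance kcomp_mor (R : nzRingType) (X Y Z : ktwo R) :
  Proper (@khtp R Y Z ==> @khtp R X Y ==> @khtp R X Z)%signature (@kcomp R X Y Z).
Proof. by move=> g g' a f f' b; apply: khtp_comp. Qed.
#[global] Instance kadd_mor (R : nzRingType) (X Y : ktwo R) :
  Proper (@khtp R X Y ==> @khtp R X Y ==> @khtp R X Y)%signature (@GRing.add (kmap X Y)).
Proof. by move=> g g' a f f' b; apply: khtpD. Qed.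
#[global] Instance kopp_mor (R : nzRingType) (X Y : ktwo R) :
  Proper (@khtp R X Y ==> @khtp R X Y)%signature (@GRing.opp (kmap X Y)).
Proof. by move=> f f' b; apply: khtpN. Qed.

#[global] Hint Resolve khtp_refl : core.

(** * Comparison with complexes indexed by the integers *)

Section Translate.
Variable R : nzRingType.
Implicit Types X Y Z W : ktwo R.
Implicit Types A B C : cplx R.

Lemma hsym A B (f g : cmap A B) : homotopic f g -> homotopic g f.
Proof.
move=> [h hP]; exists (fun i => \- h i) => i x /=.
by rewrite linearN -opprD -hP opprB.
Qed.
Lemma htrans A B (f g h : cmap A B) : homotopic f g -> homotopic g h -> homotopic f h.
Proof.
move=> [u uP] [v vP]; exists (fun i => u i \+ v i) => i x /=.
by rewrite linearD addrACA -uP -vP addrA subrK.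
Qed.
Lemma hcompl A B C (g : cmap B C) (f f' : cmap A B) : homotopic f f' ->
  homotopic (ccomp g f) (ccomp g f').
Proof.
move=> [h hP]; exists (fun i => g i \o h i) => i x /=.
by rewrite -linearB hP linearD cmP.
Qed.
Lemma hcompr A B C (g g' : cmap B C) (f : cmap A B) : homotopic g g' ->
  homotopic (ccomp g f) (ccomp g' f).
Proof.
move=> [h hP]; exists (fun i => h i \o f (i + 1)) => i x /=.
by rewrite hP cmP.
Qed.

Definition of_c X Y (f : cmap X Y) : kmap X Y :=
  @KMap R X Y (cm f (Negz 0)) (cm f (Posz 0)) (@cmP R X Y f (Negz 0)).

Lemma ob_triv X (i : int) : i != Negz 0 -> i != Posz 0 -> forall x y : ktwo_ob X i, x = y.
Proof. by case: i => [[|n]|[|n]] // _ _ x y; apply/rowP => -[]. Qed.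

Definition to_c_ X Y (f : kmap X Y) (i : int) : {linear ktwo_ob X i -> ktwo_ob Y i} :=
  match i return {linear ktwo_ob X i -> ktwo_ob Y i} with
  | Negz 0 => m1 f | Posz 0 => m0 f | _ => \0 end.
(** A differential reaches degree i + 1, which is not syntactically one of the
    degrees -1 and 0; these inversions allow i itself to be substituted. *)
Lemma addz1_eqN1 (i : int) : i + 1 = Negz 0 -> i = Negz 1. Proof. by case: i => [n|[|[|n]]]. Qed.
Lemma addz1_eqN2 (i : int) : i + 1 = Negz 1 -> i = Negz 2. Proof. by case: i => [n|[|[|[|n]]]]. Qed.
Lemma addz1_eq0 (i : int) : i + 1 = Posz 0 -> i = Negz 0. Proof. by case: i => [[|n]|[|[|n]]]. Qed.
Lemma to_c_subproof X Y (f : kmap X Y) i x :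
  to_c_ f (i + 1) (cd X i x) = cd Y i (to_c_ f i x).
Proof.
move: x; case: (eqVneq (i + 1) (Negz 0)) => [/addz1_eqN1 -> x|n1].
  by rewrite /= linear0.
case: (eqVneq (i + 1) (Posz 0)) => [/addz1_eq0 -> x|n0 x]; first exact: mC.
exact: ob_triv.
Qed.
Definition to_c X Y (f : kmap X Y) : cmap X Y := @CMap R X Y (to_c_ f) (to_c_subproof f).

Lemma of_cK X Y (f : kmap X Y) : of_c (to_c f) = f.
Proof. exact: kmap_ext. Qed.

Lemma to_h X Y (f g : cmap X Y) : of_c f ~~ of_c g -> homotopic f g.
Proof.
move=> [h [h1 h0]].
pose H (i : int) : {linear X (i + 1) -> Y i} :=
  match i return {linear X (i + 1) -> Y i} with
  | Negz 0 => h | _ => \0 end.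
exists H => i; case: (eqVneq (i + 1) (Negz 0)) => [/addz1_eqN1 -> x|n1].
  by have := h1 x; rewrite mE /= add0r.
case: (eqVneq (i + 1) (Posz 0)) => [/addz1_eq0 -> x|n0 x]; last exact: ob_triv.
by have := h0 x; rewrite mE /= addr0.
Qed.
Lemma of_h X Y (f g : cmap X Y) : homotopic f g -> of_c f ~~ of_c g.
Proof.
move=> [h hP]; exists (h (Negz 0)); split=> x; rewrite mE /=.
  by have /= := hP (Negz 1) x; rewrite add0r.
by have /= := hP (Negz 0) x; rewrite linear0 addr0.
Qed.
Lemma of_hE X Y (f g : cmap X Y) : of_c f ~~ of_c g <-> homotopic f g.
Proof. by split; [exact: to_h | exact: of_h]. Qed.
Lemma of_comp X Y Z (g : cmap Y Z) (f : cmap X Y) : of_c (ccomp g f) = of_c g \k of_c f.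
Proof. exact: kmap_ext. Qed.
Lemma of_id X : of_c (cid X) = kid X. Proof. exact: kmap_ext. Qed.

Definition kinvs X Y (f : kmap X Y) (g : kmap Y X) := g \k f ~~ kid X /\ f \k g ~~ kid Y.
Definition khiso X Y (f : kmap X Y) := exists g, kinvs f g.
Lemma khisoE X Y (f : kmap X Y) : is_hiso (to_c f) <-> khiso f.
Proof.
split=> [[g [h1 h2]]|[g [h1 h2]]].
  by exists (of_c g); split; rewrite -[f]of_cK -of_comp -of_id of_hE.
exists (to_c g); split; apply: to_h; by rewrite of_comp of_id !of_cK.
Qed.
Lemma is_hisoE X Y (f : cmap X Y) : is_hiso f <-> khiso (of_c f).
Proof.
split=> [[g [h1 h2]]|[g [h1 h2]]].
  by exists (of_c g); split; rewrite -of_comp -of_id of_hE.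
exists (to_c g); split; apply: to_h; by rewrite of_comp of_id !of_cK.
Qed.
Lemma kisoE X Y : kiso X Y <-> exists f : kmap X Y, khiso f.
Proof.
split=> [[f /is_hisoE h]|[f /khisoE h]]; first by exists (of_c f).
by exists (to_c f).
Qed.
Lemma kinvs_comp X Y Z (f : kmap X Y) g (f' : kmap Y Z) g' : kinvs f g -> kinvs f' g' ->
  kinvs (f' \k f) (g \k g').
Proof.
move=> [a b] [c d]; split.
  by rewrite kcompA -(kcompA g g' f') c kcomp1r.
by rewrite kcompA -(kcompA f' f g) b kcomp1r.
Qed.
Lemma kinvs_sym X Y (f : kmap X Y) g : kinvs f g -> kinvs g f.
Proof. by case. Qed.
Lemma kiso_refl X : kiso X X.
Proof. by apply/kisoE; exists (kid X), (kid X); split; rewrite kcomp1l. Qed.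
Lemma kiso_sym X Y : kiso X Y -> kiso Y X.
Proof. by move/kisoE=> [f [g h]]; apply/kisoE; exists g, f; apply: kinvs_sym. Qed.
Lemma kiso_trans X Y Z : kiso X Y -> kiso Y Z -> kiso X Z.
Proof.
move=> /kisoE [f [g h]] /kisoE [f' [g' h']]; apply/kisoE.
by exists (f' \k f), (g \k g'); apply: kinvs_comp.
Qed.

(** E(X, Y) = 0 in coordinates. A map from X to the shift of Y is a linear map
    from the degree -1 term of X to the degree 0 term of Y, and it is null
    homotopic when it is a sum of two maps that factor through the
    differentials. *)
Definition Ev X Y := forall f : {linear km1 X -> k0 Y},
  exists (h : {linear km1 X -> km1 Y}) (h' : {linear k0 X -> k0 Y}),
  forall x, f x = kd Y (h x) + h' (kd X x).

Definition ev_c_ X Y (f : {linear km1 X -> k0 Y}) (i : int) : {linear X i -> shift Y i} :=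
  match i return {linear X i -> shift Y i} with
  | Negz 0 => f | _ => \0 end.
Lemma ev_c_subproof X Y (f : {linear km1 X -> k0 Y}) i x :
  ev_c_ f (i + 1) (cd X i x) = cd (shift Y) i (ev_c_ f i x).
Proof.
move: x; case: (eqVneq (i + 1 + 1) (Negz 0)) => [/addz1_eqN1/addz1_eqN2 -> x|n1].
  exact: (esym (oppr0 _)).
case: (eqVneq (i + 1 + 1) (Posz 0)) => [/addz1_eq0/addz1_eqN1 -> x|n0 x]; last exact: ob_triv.
by rewrite /= !linear0.
Qed.
Definition ev_c X Y (f : {linear km1 X -> k0 Y}) : cmap X (shift Y) :=
  @CMap R X (shift Y) (ev_c_ f) (ev_c_subproof f).

Lemma shift_null X Y (F : forall i, {linear X i -> shift Y i}) :
  (exists h : forall i, {linear X (i + 1) -> shift Y i}, forall i x,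
     F (i + 1) x = cd (shift Y) i (h i x) + h (i + 1) (cd X (i + 1) x)) <->
  exists (h : {linear km1 X -> km1 Y}) (h' : {linear k0 X -> k0 Y}),
     forall x, F (Negz 0) x = kd Y (h x) + h' (kd X x).
Proof.
split=> [[h hP]|[h [h' hP]]].
  exists (\- h (Negz 1)), (h (Negz 0)) => x.
  by rewrite /= linearN; apply: hP (Negz 1) x.
pose K (i : int) : {linear X (i + 1) -> shift Y i} :=
  match i return {linear X (i + 1) -> shift Y i} with
  | Negz 0 => h' | Negz 1 => \- h | _ => \0 end.
exists K => i; case: (eqVneq (i + 1) (Negz 0)) => [/addz1_eqN1 -> x|n1].
  by rewrite /= linearN opprK; apply: hP.
case: (eqVneq (i + 1) (Posz 0)) => [/addz1_eq0 -> x|n0 x].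
  by apply/rowP => -[].
have e : x = 0 by apply: ob_triv.
by rewrite e !linear0 addr0.
Qed.

Lemma EvE X Y : E_vanish X Y <-> Ev X Y.
Proof.
split=> H f; first exact: ((shift_null (cm (ev_c f))).1 (H _)).
exact: ((shift_null (cm f)).2 (H _)).
Qed.

Lemma hom_shiftE X Y (f f' : cmap X (shift Y)) :
  homotopic f f' <-> exists (h : {linear km1 X -> km1 Y}) (h' : {linear k0 X -> k0 Y}),
    forall x, cm f (Negz 0) x - cm f' (Negz 0) x = kd Y (h x) + h' (kd X x).
Proof. exact: (shift_null (fun i => cm f i \- cm f' i)). Qed.
End Translate.

(** * Quasi-isomorphisms and extensions of two-term complexes *)

Section Quasi.
Variable R : nzRingType.
Implicit Types X Y Z W : ktwo R.

Lemma lin_inj (A B : lmodType R) (f : {linear A -> B}) : (forall x, f x = 0 -> x = 0) ->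
  injective f.
Proof. by move=> h x y e; apply/eqP; rewrite -subr_eq0; apply/eqP/h; rewrite linearB e subrr. Qed.

Lemma proj_sect (P M : lmodType R) (q : {linear M -> P}) : projective P -> surjective q ->
  exists s : {linear P -> M}, forall y, q (s y) = y.
Proof. by move=> pP sq; apply: (proj_lift (f := idfun) pP). Qed.

(** Exactness of the mapping cone of f, which has three terms: it says that f
    is a quasi-isomorphism, in a form that chases can use directly. *)
Definition kqis X Y (f : kmap X Y) :=
  [/\ forall y0, exists x0 y1, y0 = m0 f x0 + kd Y y1,
      forall x0 y1, m0 f x0 = kd Y y1 -> exists2 x1, x0 = kd X x1 & y1 = m1 f x1
    & forall x1, kd X x1 = 0 -> m1 f x1 = 0 -> x1 = 0].

(** The cone of a quasi-isomorphism is an exact three-term complex that ends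
    in a projective, hence splits; the components of a splitting are an
    inverse up to homotopy together with the two homotopies. *)
Lemma kqis_hiso X Y (f : kmap X Y) : kqis f -> khiso f.
Proof.
move=> [onto mid inj].
pose q : {linear (k0 X * km1 Y)%type -> k0 Y} := pair_case (m0 f) (kd Y).
have [s sP] : exists s : {linear k0 Y -> (k0 X * km1 Y)%type}, forall y, q (s y) = y.
  apply: proj_sect; first by case: (k0P Y).
  by move=> y; have [x0 [y1 ->]] := onto y; exists (x0, y1).
pose g0 : {linear k0 Y -> k0 X} := fst \o s.
pose k : {linear k0 Y -> km1 Y} := snd \o s.
have gk y : m0 f (g0 y) + kd Y (k y) = y by exact: sP.
pose j : {linear km1 X -> (k0 X * km1 Y)%type} := lpair (kd X) (m1 f).
have ji : injective j by apply: lin_inj => x [e1 e2]; apply: inj.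
have [g1 g1P] : exists g1 : {linear km1 Y -> km1 X}, forall y,
    j (g1 y) = (lpair (g0 \o kd Y) (idfun \- (k \o kd Y)) : {linear _ -> _}) y.
  apply: lin_fact => // y; have /= := mid (g0 (kd Y y)) (y - k (kd Y y)).
  case=> [|x1 e1 e2]; first by rewrite linearB /= -[X in X - _]gk addrK.
  by exists x1; rewrite /= /lpair /= -e1 -e2.
have [h hP] : exists h : {linear k0 X -> km1 X}, forall x,
    j (h x) = (lpair (idfun \- (g0 \o m0 f)) (k \o m0 f) : {linear _ -> _}) x.
  apply: lin_fact => // x; have /= := mid (x - g0 (m0 f x)) (k (m0 f x)).
  case=> [|x1 e1 e2]; first by rewrite linearB /= -[X in X - _]gk addrC addKr.
  by exists x1; rewrite /= /lpair /= -e1 -e2.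
have g1E y : kd X (g1 y) = g0 (kd Y y) by case: (g1P y).
have fg1 y : m1 f (g1 y) = y - k (kd Y y) by case: (g1P y).
have dh x : kd X (h x) = x - g0 (m0 f x) by case: (hP x).
have fh x : m1 f (h x) = k (m0 f x) by case: (hP x).
pose g : kmap Y X := @KMap R Y X g1 g0 (fun y => esym (g1E y)).
exists g; split.
  apply: khtp_sym; exists h; split=> x; rewrite mE /=; last by rewrite dh.
  apply: ji; rewrite /= /lpair /=; congr (_, _).
    by rewrite dh linearB /= g1E mC.
  by rewrite fh linearB /= fg1 opprB addrC subrK mC.
apply: khtp_sym; exists k; split=> y; rewrite mE /=.
  by rewrite fg1 opprB addrC subrK.
by rewrite -[X in X - _]gk addrC addKr.
Qed.

Lemma khiso_qis X Y (f : kmap X Y) : khiso f -> kqis f.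
Proof.
move=> [g [[h [h1 h0]] [k [k1 k0]]]].
have gf1 x : x = m1 g (m1 f x) - h (kd X x) by rewrite -h1 mE /= opprD opprK addNKr.
have gf0 x : x = m0 g (m0 f x) - kd X (h x) by rewrite -h0 mE /= opprD opprK addNKr.
have fg1 x : x = m1 f (m1 g x) - k (kd Y x) by rewrite -k1 mE /= opprD opprK addNKr.
have fg0 x : x = m0 f (m0 g x) - kd Y (k x) by rewrite -k0 mE /= opprD opprK addNKr.
split.
- by move=> y; exists (m0 g y), (- k y); rewrite linearN -fg0.
- move=> x0 y1 e; pose x1 := m1 g y1 - h x0.
  have e1 : kd X x1 = x0 by rewrite /x1 linearB /= -mC -e -gf0.
  have e2 : kd Y (y1 - m1 f x1) = 0 by rewrite linearB /= -mC e1 e subrr.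
  exists (x1 + m1 g (y1 - m1 f x1)).
    by rewrite [RHS]linearD /= -mC e2 linear0 addr0.
  have e3 : m1 f (m1 g (y1 - m1 f x1)) = y1 - m1 f x1 by rewrite [RHS]fg1 e2 !linear0 addr0.
  by rewrite [RHS]linearD /= e3 addrC subrK.
- by move=> x e1 e2; rewrite [x]gf1 e1 e2 !linear0 ?(subr0, addr0).
Qed.
End Quasi.

Section Extension.
Variable R : nzRingType.
Implicit Types X Y Z W A B C : ktwo R.

(** The extension of C by A with class e: the direct sum of A and C, with e
    added to the differential. It is the cocone of the map from C to the shift
    of A given by e, up to sign. *)
Definition kext_d A C (e : {linear km1 C -> k0 A}) (u : (km1 A * km1 C)%type) :
  (k0 A * k0 C)%type :=
  (kd A u.1 + e u.2, kd C u.2).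
Lemma kext_d_lin A C e : linear (@kext_d A C e).
Proof.
move=> c u v; apply/pair_equal_spec; split; rewrite /= !linearP /= ?scalerDr; abel.
Qed.
HB.instance Definition _ A C e := GRing.isLinear.Build R _ _ *:%R (@kext_d A C e) (@kext_d_lin A
  C e).
Definition kext A C e : ktwo R :=
  @KTwo R (km1 A * km1 C)%type (k0 A * k0 C)%type (@kext_d A C e)
    (fg_projective_sum (km1P A) (km1P C)) (fg_projective_sum (k0P A) (k0P C)).

Lemma kext_i_sub A C e x : (@pair_inl R (k0 A) (k0 C)) (kd A x) =
  kd (@kext A C e) (@pair_inl R (km1 A) (km1 C) x).
Proof. by rewrite /= /pair_inl /kext_d /= !linear0 addr0. Qed.
Definition kext_i A C e : kmap A (@kext A C e) :=
  @KMap R A (kext e) (@pair_inl R (km1 A) (km1 C)) (@pair_inl R (k0 A) (k0 C)) (@kext_i_sub A C e).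
Lemma kext_p_sub A C e x : (lsnd (k0 A) (k0 C)) (kd (@kext A C e) x) =
  kd C ((lsnd (km1 A) (km1 C)) x).
Proof. by []. Qed.
Definition kext_p A C e : kmap (@kext A C e) C :=
  @KMap R (kext e) C (lsnd (km1 A) (km1 C)) (lsnd (k0 A) (k0 C)) (@kext_p_sub A C e).

Section Cplx.
Implicit Types P Q S : cplx R.
Lemma hiso_cycle_surj P Q (f : cmap P Q) : is_hiso f -> forall i (y :
  Q (i + 1)), cd Q (i + 1) y = 0 ->
  exists x : P (i + 1), cd P (i + 1) x = 0 /\ exists y', y = f (i + 1) x + cd Q i y'.
Proof.
move=> [g [_ [h hP]]] i y dy; exists (g (i + 1) y); split; first by rewrite -cmP dy linear0.
have := hP i y; rewrite dy linear0 addr0 /= => e.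
by exists (- h i y); rewrite linearN -e; abel.
Qed.
Lemma hiso_boundary_inj P Q (f : cmap P Q) : is_hiso f -> forall i (x :
  P (i + 1)), cd P (i + 1) x = 0 ->
  forall y', f (i + 1) x = cd Q i y' -> exists x', x = cd P i x'.
Proof.
move=> [g [[h hP] _]] i x dx y' e.
have := hP i x; rewrite dx linear0 addr0 /= e cmP => e'.
by exists (g i y' - h i x); rewrite linearB -e'; abel.
Qed.
End Cplx.

(** A triangle on h is isomorphic to the standard triangle of some f', through
    a, b and c. The homotopy K between the two maps from Z to the shift of A'
    corrects the second component of c to a map cB such that f' a and cB
    together form a chain map to B' from the cocone of h. The two chases below
    are surjectivity and injectivity of that map on cohomology; they are the
    part of the five lemma that is needed to see that the middle term of a
    triangle is determined by its connecting map. *)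
Section Triangle.
Variables (X Y Z : ktwo R) (h : cmap Z (shift X)).
Variables (A' B' : cplx R) (f' : cmap A' B').
Variables (a : cmap X A') (c : cmap Z (cone f')).
Hypotheses (ha : is_hiso a) (hc : is_hiso c).
Variable K : forall i, {linear Z (i + 1) -> A' (i + 1)}.
Hypothesis KP : forall i z, a (i + 1 + 1) (h (i + 1) z) - (c (i + 1) z).1 =
  - cd A' (i + 1) (K i z) + K (i + 1) (cd Z (i + 1) z).

Let hd i z : h (i + 1) (cd Z i z) = - cd X (i + 1) (h i z).
Proof. exact: cmP. Qed.
Let cd1 i z : (c (i + 1) (cd Z i z)).1 = - cd A' (i + 1) (c i z).1.
Proof. by rewrite cmP. Qed.
Let cd2 i z : (c (i + 1) (cd Z i z)).2 = f' (i + 1) (c i z).1 + cd B' i (c i z).2.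
Proof. by rewrite cmP. Qed.

Definition cB i : {linear Z (i + 1) -> B' (i + 1)} :=
  (snd \o cm c (i + 1)) \+ (cm f' (i + 1) \o K i).

Let c1E i z : (c (i + 1) z).1 = a (i + 1 + 1) (h (i + 1) z) + cd A' (i + 1) (K i z) - K (i + 1)
  (cd Z (i + 1) z).
Proof.
have := KP z; move: (a _ _) (c _ _).1 (cd A' _ _) (K _ (cd _ _ _)) => p q r s /eqP.
by rewrite subr_eq => /eqP ->; abel.
Qed.

Lemma cB_d i z : cB (i + 1) (cd Z (i + 1) z) =
  f' (i + 1 + 1) (a (i + 1 + 1) (h (i + 1) z)) + cd B' (i + 1) (cB i z).
Proof. by rewrite /= cd2 c1E !linearD linearN /= !cmP; abel. Qed.

Lemma chase_s i (y : B' (i + 1)) : cd B' (i + 1) y = 0 ->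
  exists (x : X (i + 1)) (z : Z (i + 1)) (b : B' i),
  [/\ cd Z (i + 1) z = 0, cd X (i + 1) x = h (i + 1) z & y =
    f' (i + 1) (a (i + 1) x) + cB i z + cd B' i b].
Proof.
move=> dy.
have dy' : cd (cone f') (i + 1) (0, y) = 0.
  by rewrite /= /cone_d /= !linear0 ?oppr0 add0r dy.
have [z [dz [[al be] [e1 e2]]]] := hiso_cycle_surj hc dy'.
rewrite /= in e1 e2.
have ea : a (i + 1 + 1) (h (i + 1) z) = cd A' (i + 1) (al - K i z).
  move: e1; rewrite c1E dz linear0 subr0 linearB /= => /esym/eqP; rewrite subr_eq0 => /eqP <-; abel.
have [x ex] : exists x, h (i + 1) z = cd X (i + 1) x.
  by apply: (hiso_boundary_inj ha _ ea); move: (hd z); rewrite dz linear0 => /eqP;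
    rewrite eq_sym oppr_eq0 => /eqP.
have [x' [dx' [al' eal]]] : exists x', cd X (i + 1) x' = 0 /\ exists al',
  a (i + 1) x - (al - K i z) = a (i + 1) x' + cd A' i al'.
  by apply: (hiso_cycle_surj ha); rewrite linearB -cmP -ex ea subrr.
exists (x - x'), z, (be - f' i al'); split=> //; first by rewrite linearB dx' subr0.
have eal2 : a (i + 1) (x - x') = cd A' i al' + al - K i z.
  have -> : a (i + 1) (x - x') = a (i + 1) x - a (i + 1) x' by rewrite linearB.
  have -> : a (i + 1) x = (a (i + 1) x - (al - K i z)) + (al - K i z) by rewrite subrK.
  by rewrite eal; abel.
rewrite eal2 e2 /= linearB !linearD linearN /= cmP; abel.
Qed.

Lemma chase_i i (x : X (i + 1 + 1)) (z : Z (i + 1 + 1)) (b : B' (i + 1)) :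
  cd Z (i + 1 + 1) z = 0 -> cd X (i + 1 + 1) x = h (i + 1 + 1) z ->
  f' (i + 1 + 1) (a (i + 1 + 1) x) + cB (i + 1) z = cd B' (i + 1) b ->
  exists (x0 : X (i + 1)) (z0 : Z (i + 1)), z = cd Z (i + 1) z0 /\ x =
    cd X (i + 1) x0 - h (i + 1) z0.
Proof.
move=> dz dx e.
have [z1 ez1] : exists z1, z = cd Z (i + 1) z1.
  apply: (hiso_boundary_inj hc dz (y' := (- (a (i + 1 + 1) x + K (i + 1) z), b))).
  rewrite [LHS]surjective_pairing /= /cone_d; congr (_, _).
    by rewrite c1E dz linear0 -dx cmP !linearN linearD /= opprK subr0.
  by rewrite /= -e linearN linearD /=; abel.
pose x1 := x + h (i + 1) z1.
have dx1 : cd X (i + 1 + 1) x1 = 0.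
  by rewrite linearD dx ez1 hd addNr.
pose b1 := b - cB i z1.
have eb1 : f' (i + 1 + 1) (a (i + 1 + 1) x1) = cd B' (i + 1) b1.
  rewrite linearB -e /x1 [in LHS]linearD linearD ez1 cB_d; abel.
have [z2 [dz2 [[al be] [e1 e2]]]] : exists z2, cd Z (i + 1) z2 = 0 /\ exists y',
    (a (i + 1 + 1) x1, - b1) = c (i + 1) z2 + cd (cone f') i y'.
  apply: (hiso_cycle_surj hc); rewrite /= /cone_d /=; congr (_, _).
    by rewrite -cmP dx1 linear0 oppr0.
  by rewrite eb1 linearN subrr.
have [x0 ex0] : exists x0, x1 - h (i + 1) z2 = cd X (i + 1) x0.
  apply: (hiso_boundary_inj ha _ (y' := K i z2 - al)).
    by rewrite linearB dx1 sub0r -hd dz2 linear0.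
  rewrite /= in e1; rewrite linearB e1 c1E dz2 linear0 linearB /=; abel.
exists x0, (z1 - z2); split; first by rewrite linearB dz2 subr0.
by rewrite -ex0 linearB /x1 /=; abel.
Qed.
End Triangle.
End Extension.

Section Confl.
Variable R : nzRingType.
Implicit Types X Y Z W A B C : ktwo R.

Lemma pair_caseL (M N P : lmodType R) (f : {linear M -> P}) (g : {linear N -> P}) x :
  pair_case f g (pair_inl N x) = f x.
Proof. by rewrite /pair_case /= linear0 addr0. Qed.

(** The mapping cone is exact as soon as f is bijective on cohomology in both
    degrees. *)
Lemma kqis_cohomology X Y (f : kmap X Y) :
  (forall y0, exists x0 y1, y0 = m0 f x0 + kd Y y1) ->
  (forall x0 y1, m0 f x0 = kd Y y1 -> exists x1, x0 = kd X x1) ->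
  (forall y1, kd Y y1 = 0 -> exists x1, kd X x1 = 0 /\ y1 = m1 f x1) ->
  (forall x1, kd X x1 = 0 -> m1 f x1 = 0 -> x1 = 0) -> kqis f.
Proof.
move=> s0 i0 s1 i1; split=> // x0 y1 e.
have [x1 ex1] := i0 _ _ e.
have [|x2 [dx2 e2]] := s1 (y1 - m1 f x1).
  by rewrite linearB /= -mC -ex1 e subrr.
by exists (x1 + x2); rewrite linearD ?dx2 ?addr0 //= -e2; abel.
Qed.

(** In a distinguished triangle the middle term is the extension with class
    minus the connecting map, compatibly with the map from X: the map from the
    extension to B' given by the chases is a quasi-isomorphism, and composing
    it with an inverse of b lands in Y. *)
Lemma distinguished_kext X Y Z (f : cmap X Y) (g : cmap Y Z) (h : cmap Z (shift X)) :
  distinguished f g h ->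
  exists2 phi : kmap (kext (\- cm h (Negz 0) : {linear km1 Z ->
    k0 X})) Y, khiso phi & phi \k kext_i _ ~~ of_c f.
Proof.
move=> [A' [B' [f' [a [b [c [[ha hb hc] [hbf _ hh]]]]]]]].
have [K KP] := hh.
pose e : {linear km1 Z -> k0 X} := (\- cm h (Negz 0) : {linear km1 Z -> k0 X}).
have [b' [bb1 bb2]] := hb.
have hb' : is_hiso b' by exists b.
have KP' : forall i z, a (i + 1 + 1) (h (i + 1) z) - (c (i + 1) z).1 =
  - cd A' (i + 1) (K i z) + K (i + 1) (cd Z (i + 1) z).
  by move=> i z; apply: KP.
pose p1 : {linear km1 (kext e) -> B' (Negz 0)} :=
  pair_case (cm f' (Negz 0) \o cm a (Negz 0) : {linear km1 X -> B' (Negz 0)}) (cB c K (Negz 1)).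
pose p0 : {linear k0 (kext e) -> B' (Posz 0)} :=
  pair_case (cm f' (Posz 0) \o cm a (Posz 0) : {linear k0 X -> B' (Posz 0)}) (cB c K (Negz 0)).
pose F : {linear k0 X -> B' (Posz 0)} := cm f' (Posz 0) \o cm a (Posz 0).
have pC x : p0 (kd (kext e) x) = cd B' (Negz 0) (p1 x).
  have eZ : cB c K (Negz 0) (kd Z x.2) = F (h (Negz 0) x.2) + cd B' (Negz 0) (cB c K (Negz 1) x.2).
    exact: (@cB_d R X Z h A' B' f' a c K KP' (Negz 1) x.2).
  have eX : F (kd X x.1) = cd B' (Negz 0) (f' (Negz 0) (a (Negz 0) x.1)).
    by apply: etrans (congr1 (cm f' (Posz 0)) (@cmP _ _ _ a (Negz 0) x.1)) _;
      exact: (@cmP _ _ _ f' (Negz 0) (cm a (Negz 0) x.1)).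
  have -> : p0 (kd (kext e) x) = F (kd X x.1 - h (Negz 0) x.2) + cB c K (Negz 0) (kd Z x.2) by [].
  have -> : cd B' (Negz 0) (p1 x) = cd B' (Negz 0) (f' (Negz 0) (a (Negz 0) x.1)) + cd B' (Negz
    0) (cB c K (Negz 1) x.2).
    exact: linearD.
  by rewrite eZ -eX linearB; abel.
have phiC x : (cm b' (Posz 0) \o p0) (kd (kext e) x) = kd Y ((cm b' (Negz 0) \o p1) x).
  by rewrite /= [p0 _]pC; exact: (@cmP _ _ _ b' (Negz 0)).
pose phi : kmap (kext e) Y :=
  @KMap R (kext e) Y (cm b' (Negz 0) \o p1 : {linear _ -> km1 Y}) (cm b' (Posz 0) \o p0 :
    {linear _ -> k0 Y}) phiC.
exists phi; last first.
  have -> : phi \k kext_i e = of_c (ccomp b' (ccomp f' a)).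
    apply: kmap_ext => x.
      by have /(congr1 (cm b' (Negz 0))) := pair_caseL (cm f' (Negz 0) \o cm a (Negz 0) :
      {linear km1 X -> B' (Negz 0)}) (cB c K (Negz 1)) x.
    by have /(congr1 (cm b' (Posz 0))) := pair_caseL (cm f' (Posz 0) \o cm a (Posz 0) :
      {linear k0 X -> B' (Posz 0)}) (cB c K (Negz 0)) x.
  apply/of_hE; apply: htrans (_ : homotopic (ccomp b' (ccomp b f)) f).
    by apply/hcompl/hsym.
  exact: (hcompr f bb1).
apply: kqis_hiso; apply: kqis_cohomology.
- move=> y.
  have dy : cd Y (Negz 0 + 1) y = 0 by apply/rowP => -[].
  have [u [du [y' ey]]] := hiso_cycle_surj hb' dy.
  have [x [z [be [dz dx eu]]]] := chase_s ha hc KP' du.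
  exists (x, z), (y' + cm b' (Negz 0) be).
  pose w : B' (Posz 0) := f' (Posz 0) (a (Posz 0) x) + cB c K (Negz 0) z.
  have eu' : u = w + cd B' (Negz 0) be := eu.
  have eb : cm b' (Posz 0) u = cm b' (Posz 0) w + cd Y (Negz 0) (cm b' (Negz 0) be).
    by rewrite eu' linearD; congr (_ + _); exact: (@cmP _ _ _ b' (Negz 0)).
  have E : m0 phi (x, z) = cm b' (Posz 0) w by [].
  have D : kd Y (y' + cm b' (Negz 0) be) = cd Y (Negz 0) y' + cd Y (Negz 0) (cm b' (Negz 0) be)
    := linearD _ _ _.
  by rewrite E ey D [cm b' _ u]eb; abel.
- move=> [x z] y ey.
  pose w : B' (Posz 0) := f' (Posz 0) (a (Posz 0) x) + cB c K (Negz 0) z.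
  have dw : cd B' (Posz 0) w = 0.
    have D : cd B' (Posz 0) w = cd B' (Posz 0) (f' (Posz 0) (a (Posz 0) x)) + cd B' (Posz 0) (cB
      c K (Negz 0) z) := linearD _ _ _.
    have F1 : cd B' (Posz 0) (f' (Posz 0) (a (Posz 0) x)) = 0.
      rewrite -!cmP (_ : cd X (Posz 0) x = 0) ?linear0 //; by apply/rowP => -[].
    have F2 : cd B' (Posz 0) (cB c K (Negz 0) z) = 0.
      have e1 := cB_d KP' (z : Z (Negz 0 + 1)).
      have e2 : h (Negz 0 + 1) z = 0 by apply/rowP => -[].
      have e3 : cd Z (Negz 0 + 1) z = 0 by apply/rowP => -[].
      move: e1; rewrite e2 e3 !linear0 => e1; symmetry; apply: etrans e1 _; exact: add0r.
    by rewrite D F1 F2; exact: add0r.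
  have [be ebe] := @hiso_boundary_inj R B' Y b' hb' (Negz 0) w dw y ey.
  have [] := @chase_i R X Z h A' B' f' a c ha hc K KP' (Negz 1) x z be _ _ ebe.
  + by apply/rowP => -[].
  + by apply/rowP => -[].
  move=> x0 [z0 [ez ex]]; exists (x0, z0); rewrite /kext_d /= ez ex; congr (_, _).
- move=> y dy.
  have [u [du [y' ey]]] := @hiso_cycle_surj R B' Y b' hb' (Negz 1) y dy.
  have [x [z [be [dz dx eu]]]] := chase_s ha hc KP' du.
  exists (x, z); split.
    by apply/pair_equal_spec; split; [apply/eqP; rewrite subr_eq0; apply/eqP | exact: dz].
  pose w : B' (Negz 0) := f' (Negz 0) (a (Negz 0) x) + cB c K (Negz 1) z.
  have eu' : u = w + cd B' (Negz 1) be := eu.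
  have E : m1 phi (x, z) = cm b' (Negz 0) w by [].
  have D1 : cm b' (Negz 0) (cd B' (Negz 1) be) = 0.
    apply: etrans (@cmP _ _ _ b' (Negz 1) be) _; by rewrite [cm b' _ be](_ : _ = 0) ?linear0 //;
      apply/rowP => -[].
  have D2 : cd Y (Negz 1) y' = 0.
    by rewrite [y'](_ : _ = 0) ?linear0 //; apply/rowP => -[].
  rewrite E [LHS]ey [cd Y _ y']D2 addr0 [u]eu'.
  by rewrite [LHS]linearD [X in _ + X]D1 addr0.
- move=> [x z] /pair_equal_spec [/= dx dz] ex.
  pose w : B' (Negz 0) := f' (Negz 0) (a (Negz 0) x) + cB c K (Negz 1) z.
  have dw : cd B' (Negz 0) w = 0.
    have <- : p0 (kd (kext e) (x, z)) = cd B' (Negz 0) w by exact: pC.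
    have -> : kd (kext e) (x, z) = 0 by apply/pair_equal_spec.
    exact: linear0.
  have [be ebe] := @hiso_boundary_inj R B' Y b' hb' (Negz 1) w dw 0 ex.
  have [] := @chase_i R X Z h A' B' f' a c ha hc K KP' (Negz 2) x z be dz _ ebe.
  + by apply/eqP; rewrite -subr_eq0; apply/eqP.
  move=> x0 [z0 [-> ->]]; have -> : x0 = 0 by apply/rowP => -[].
  have -> : z0 = 0 by apply/rowP => -[].
  by rewrite !linear0 ?addr0.
Qed.
End Confl.

Section Confl2.
Variable R : nzRingType.
Implicit Types X Y Z W A B C : ktwo R.

Lemma homotopic_eq (P Q : cplx R) (f g : cmap P Q) : (forall i x, f i x = g i x) -> homotopic f g.
Proof. by move=> e; exists (fun=> \0) => i x; rewrite e /= subrr linear0 addr0. Qed.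
Lemma hiso_id (P : cplx R) : is_hiso (cid P).
Proof. by exists (cid P); split; apply: homotopic_eq. Qed.

(** Conversely, an extension lies in a distinguished triangle: the cone of the
    inclusion of X contracts onto Z. The maps gp1 and gin2 are the degreewise
    splittings of the extension, which are not chain maps; the failure of each
    to commute with the differentials is the connecting map h. *)
Section Std.
Variables (X Z : ktwo R) (e : {linear km1 Z -> k0 X}).
Let E := kext e.
Let F : cmap X E := to_c (kext_i e).
Let G : cmap E Z := to_c (kext_p e).
Let h : cmap Z (shift X) := ev_c (\- e).

Definition gp1 i : {linear E i -> X i} :=
  match i return {linear ktwo_ob E i -> ktwo_ob X i} with
  | Negz 0 => @fst _ _ : {linear (km1 X * km1 Z)%type -> _}
  | Posz 0 => @fst _ _ : {linear (k0 X * k0 Z)%type -> _} | _ => \0 end.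
Definition gin2 i : {linear Z i -> E i} :=
  match i return {linear ktwo_ob Z i -> ktwo_ob E i} with
  | Negz 0 => @pair_inr _ (km1 X) (km1 Z)
  | Posz 0 => @pair_inr _ (k0 X) (k0 Z) | _ => \0 end.

Let gp1F i x : gp1 i (F i x) = x.
Proof. by move: x; case: i => [[|n]|[|n]] x //; apply/rowP => -[]. Qed.
Let GF i x : G i (F i x) = 0.
Proof. by move: x; case: i => [[|n]|[|n]] x //; apply/rowP => -[]. Qed.
Let Gin2 i x : G i (gin2 i x) = x.
Proof. by move: x; case: i => [[|n]|[|n]] x //; apply/rowP => -[]. Qed.
Let Edec i u : u = F i (gp1 i u) + gin2 i (G i u).
Proof.
move: u; case: i => [[|n]|[|n]]; try by move=> u; apply/rowP => -[].
  by move=> [x z]; apply/pair_equal_spec; rewrite /= addr0 add0r.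
by move=> [x z]; apply/pair_equal_spec; rewrite /= addr0 add0r.
Qed.
Let gp1d i u : gp1 (i + 1) (cd E i u) = cd X i (gp1 i u) - h i (G i u).
Proof.
move: u; case: (eqVneq (i + 1) (Negz 0)) => [/addz1_eqN1 -> u|n1].
  by rewrite [u](_ : _ = 0) ?linear0 ?addr0 //; apply/rowP => -[].
case: (eqVneq (i + 1) (Posz 0)) => [/addz1_eq0 -> [x z]|n0 u]; last exact: ob_triv.
by rewrite /= opprK.
Qed.
Let din2 i z : cd E i (gin2 i z) = gin2 (i + 1) (cd Z i z) - F (i + 1) (h i z).
Proof.
move: z; case: (eqVneq (i + 1) (Negz 0)) => [/addz1_eqN1 -> u|n1].
  by rewrite [u](_ : _ = 0) ?linear0 ?addr0 //; apply/rowP => -[].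
case: (eqVneq (i + 1) (Posz 0)) => [/addz1_eq0 -> z|n0 u]; last exact: ob_triv.
by apply/pair_equal_spec; rewrite /kext_d /= !linear0 opprK !add0r addr0.
Qed.

Definition std_c_ i : {linear Z i -> cone F i} := lpair (cm h i) (gin2 i).
Lemma std_cP i z : std_c_ (i + 1) (cd Z i z) = cd (cone F) i (std_c_ i z).
Proof.
apply/pair_equal_spec; split; first exact: (@cmP _ _ _ h i z).
have -> : cd E i (gin2 i z) = gin2 (i + 1) (cd Z i z) - F (i + 1) (h i z) := din2 z.
rewrite /=; abel.
Qed.
Definition std_c : cmap Z (cone F) := CMap std_cP.
Definition std_r_ i : {linear cone F i -> Z i} := cm G i \o (@snd _ _ :
  {linear (X (i + 1)%R * E i)%type -> _}).
Lemma std_rP i w : std_r_ (i + 1) (cd (cone F) i w) = cd Z i (std_r_ i w).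
Proof.
rewrite /std_r_ -(@cmP _ _ _ G i w.2) /=; set u := cd E i _.
have -> : to_c_ (kext_p e) (i + 1) (to_c_ (kext_i e) (i + 1) w.1 + u) =
  G (i + 1) (F (i + 1) w.1 + u) by [].
rewrite linearD GF; exact: add0r.
Qed.
Definition std_r : cmap (cone F) Z := CMap std_rP.

Lemma std_rc : homotopic (ccomp std_r std_c) (cid Z).
Proof. by apply: homotopic_eq => i x; apply: Gin2. Qed.

Lemma std_cr : homotopic (ccomp std_c std_r) (cid (cone F)).
Proof.
pose k i : {linear cone F (i + 1) -> cone F i} :=
  lpair (\- (gp1 (i + 1) \o (@snd _ _ : {linear (X (i + 1 + 1)%R * E (i + 1)%R)%type -> _}))) \0.
exists k => i [x u]; apply/pair_equal_spec; split.
  change (h (i + 1) (G (i + 1) u) - x =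
     - cd X (i + 1) (- gp1 (i + 1) u) - gp1 (i + 1 + 1) (F (i + 1 + 1) x + cd E (i + 1) u)).
  rewrite linearN opprK linearD gp1F gp1d; abel.
change (gin2 (i + 1) (G (i + 1) u) - u = F (i + 1) (- gp1 (i + 1) u) + cd E i 0 + 0).
have := Edec u; rewrite linearN linear0.
move: (F (i + 1) (gp1 (i + 1) u)) (gin2 (i + 1) (G (i + 1) u)) => p q ->; abel.
Qed.

Lemma kext_distinguished : distinguished F G h.
Proof.
exists X, E, F, (cid X), (cid E), std_c; split; split; try exact: hiso_id.
- by exists std_r; split; [exact: std_rc | exact: std_cr].
- exact: homotopic_eq.
- apply: htrans (_ : homotopic (ccomp (ccomp std_c std_r) (cone_in F)) _).
    exact: homotopic_eq.
  apply: htrans (hcompr (cone_in F) std_cr) _.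
  exact: homotopic_eq.
- exact: homotopic_eq.
Qed.
End Std.

Lemma distinguished_iso X Y Y' Z (f : cmap X Y) (g : cmap Y Z) h (b : cmap Y' Y) (b' : cmap Y Y') :
  homotopic (ccomp b' b) (cid _) -> homotopic (ccomp b b') (cid _) ->
  distinguished f g h -> distinguished (ccomp b' f) (ccomp g b) h.
Proof.
move=> h1 h2 [A' [B' [f' [a [b0 [c [[ha hb hc] [hbf hg hh]]]]]]]].
exists A', B', f', a, (ccomp b0 b), c; split; split=> //.
- have [b1 [e1 e2]] := hb; exists (ccomp b' b1); split.
    apply: htrans (_ : homotopic (ccomp b' (ccomp (ccomp b1 b0) b)) _); first exact: homotopic_eq.
    apply: htrans (hcompl _ (hcompr _ e1)) _.
    by apply: htrans h1; apply: homotopic_eq.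
  apply: htrans (_ : homotopic (ccomp b0 (ccomp (ccomp b b') b1)) _); first exact: homotopic_eq.
  apply: htrans (hcompl _ (hcompr _ h2)) _.
  by apply: htrans e2; apply: homotopic_eq.
- apply: htrans (_ : homotopic (ccomp b0 (ccomp (ccomp b b') f)) _); first exact: homotopic_eq.
  apply: htrans (hcompl _ (hcompr _ h2)) _.
  by apply: htrans hbf; apply: homotopic_eq.
- apply: htrans (_ : homotopic (ccomp (ccomp c g) b) _); first exact: homotopic_eq.
  apply: htrans (hcompr _ hg) _; exact: homotopic_eq.
Qed.

(** Conflations in coordinates. All that matters below is the isomorphism
    class of the middle term, so the maps are not recorded. *)
Definition confl X Y Z := exists e : {linear km1 Z -> k0 X}, kiso Y (kext e).
Lemma conflE X Y Z : conflation X Y Z <-> confl X Y Z.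
Proof.
split=> [[f [g [h /distinguished_kext [phi [psi hphi] _]]]]|[e [b [b' [h1 h2]]]]].
  exists (\- cm h (Negz 0)); apply/kisoE; exists psi, phi; exact: kinvs_sym.
exists (ccomp b' (to_c (kext_i e))), (ccomp (to_c (kext_p e)) b), (ev_c (\- e)).
exact: distinguished_iso h1 h2 (kext_distinguished e).
Qed.
End Confl2.

(** * Calculus of conflations *)

Section Calc.
Variable R : nzRingType.
Implicit Types X Y Z W A B C D U V : ktwo R.

Lemma kiso_bij X Y (f : kmap X Y) :
  injective (m1 f) -> surjective (m1 f) -> injective (m0 f) -> surjective (m0 f) -> kiso X Y.
Proof.
move=> i1 s1 i0 s0; apply/kisoE; exists f; apply: kqis_hiso; split.
- by move=> y; have [x <-] := s0 y; exists x, 0; rewrite linear0 addr0.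
- move=> x0 y1 e; have [x1 ex] := s1 y1; exists x1 => //.
  by apply: i0; rewrite mC ex.
- by move=> x _ e; apply: i1; rewrite e linear0.
Qed.

(** Being a retract up to homotopy. It is closed under the operations used
    below without any choice of complement, and it is the same as being a
    direct summand (kret_summand). *)
Definition kret V A := exists (a : kmap V A) (c : kmap A V), c \k a ~~ kid V.
Lemma kret_refl A : kret A A.
Proof. by exists (kid A), (kid A); rewrite kcomp1l. Qed.
Lemma kret_trans A B C : kret A B -> kret B C -> kret A C.
Proof.
move=> [a [c h]] [a' [c' h']]; exists (a' \k a), (c \k c').
by rewrite kcompA -(kcompA c) h' kcomp1r.
Qed.
Lemma kiso_ret A B : kiso A B -> kret A B.
Proof. by move/kisoE=> [f [g [h _]]]; exists f, g. Qed.

Lemma kiso_retV A B : kiso A B -> kret B A.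
Proof. by move=> h; apply/kiso_ret/kiso_sym. Qed.

Lemma Ev_retl X' X Y : kret X' X -> Ev X Y -> Ev X' Y.
Proof.
move=> [a [c [h [h1 _]]]] EXY f.
have [k [k' kP]] := EXY (f \o m1 c).
exists (k \o m1 a), ((k' \o m0 a) \- (f \o h)) => x /=.
have e : x = m1 c (m1 a x) - h (kd X' x) by rewrite -h1 mE /= opprD opprK addNKr.
have /= kx := kP (m1 a x).
by rewrite [in LHS]e linearB kx mC /=; abel.
Qed.
Lemma Ev_retr X Y' Y : kret Y' Y -> Ev X Y -> Ev X Y'.
Proof.
move=> [a [c [h [_ h0]]]] EXY f.
have [k [k' kP]] := EXY (m0 a \o f).
exists ((m1 c \o k) \- (h \o f)), (m0 c \o k') => x /=.
have e : f x = m0 c (m0 a (f x)) - kd Y' (h (f x)) by rewrite -h0 mE /= opprD opprK addNKr.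
have /= kx := kP x.
rewrite [LHS]e kx linearD mC /= linearB /=; abel.
Qed.

Definition kinl A B : kmap A (ksum A B) :=
  @KMap R A (ksum A B) (@pair_inl R (km1 A) (km1 B)) (@pair_inl R (k0 A) (k0 B))
   (fun x => esym (congr1 (pair (kd A x)) (linear0 (kd B)))).
Definition kinr A B : kmap B (ksum A B) :=
  @KMap R B (ksum A B) (@pair_inr R (km1 A) (km1 B)) (@pair_inr R (k0 A) (k0 B))
   (fun x => esym (congr1 (pair^~ (kd B x)) (linear0 (kd A)))).
Definition kfst A B : kmap (ksum A B) A :=
  @KMap R (ksum A B) A (lfst (km1 A) (km1 B)) (lfst (k0 A) (k0 B)) (fun=> erefl).
Definition ksnd A B : kmap (ksum A B) B :=
  @KMap R (ksum A B) B (lsnd (km1 A) (km1 B)) (lsnd (k0 A) (k0 B)) (fun=> erefl).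
Lemma kfst_inl A B : kfst A B \k kinl A B = kid A. Proof. exact: kmap_ext. Qed.
Lemma ksnd_inr A B : ksnd A B \k kinr A B = kid B. Proof. exact: kmap_ext. Qed.
Lemma kfst_inr A B : kfst A B \k kinr A B = 0. Proof. exact: kmap_ext. Qed.
Lemma ksnd_inl A B : ksnd A B \k kinl A B = 0. Proof. exact: kmap_ext. Qed.
Lemma ksum_id A B : kinl A B \k kfst A B + kinr A B \k ksnd A B = kid (ksum A B).
Proof. by apply: kmap_ext => -[x y]; rewrite mE /=; apply/pair_equal_spec;
  rewrite /= addr0 add0r. Qed.

Lemma kret_suml A B : kret A (ksum A B).
Proof. by exists (kinl A B), (kfst A B); rewrite kfst_inl. Qed.
Lemma kret_sumr A B : kret B (ksum A B).
Proof. by exists (kinr A B), (ksnd A B); rewrite ksnd_inr. Qed.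
Definition kdiag A A' B B' (a : kmap A A') (b : kmap B B') : kmap (ksum A B) (ksum A' B') :=
  kinl _ _ \k a \k kfst _ _ + kinr _ _ \k b \k ksnd _ _.
Lemma kdiag_inv A A' B B' (a : kmap A A') (c : kmap A' A) (a' : kmap B B') (c' : kmap B' B) :
  c \k a ~~ kid A -> c' \k a' ~~ kid B -> kdiag c c' \k kdiag a a' ~~ kid (ksum A B).
Proof.
move=> h h'.
have -> : kdiag c c' \k kdiag a a' = kinl _ _ \k (c \k a) \k kfst _ _ + kinr _ _ \k (c' \k a') \k
  ksnd _ _.
  by apply: kmap_ext => -[x y]; rewrite /= ?mE /= ?mE /=; apply/pair_equal_spec;
    rewrite /= ?linear0 !addr0 !add0r.
by rewrite h h' !kcomp1r ksum_id.
Qed.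
Lemma kiso_retl U A B : kiso U (ksum A B) -> kret A U.
Proof. by move/kiso_retV; apply: kret_trans (kret_suml A B). Qed.
Lemma kiso_retr U A B : kiso U (ksum A B) -> kret B U.
Proof. by move/kiso_retV; apply: kret_trans (kret_sumr A B). Qed.
Lemma kret_sum A A' B B' : kret A A' -> kret B B' -> kret (ksum A B) (ksum A' B').
Proof.
by move=> [a [c h]] [a' [c' h']]; exists (kdiag a a'), (kdiag c c'); apply: kdiag_inv.
Qed.
Lemma ksumC A B : kiso (ksum A B) (ksum B A).
Proof.
apply: (@kiso_bij _ _ (kinr _ _ \k kfst _ _ + kinl _ _ \k ksnd _ _)).
- by move=> [x y] [x' y']; rewrite /= => -[]; rewrite !(addr0, add0r) => -> ->.
- by move=> [x y]; exists (y, x); rewrite /=; apply/pair_equal_spec; rewrite /= addr0 add0r.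
- by move=> [x y] [x' y']; rewrite /= => -[]; rewrite !(addr0, add0r) => -> ->.
- by move=> [x y]; exists (y, x); rewrite /=; apply/pair_equal_spec; rewrite /= addr0 add0r.
Qed.
Lemma ksumA A B C : kiso (ksum A (ksum B C)) (ksum (ksum A B) C).
Proof.
pose f1 : {linear km1 (ksum A (ksum B C)) -> km1 (ksum (ksum A B) C)} :=
  lpair (lpair fst (fst \o snd)) (snd \o snd).
pose f0 : {linear k0 (ksum A (ksum B C)) -> k0 (ksum (ksum A B) C)} :=
  lpair (lpair fst (fst \o snd)) (snd \o snd).
have fC x : f0 (kd (ksum A (ksum B C)) x) = kd (ksum (ksum A B) C) (f1 x) by [].
apply: (@kiso_bij _ _ (KMap fC)).
- by move=> [x [z w]] [x' [z' w']] [-> -> ->].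
- by move=> [[x z] w]; exists (x, (z, w)).
- by move=> [x [z w]] [x' [z' w']] [-> -> ->].
- by move=> [[x z] w]; exists (x, (z, w)).
Qed.
Lemma ksum_iso A A' B B' : kiso A A' -> kiso B B' -> kiso (ksum A B) (ksum A' B').
Proof.
move=> /kisoE [a [c [h1 h2]]] /kisoE [a' [c' [h1' h2']]]; apply/kisoE.
by exists (kdiag a a'), (kdiag c c'); split; apply: kdiag_inv.
Qed.

Lemma lin_pair (M N P : lmodType R) (f : {linear (M * N)%type -> P}) x y :
  f (x, y) = f (pair_inl _ x) + f (pair_inr _ y).
Proof. by rewrite -linearD; congr (f _); apply/pair_equal_spec; rewrite /= addr0 add0r. Qed.
Lemma Ev_suml X X' Y : Ev X Y -> Ev X' Y -> Ev (ksum X X') Y.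
Proof.
move=> E1 E2 f.
have [h [h' hP]] := E1 (f \o @pair_inl _ _ _).
have [k [k' kP]] := E2 (f \o @pair_inr _ _ _).
exists (pair_case h k), (pair_case h' k') => -[x y].
rewrite lin_pair [f (pair_inl _ _)]hP [f (pair_inr _ _)]kP /= /pair_case /pair_map /= [kd Y (_ +
  _)]linearD; abel.
Qed.
Lemma Ev_sumr X Y Y' : Ev X Y -> Ev X Y' -> Ev X (ksum Y Y').
Proof.
move=> E1 E2 f.
have [h [h' hP]] := E1 (fst \o f).
have [k [k' kP]] := E2 (snd \o f).
exists (lpair h k), (lpair h' k') => x.
by rewrite [f x]surjective_pairing; apply/pair_equal_spec; split; [exact: hP | exact: kP].
Qed.
Lemma Ev_zerol Y : Ev (kzero R) Y.
Proof. by move=> f; exists \0, \0 => x; rewrite [x](_ : _ = 0) ?linear0 /= ?addr0 //;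
  apply/rowP => -[]. Qed.
Lemma Ev_zeror Y : Ev Y (kzero R).
Proof. by move=> f; exists \0, \0 => x; apply/rowP => -[]. Qed.

Section Ext.
Variables (A C : ktwo R) (e : {linear km1 C -> k0 A}).
(** There is no second extension group between two-term complexes, so E(W, -)
    and E(-, W) are right exact on the conflation with middle term kext e:
    vanishing on it passes to C, respectively to A. *)
Lemma Ev_ext_q W : Ev W (kext e) -> Ev W C.
Proof.
move=> E f; have [h [h' hP]] := E (@pair_inr _ _ _ \o f).
by exists (snd \o h), (snd \o h') => x; have [_ ->] := hP x.
Qed.
Lemma Ev_extl W : Ev A W -> Ev C W -> Ev (kext e) W.
Proof.
move=> E1 E2 f.
have [h [h' hP]] := E1 (f \o @pair_inl _ _ _).
have [k [k' kP]] := E2 ((f \o @pair_inr _ _ _) \- (h' \o e)).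
exists (pair_case h k), (pair_case h' k') => -[x z].
have e2 : f (pair_inr _ z) = kd W (k z) + k' (kd C z) + h' (e z).
  by have /= := kP z => /eqP; rewrite subr_eq => /eqP ->.
rewrite lin_pair [f (pair_inl _ _)]hP e2 /= /pair_case /kext_d /= [kd W (_ + _)]linearD [h' (_ +
  _)]linearD; abel.
Qed.
Lemma Ev_ext_s W : Ev (kext e) W -> Ev A W.
Proof.
move=> E f; have [h [h' hP]] := E (f \o (lfst (km1 A) (km1 C))).
exists (h \o @pair_inl _ _ _), (h' \o @pair_inl _ _ _) => x.
have /= := hP (pair_inl _ x); rewrite /kext_d /= !linear0 addr0; exact.
Qed.
Lemma kext_htp (e' : {linear km1 C -> k0 A}) (h : {linear km1 C -> km1 A}) (h' : {linear k0 C ->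
  k0 A}) :
  (forall z, e z = e' z + (kd A (h z) + h' (kd C z))) -> kiso (kext e) (kext e').
Proof.
move=> hP.
pose f1 : {linear km1 (kext e) -> km1 (kext e')} := lpair (pair_case idfun h) snd.
pose f0 : {linear k0 (kext e) -> k0 (kext e')} := lpair (pair_case idfun (\- h')) snd.
have fC x : f0 (kd (kext e) x) = kd (kext e') (f1 x).
  case: x => x z; apply/pair_equal_spec; split=> //=.
  by rewrite /pair_case /= hP linearD; abel.
apply: (@kiso_bij _ _ (KMap fC)).
- move=> [x z] [x' z'] /pair_equal_spec [] /=; rewrite /pair_case /= => e1 e2.
  by move: e1; rewrite e2 => /addIr ->.
- move=> [x z]; exists (x - h z, z); apply/pair_equal_spec; split=> //=.
  by rewrite /pair_case /= subrK.
- move=> [x z] [x' z'] /pair_equal_spec [] /=; rewrite /pair_case /= => e1 e2.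
  by move: e1; rewrite e2 => /addIr ->.
- move=> [x z]; exists (x + h' z, z); apply/pair_equal_spec; split=> //=.
  by rewrite /pair_case /= addrK.
Qed.
Lemma kext_split (h : {linear km1 C -> km1 A}) (h' : {linear k0 C -> k0 A}) :
  (forall z, e z = kd A (h z) + h' (kd C z)) -> kiso (kext e) (ksum A C).
Proof.
move=> hP; apply: kiso_trans (@kext_htp \0 h h' _) _; first by move=> z; rewrite hP /= add0r.
have fC x : (idfun : {linear k0 (kext (\0 : {linear km1 C -> k0 A})) ->
  k0 (ksum A C)}) (kd (kext \0) x)
  = kd (ksum A C) ((idfun : {linear km1 (kext (\0 : {linear km1 C -> k0 A})) -> km1 (ksum A C)}) x).
  by apply/pair_equal_spec; rewrite /= addr0.
apply: (@kiso_bij _ _ (KMap fC)) => //; by move=> y; exists y.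
Qed.
Lemma kext_Ev_split : Ev C A -> kiso (kext e) (ksum A C).
Proof. by move=> E; have [h [h' hP]] := E e; apply: kext_split hP. Qed.
End Ext.

Lemma confl_Eq W A B C : confl A B C -> Ev W B -> Ev W C.
Proof. by move=> [e /kiso_sym/kiso_ret hr] E1; apply: (Ev_ext_q (e := e)); apply: Ev_retr hr _. Qed.
Lemma confl_El W A B C : confl A B C -> Ev A W -> Ev C W -> Ev B W.
Proof. by move=> [e /kiso_ret hr] E1 E2; apply: Ev_retl hr _; apply: Ev_extl. Qed.
Lemma confl_Es W A B C : confl A B C -> Ev B W -> Ev A W.
Proof. by move=> [e /kiso_sym/kiso_ret hr] E1; apply: (Ev_ext_s (e := e)); apply: Ev_retl hr _. Qed.
Lemma confl_split A B C : confl A B C -> Ev C A -> kiso B (ksum A C).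
Proof. by move=> [e h] E; apply: kiso_trans h _; apply: kext_Ev_split. Qed.
Lemma confl_ext A C (e : {linear km1 C -> k0 A}) : confl A (kext e) C.
Proof. by exists e; apply: kiso_refl. Qed.

Lemma confl_isoB A B B' C : kiso B B' -> confl A B C -> confl A B' C.
Proof. by move=> h [e h']; exists e; apply: kiso_trans h'; apply: kiso_sym. Qed.
Lemma confl_isoA A A' B C : kiso A A' -> confl A B C -> confl A' B C.
Proof.
move=> /kisoE [a /khiso_qis [s0 mid inj]] [e h].
exists (m0 a \o e); apply: kiso_trans h _; apply/kisoE.
pose f1 : {linear km1 (kext e) -> km1 (kext (m0 a \o e))} := lpair (m1 a \o fst) snd.
pose f0 : {linear k0 (kext e) -> k0 (kext (m0 a \o e))} := lpair (m0 a \o fst) snd.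
have fC x : f0 (kd (kext e) x) = kd (kext (m0 a \o e)) (f1 x).
  by case: x => x z; apply/pair_equal_spec; split=> //=; rewrite linearD mC.
exists (KMap fC); apply: kqis_hiso; split.
- move=> [y z]; have [x0 [y1 ->]] := s0 y; exists (x0, z), (y1, 0).
  by apply/pair_equal_spec; rewrite /= !linear0 !addr0.
- move=> [x z] [y w] /pair_equal_spec [/= e1 e2].
  have [|x1 ex1 ex2] := mid (x - e w) y; first by rewrite linearB e1 addrK.
  exists (x1, w); last by apply/pair_equal_spec; split; rewrite /= ?ex2.
  by apply/pair_equal_spec; split; rewrite /= -?ex1 ?subrK.
- move=> [x z] /pair_equal_spec [/= e1 e2] /pair_equal_spec [/= e3 e4].
  rewrite e4; congr (_, _); apply: inj => //.
  by move: e1; rewrite e4 linear0 addr0.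
Qed.
Lemma confl_isoC A B C C' : kiso C C' -> confl A B C -> confl A B C'.
Proof.
move=> /kiso_sym/kisoE [c hc] [e h].
exists (e \o m1 c); apply: kiso_trans h _; apply: kiso_sym; apply/kisoE.
have /khiso_qis [s0 mid inj] := hc.
pose f1 : {linear km1 (kext (e \o m1 c)) -> km1 (kext e)} := lpair fst (m1 c \o snd).
pose f0 : {linear k0 (kext (e \o m1 c)) -> k0 (kext e)} := lpair fst (m0 c \o snd).
have fC x : f0 (kd (kext (e \o m1 c)) x) = kd (kext e) (f1 x).
  by case: x => x z; apply/pair_equal_spec; split=> //=; rewrite mC.
exists (KMap fC); apply: kqis_hiso; split.
- move=> [y z]; have [x0 [y1 ->]] := s0 z; exists (y - e y1, x0), (0, y1).
  by apply/pair_equal_spec; rewrite /= !linear0 add0r subrK.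
- move=> [x z] [y w] /pair_equal_spec [/= e1 e2].
  have [x1 ex1 ex2] := mid _ _ e2.
  exists (y, x1); apply/pair_equal_spec; split; rewrite /= -?ex1 -?ex2 //.
- move=> [x z] /pair_equal_spec [/= e1 e2] /pair_equal_spec [/= e3 e4].
  by rewrite e3; congr (_, _); apply: inj.
Qed.

(** The octahedral axiom, in three forms: two composable inflations; an
    extension B of C that is prolonged along an inflation from C to D, which
    is possible because E(-, A) is right exact; and two inflations with the
    same source. In coordinates each of them only rebrackets three summands.
    *)
Lemma confl_oct A B C D E : confl A B C -> confl B D E -> exists2 F, confl A D F & confl C F E.
Proof.
move=> [e hB] /(confl_isoA hB) [e' hD].
pose eC : {linear km1 E -> k0 C} := snd \o e'.
pose e2 : {linear km1 (kext eC) -> k0 A} := pair_case e (fst \o e').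
exists (kext eC); last exact: confl_ext.
exists e2; apply: kiso_trans hD _.
pose f1 : {linear km1 (kext e') -> km1 (kext e2)} := lpair (fst \o fst) (lpair (snd \o fst) snd).
pose f0 : {linear k0 (kext e') -> k0 (kext e2)} := lpair (fst \o fst) (lpair (snd \o fst) snd).
have fC x : f0 (kd (kext e') x) = kd (kext e2) (f1 x).
  by case: x => [[x z] w]; apply/pair_equal_spec; split=> //=; rewrite /pair_case /=; abel.
apply: (@kiso_bij _ _ (KMap fC)).
- by move=> [[x z] w] [[x' z'] w'] [-> -> ->].
- by move=> [x [z w]]; exists ((x, z), w).
- by move=> [[x z] w] [[x' z'] w'] [-> -> ->].
- by move=> [x [z w]]; exists ((x, z), w).
Qed.
Lemma confl_comp A B C D E : confl A B C -> confl C D E -> exists2 F, confl A F D & confl B F E.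
Proof.
move=> [e hB] [e2 hD].
pose e3 : {linear km1 (kext e2) -> k0 A} := e \o fst.
pose e4 : {linear km1 E -> k0 (kext e)} := @pair_inr _ _ _ \o e2.
exists (kext e3); first by apply: confl_isoC (kiso_sym hD) _; apply: confl_ext.
apply: confl_isoA (kiso_sym hB) _; exists e4.
pose f1 : {linear km1 (kext e3) -> km1 (kext e4)} := lpair (lpair fst (fst \o snd)) (snd \o snd).
pose f0 : {linear k0 (kext e3) -> k0 (kext e4)} := lpair (lpair fst (fst \o snd)) (snd \o snd).
have fC x : f0 (kd (kext e3) x) = kd (kext e4) (f1 x).
  by case: x => [x [z w]]; apply/pair_equal_spec; split=> //=; apply/pair_equal_spec; split=> /=;
    rewrite ?addr0.
apply: (@kiso_bij _ _ (KMap fC)).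
- by move=> [x [z w]] [x' [z' w']] [-> -> ->].
- by move=> [[x z] w]; exists (x, (z, w)).
- by move=> [x [z w]] [x' [z' w']] [-> -> ->].
- by move=> [[x z] w]; exists (x, (z, w)).
Qed.
Lemma confl_pushout A B C D E : confl A B C -> confl A D E -> exists2 F, confl B F E & confl D F C.
Proof.
move=> [e hB] [e' hD].
pose e3 : {linear km1 E -> k0 (kext e)} := @pair_inl _ _ _ \o e'.
pose e4 : {linear km1 C -> k0 (kext e')} := @pair_inl _ _ _ \o e.
exists (kext e3); first by apply: confl_isoA (kiso_sym hB) _; apply: confl_ext.
apply: confl_isoA (kiso_sym hD) _; exists e4.
pose f1 : {linear km1 (kext e3) -> km1 (kext e4)} := lpair (lpair (fst \o fst) snd) (snd \o fst).
pose f0 : {linear k0 (kext e3) -> k0 (kext e4)} := lpair (lpair (fst \o fst) snd) (snd \o fst).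
have fC x : f0 (kd (kext e3) x) = kd (kext e4) (f1 x).
  by case: x => [[x z] w]; apply/pair_equal_spec; split; [apply/pair_equal_spec; split|];
    rewrite /= ?addr0 ?add0r //; abel.
apply: (@kiso_bij _ _ (KMap fC)).
- by move=> [[x z] w] [[x' z'] w'] [-> -> ->].
- by move=> [[x z] w]; exists ((x, w), z).
- by move=> [[x z] w] [[x' z'] w'] [-> -> ->].
- by move=> [[x z] w]; exists ((x, w), z).
Qed.
End Calc.

(** * Deflations, additive closure and thick subcategories *)

Section Defl.
Variable R : nzRingType.
Implicit Types X Y Z W A B C D U V : ktwo R.

Lemma fin_gen_surj (P Q : lmodType R) (r : {linear P -> Q}) : surjective r -> fin_gen P ->
  fin_gen Q.
Proof.
move=> rs [s sP]; exists [seq r x | x <- s] => m.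
have [p <-] := rs m; have [c ->] := sP p; exists c.
rewrite linear_sum size_map; apply: eq_bigr => i _.
by rewrite linearZ /= (nth_map 0).
Qed.
Lemma fg_projective_ret (P Q : lmodType R) (i : {linear Q -> P}) (r : {linear P -> Q}) :
  (forall x, r (i x) = x) -> fg_projective P -> fg_projective Q.
Proof.
move=> ri [fP pP]; split; first by apply: fin_gen_surj fP => y; exists (i y).
move=> M N p f ps.
have [g gP] := pP _ _ p (f \o r) ps.
by exists (g \o i) => x; have /= -> := gP (i x); rewrite ri.
Qed.

(** A map that is onto on degree 0 cohomology is a deflation. The surjection q
    onto the degree 0 term of B splits, so its kernel is projective, and the
    kernel is the degree 0 term of the cocone. *)
Lemma kdefl U B (p : kmap U B) :
  (forall y, exists u b, y = m0 p u + kd B b) ->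
  exists W (e : {linear km1 B -> k0 W}) (phi : kmap U (kext e)), khiso phi /\ kext_p e \k phi = p.
Proof.
move=> ps.
pose q : {linear (k0 U * km1 B)%type -> k0 B} := pair_case (m0 p) (kd B).
have [s sP] : exists s : {linear k0 B -> (k0 U * km1 B)%type}, forall y, q (s y) = y.
  apply: proj_sect; first by case: (k0P B).
  by move=> y; have [u [b ->]] := ps y; exists (u, b).
have [r rP] : exists r : {linear (k0 U * km1 B)%type -> kerm q},
    forall x, kinj q (r x) = (idfun \- (s \o q)) x.
  by apply: ker_lift => x; rewrite linearB /= sP subrr.
have WP : fg_projective (kerm q).
  apply: (@fg_projective_ret _ _ (kinj q) r).
    by move=> x; apply: (@kinj_inj _ _ _ q); rewrite rP /= kinjK linear0 subr0.
  exact: fg_projective_sum (k0P U) (km1P B).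
have [w wP] : exists w : {linear km1 U -> kerm q}, forall x,
  kinj q (w x) = lpair (kd U) (\- m1 p) x.
  by apply: ker_lift => x; rewrite /q /= /pair_case /= linearN mC subrr.
pose W := @KTwo R (km1 U) (kerm q) w (km1P U) WP.
pose e : {linear km1 B -> k0 W} := r \o @pair_inr _ _ _.
pose f1 : {linear km1 U -> km1 (kext e)} := lpair idfun (m1 p).
pose f0 : {linear k0 U -> k0 (kext e)} := lpair (r \o @pair_inl _ _ _) (m0 p).
have fC x : f0 (kd U x) = kd (kext e) (f1 x).
  apply/pair_equal_spec; split; last exact: mC.
  apply: (@kinj_inj _ _ _ q).
  change (kinj q (r (pair_inl _ (kd U x))) = kinj q (w x + r (pair_inr _ (m1 p x)))).
  rewrite linearD !rP wP.
  change (pair_inl _ (kd U x) - s (q (pair_inl _ (kd U x))) =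
    (kd U x, - m1 p x) + (pair_inr _ (m1 p x) - s (q (pair_inr _ (m1 p x))))).
  have -> : q (pair_inl _ (kd U x)) = kd B (m1 p x) by rewrite [LHS]pair_caseL mC.
  have -> : q (pair_inr _ (m1 p x)) = kd B (m1 p x) by rewrite /q /= /pair_case /= linear0 add0r.
  by rewrite addrA; congr (_ - _); apply/pair_equal_spec; rewrite /= addr0 addNr.
exists W, e, (KMap fC); split; last exact: kmap_ext.
apply: kqis_hiso; split.
- move=> [y z].
  pose t := kinj q y + s z.
  have qt : q t = z by rewrite linearD /= kinjK sP add0r.
  exists t.1, (0, t.2); apply/pair_equal_spec; split; last by rewrite /= -[LHS]qt.
  apply: (@kinj_inj _ _ _ q).
  change (kinj q y = kinj q (r (pair_inl _ t.1) + (w 0 + r (pair_inr _ t.2)))).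
  rewrite linear0 add0r linearD !rP.
  change (kinj q y = pair_inl _ t.1 - s (q (pair_inl _ t.1)) + (pair_inr _ t.2 - s (q (pair_inr _
    t.2)))).
  have -> (V : zmodType) (a a' b b' : V) : a - b + (a' - b') = (a + a') - (b + b') by abel.
  have et : pair_inl _ t.1 + pair_inr _ t.2 = t.
    by rewrite [RHS]surjective_pairing; apply/pair_equal_spec; rewrite /= addr0 add0r.
  by rewrite -!linearD et qt /t addrK.
- move=> x0 [y z] /pair_equal_spec [/= e1 e2].
  have : kinj q (r (pair_inl _ x0)) = kinj q (w y + r (pair_inr _ z)) by congr (kinj q _).
  rewrite linearD !rP wP.
  change ((x0, 0) - s (q (x0, 0)) = (kd U y, - m1 p y) + ((0, z) - s (q (0, z))) ->
    exists2 x1, x0 = kd U x1 & (y, z) = f1 x1).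
  have -> : q (x0, 0) = m0 p x0 by rewrite /q /= /pair_case /= linear0 addr0.
  have -> : q (0, z) = kd B z by rewrite /q /= /pair_case /= linear0 add0r.
  rewrite e2; move: (s _) => sz e3.
  have : (x0, 0) = (kd U y, - m1 p y) + (0, z) :> (k0 U * km1 B)%type.
    move: e3; move: (x0, 0) ((0, z) : (k0 U * km1 B)%type) (kd U y, - m1 p y) => a b c e3.
    have -> : a = (a - sz) + sz by abel.
    by rewrite e3; abel.
  move=> /pair_equal_spec [/= e4 e5]; exists y; first by rewrite e4 addr0.
  apply/pair_equal_spec; split=> //=; apply/eqP; rewrite eq_sym -subr_eq0; apply/eqP.
  by rewrite -[RHS]oppr0 e5 opprD opprK.
- by move=> x _ [].
Qed.

Lemma kext_section A C (e : {linear km1 C -> k0 A}) (s : kmap C (kext e)) :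
  kext_p e \k s ~~ kid C -> exists (h : {linear km1 C -> km1 A}) (h' : {linear k0 C -> k0 A}),
  forall z, e z = kd A (h z) + h' (kd C z).
Proof.
move=> [h [h1 h0]].
exists (\- (fst \o m1 s)), ((fst \o m0 s) \- (e \o h)) => z /=.
have /= e1 := congr1 fst (mC s z).
have e3 : z = (m1 s z).2 - h (kd C z) by rewrite -h1 mE /= opprD opprK addNKr.
rewrite e1 linearN [in LHS]e3 linearB /=; abel.
Qed.

(** Idempotents split: the retraction is a deflation, and the extension it
    defines has a section. *)
Lemma kret_summand V A : kret V A <-> ksummand V A.
Proof.
split=> [[a [c h]]|[A' /kiso_sym/kiso_ret hr]]; last exact: kret_trans (kret_suml _ _) hr.
have [W [e [phi [hphi ephi]]]] : exists W (e : {linear km1 V ->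
  k0 W}) (phi : kmap A (kext e)), khiso phi /\ kext_p e \k phi = c.
  apply: kdefl => v; have [k [_ k0]] := h.
  exists (m0 a v), (- k v); rewrite linearN -k0 mE /=; abel.
have [k [k' kP]] : exists (h : {linear km1 V -> km1 W}) (h' : {linear k0 V -> k0 W}),
  forall z, e z = kd W (h z) + h' (kd V z).
  by apply: (@kext_section _ _ e (phi \k a)); rewrite kcompA ephi.
exists W; apply: kiso_trans (_ : kiso A (kext e)) _; first by apply/kisoE; exists phi.
by apply: kiso_trans (kext_split kP) _; apply: ksumC.
Qed.

Definition kpow (U : ktwo R) n : ktwo R := iter n (ksum U) (kzero R).
Lemma kaddE U V : kadd U V <-> exists n, kret V (kpow U n).
Proof. by split=> -[n h]; exists n; apply/kret_summand. Qed.
Lemma fg_cover (N : lmodType R) : fin_gen N ->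
  exists n (r : {linear k0 (kpow (kreg R) n) -> N}), surjective r.
Proof.
move=> [s sP].
have rel n : exists r : {linear k0 (kpow (kreg R) n) -> N},
    forall c : nat -> R, exists u, r u = \sum_(i < n) c i *: s`_i.
  elim: n => [|n [r rP]]; first by exists \0 => c; exists 0; rewrite big_ord0.
  exists (pair_case (regular_act s`_n) r) => c; have [u ur] := rP c.
  by exists (c n, u); rewrite big_ord_recr /= /pair_case /= ur addrC.
have [r rP] := rel (size s); exists (size s), r.
by move=> y; have [c ->] := sP y; exact: rP.
Qed.
Lemma kret_pow_add U n m : kret (ksum (kpow U n) (kpow U m)) (kpow U (n + m)).
Proof.
elim: n => [|n IH].
  exists (ksnd _ _), (kinr _ _).
  rewrite (_ : _ \k _ = kid _) //.
  by apply: kmap_ext => -[x y]; apply/pair_equal_spec; split=> //; apply/rowP => -[].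
apply: kret_trans (kret_sum (kret_refl U) IH).
exact/kiso_ret/kiso_sym/ksumA.
Qed.
Lemma kadd_ret U V W : kret V W -> kadd U W -> kadd U V.
Proof. by move=> h /kaddE [n hn]; apply/kaddE; exists n; apply: kret_trans h hn. Qed.
Lemma kadd_self U : kadd U U.
Proof. by apply/kaddE; exists 1%N; apply: kret_suml. Qed.
Lemma kadd_zero U : kadd U (kzero R).
Proof. by apply/kaddE; exists 0%N; apply: kret_refl. Qed.
Lemma kadd_sum U V W : kadd U V -> kadd U W -> kadd U (ksum V W).
Proof.
move=> /kaddE [n hn] /kaddE [m hm]; apply/kaddE; exists (n + m)%N.
exact: kret_trans (kret_sum hn hm) (kret_pow_add _ _ _).
Qed.
Lemma kadd_pow U V n : kadd U V -> kadd U (kpow V n).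
Proof. by move=> h; elim: n => [|n IH] /=; [apply: kadd_zero | apply: kadd_sum]. Qed.
Lemma kadd_self_pow U n : kadd U (kpow U n).
Proof. exact/kadd_pow/kadd_self. Qed.
Lemma kadd_suml A B : kadd (ksum A B) A.
Proof. exact: kadd_ret (kret_suml _ _) (kadd_self _). Qed.
Lemma kadd_sumr A B : kadd (ksum A B) B.
Proof. exact: kadd_ret (kret_sumr _ _) (kadd_self _). Qed.
Lemma kadd_trans U V W : kadd U V -> kadd V W -> kadd U W.
Proof. by move=> h /kaddE [n hn]; apply: kadd_ret hn _; apply: kadd_pow. Qed.
Lemma kadd_iso U V W : kiso V W -> kadd U V -> kadd U W.
Proof. by move=> /kiso_sym/kiso_ret; apply: kadd_ret. Qed.
Lemma kadd_sub U V : kadd U V -> kadd V U -> kadd U = kadd V.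
Proof. by move=> h1 h2; apply: class_ext => W; split; apply: kadd_trans. Qed.

Definition add_closed (T : class (ktwo R)) :=
  [/\ forall X Y, kret X Y -> T Y -> T X, T (kzero R) & forall X Y, T X -> T Y -> T (ksum X Y)].
Lemma add_closed_kadd T U V : add_closed T -> T U -> kadd U V -> T V.
Proof.
move=> [hr h0 hs] hU /kaddE [n hn]; apply: hr hn _.
by elim: n => [|n IH] //=; apply: hs.
Qed.
Lemma Ev_closedl Y : add_closed (fun X => Ev X Y).
Proof. by split; [move=> ? ?; apply: Ev_retl | apply: Ev_zerol | move=> ? ?; apply: Ev_suml]. Qed.
Lemma Ev_closedr X : add_closed (Ev X).
Proof. by split; [move=> ? ?; apply: Ev_retr | apply: Ev_zeror | move=> ? ?; apply: Ev_sumr]. Qed.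
Lemma Ev_kaddl U Y V : Ev U Y -> kadd U V -> Ev V Y.
Proof. exact: add_closed_kadd (Ev_closedl Y). Qed.
Lemma Ev_kaddr X U V : Ev X U -> kadd U V -> Ev X V.
Proof. exact: add_closed_kadd (Ev_closedr X). Qed.

Definition tri_closed (T : class (ktwo R)) := forall X Y Z, confl X Y Z ->
  [/\ T X -> T Y -> T Z, T X -> T Z -> T Y & T Y -> T Z -> T X].
Lemma is_thickE T : is_thick T <-> add_closed T /\ tri_closed T.
Proof.
split=> [[[hi h0 hs] hsm ht]|[[hr h0 hs] ht]].
  split; first by split=> // X Y /kret_summand; apply: hsm.
  by move=> X Y Z /conflE; apply: ht.
split.
- split=> // X Y h; apply: hr; exact/kiso_ret/kiso_sym.
- by move=> X Y /kret_summand; apply: hr.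
- by move=> X Y Z /conflE; apply: ht.
Qed.
Lemma thick_thick (C : class (ktwo R)) : is_thick (@thick R C).
Proof.
apply/is_thickE; split; first split.
- by move=> X Y h hY T hT hC; have [[hr _ _] _] := (is_thickE T).1 hT; apply: hr h _; apply: hY.
- by move=> T /is_thickE [[]].
- by move=> X Y hX hY T hT hC; have [[_ _ hs] _] := (is_thickE T).1 hT; apply: hs;
  [apply: hX|apply: hY].
- move=> X Y Z h; split=> h1 h2 T hT hC; have [t1 t2 t3] := ((is_thickE T).1 hT).2 _ _ _ h.
  + by apply: t1; [apply: h1 | apply: h2].
  + by apply: t2; [apply: h1 | apply: h2].
  + by apply: t3; [apply: h1 | apply: h2].
Qed.
Lemma thick_sub (C : class (ktwo R)) X : C X -> thick C X.
Proof. by move=> h T _; apply. Qed.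
Lemma thick_kadd T U V : is_thick T -> T U -> kadd U V -> T V.
Proof. by move=> /is_thickE [h _]; apply: add_closed_kadd. Qed.
End Defl.

(** * Finite dimension over the base field *)

Section FinDim.
Variable k : fieldType.
Implicit Types V W : lmodType k.

Definition fdim V := exists n (f : {linear V -> 'rV[k]_n}), injective f.

(** A submodule given by a mere predicate is the row space of a matrix in it
    of maximal rank: adding a row from the submodule cannot increase the rank.
    *)
Lemma rowspace_of_pred n (S : 'rV[k]_n -> Prop) : submodule S ->
  exists A : 'M[k]_n, forall v, (v <= A)%MS <-> S v.
Proof.
move=> HS.
pose good (A : 'M[k]_n) := forall v, (v <= A)%MS -> S v.
pose P r := decide (exists A : 'M[k]_n, good A /\ \rank A = r).
have ex : exists r, P r.
  exists 0%N; apply/decideP; exists 0; split; last exact: mxrank0.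
  by move=> v; rewrite submx0 => /eqP ->; apply: subm0 HS.
have ub r : P r -> (r <= n)%N by move=> /decideP [A [_ <-]]; apply: rank_leq_row.
case: (ex_maxnP ex ub) => r /decideP [A [gA rA]] mx.
exists A => v; split; first exact: gA.
move=> Sv; have : (\rank (A + v)%MS <= r)%N.
  apply: mx; apply/decideP; exists (A + v)%MS; split=> // u /sub_addsmxP [[a b] /= ->].
  apply: submD => //; first by apply: gA; apply: submxMl.
  by rewrite (mx11_scalar b) mul_scalar_mx; apply: submZ.
rewrite -rA => h; have sA : (A <= A + v)%MS by apply: addsmxSl.
have : (A == A + v)%MS by rewrite -(geq_leqif (mxrank_leqif_eq sA)).
by move=> /andP [_ h2]; apply: submx_trans h2; apply: addsmxSr.
Qed.

Lemma lin_inv V W (f : {linear V -> W}) : injective f -> surjective f ->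
  exists g : {linear W -> V}, (forall x, g (f x) = x) /\ (forall y, f (g y) = y).
Proof.
move=> fi fs; have [g gP] := @lin_fact k W V W f idfun fi (fun y => fs y).
by exists g; split=> // x; apply: fi; rewrite gP.
Qed.

Lemma rV_inj_le n m (f : {linear 'rV[k]_n -> 'rV[k]_m}) : injective f -> (n <= m)%N.
Proof.
move=> fi; have rf : row_free (lin1_mx f).
  rewrite -kermx_eq0; apply/eqP/row_matrixP => i.
  rewrite row0; apply: fi; rewrite linear0 -mul_rV_lin1; apply: sub_kermxP.
  exact: row_sub.
by move: rf; rewrite /row_free => /eqP <-; apply: rank_leq_col.
Qed.

Lemma fdim_basis V : fdim V -> exists n (f : {linear V -> 'rV[k]_n}), injective f /\ surjective f.
Proof.
move=> [n [f fi]].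
have [|A AP] := @rowspace_of_pred n (fun v => exists x, f x = v).
  split; first by exists 0; rewrite linear0.
  by move=> c _ _ [x <-] [y <-]; exists (c *: x + y); rewrite linearP.
pose B := row_base A.
have Bi : injective (mulmxr B : {linear 'rV_(\rank A) -> 'rV_n}).
  by move=> u v /=; apply: row_free_inj; apply: row_base_free.
have BA (u : 'rV_n) : (u <= A)%MS -> exists w, w *m B = u.
  by rewrite -(eq_row_base A) => /submxP [w ->]; exists w.
have [g gP] : exists g : {linear V -> 'rV_(\rank A)}, forall x, mulmxr B (g x) = f x.
  by apply: (lin_fact Bi) => x /=; apply: BA; apply/AP; exists x.
exists (\rank A), g; split.
  by move=> x y e; apply: fi; rewrite -!gP e.
move=> u; have [x ex] : exists x, f x = u *m B.
  by apply/AP; rewrite -(eq_row_base A); apply: submxMl.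
by exists x; exact: Bi (etrans (gP x) ex).
Qed.

Lemma fdim_surj V n (f : {linear 'rV[k]_n -> V}) : surjective f -> fdim V.
Proof.
move=> fs.
have [|A AP] := @rowspace_of_pred n (fun v => f v = 0).
  split; first by rewrite linear0.
  by move=> c u v eu ev; rewrite linearP eu ev scaler0 addr0.
pose B := row_base (A^C)%MS.
pose t : {linear 'rV_(\rank (A^C)%MS) -> V} := f \o mulmxr B.
have ti : injective t.
  apply: lin_inj => u /= /AP h1.
  have h2 : (u *m B <= A^C)%MS by rewrite -(eq_row_base (A^C)%MS); apply: submxMl.
  have : (u *m B <= A :&: A^C)%MS by rewrite sub_capmx h1.
  rewrite capmx_compl submx0 => /eqP h3.
  by apply: (row_free_inj (row_base_free (A^C)%MS)); rewrite h3 mul0mx.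
have ts : surjective t.
  move=> y; have [x <-] := fs y.
  have : (x <= A + A^C)%MS by apply: submx_full; apply: addsmx_compl_full.
  move=> /sub_addsmxP [[a b] /= ->]; rewrite linearD.
  have -> : f (a *m A) = 0 by apply/AP; apply: submxMl.
  rewrite add0r.
  have : (b *m (A^C)%MS <= B)%MS by rewrite eq_row_base; apply: submxMl.
  by move=> /submxP [w ->]; exists w.
have [g [g1 g2]] := lin_inv ti ts.
by exists _, g => x y e; rewrite -[x]g2 e g2.
Qed.

Lemma fdim_inj V W (f : {linear V -> W}) : injective f -> fdim W -> fdim V.
Proof. by move=> fi [n [g gi]]; exists n, (g \o f) => x y /gi/fi. Qed.
Lemma fdim_quot V W (f : {linear V -> W}) : surjective f -> fdim V -> fdim W.
Proof.
move=> fs /fdim_basis [n [g [gi gs]]]; have [h [h1 h2]] := lin_inv gi gs.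
by apply: (@fdim_surj W n (f \o h)) => y; have [x <-] := fs y; exists (g x); rewrite /= h1.
Qed.
Lemma fdim_vect (V : vectType k) : fdim V.
Proof.
pose b := vbasis {:V}.
have fl : linear (fun u : 'rV[k]_(\dim {:V}) => \sum_i u 0 i *: b`_i).
  move=> c u v; rewrite scaler_sumr -big_split /=; apply: eq_bigr => i _.
  by rewrite !mxE scalerDl scalerA.
apply: (@fdim_surj V _ (mklin fl)) => y.
exists (\row_i coord b i y); rewrite [RHS](coord_vbasis (memvf y)) /=.
by apply: eq_bigr => i _; rewrite mxE.
Qed.
Lemma fdim_prod V W : fdim V -> fdim W -> fdim (V * W)%type.
Proof.
move=> [n [f fi]] [m [g gi]].
have [p [h hi]] := fdim_vect ('rV[k]_n * 'rV[k]_m)%type.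
exists p, (h \o pair_map f g) => -[x y] [x' y'] /hi [/fi -> /gi ->] //.
Qed.

Lemma fdim_span V : fdim V -> exists n (s : 'I_n -> V), forall v, exists c : 'I_n ->
  k, v = \sum_i c i *: s i.
Proof.
move=> /fdim_basis [n [f [fi fs]]]; have [g [g1 g2]] := lin_inv fi fs.
exists n, (fun i => g (delta_mx 0 i)) => v; exists (fun i => f v 0 i).
rewrite -[LHS]g1 [X in g X = _]row_sum_delta linear_sum; by apply: eq_bigr => i _; rewrite linearZ.
Qed.

(** The value is meaningful only under fdim. *)
Definition kdim V : nat := epsilon (inhabits 0%N) (fun n => exists f : {linear V ->
  'rV[k]_n}, injective f /\ surjective f).
Lemma kdimP V : fdim V -> exists f : {linear V -> 'rV[k]_(kdim V)}, injective f /\ surjective f.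
Proof.
move/fdim_basis; apply: (epsilon_spec _ (fun n => exists f : {linear V ->
  'rV[k]_n}, injective f /\ surjective f)).
Qed.
Lemma kdim_le V W (f : {linear V -> W}) : injective f -> fdim W -> (kdim V <= kdim W)%N.
Proof.
move=> fi fW; have [g [gi _]] := kdimP fW.
have [h [hi hs]] := kdimP (fdim_inj fi fW).
have [h' [_ h2]] := lin_inv hi hs.
by apply: (@rV_inj_le _ _ (g \o f \o h')) => x y /gi/fi e; rewrite -[x]h2 e h2.
Qed.
Lemma kdim_eq V W (f : {linear V -> W}) : injective f -> surjective f -> fdim W -> kdim V = kdim W.
Proof.
move=> fi fs fW; apply/eqP; rewrite eqn_leq (kdim_le fi) //=.
have [g [g1 g2]] := lin_inv fi fs.
apply: (@kdim_le _ _ g); last exact: fdim_inj fi fW.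
by move=> x y e; rewrite -[x]g2 e g2.
Qed.
Lemma kdim_rV n : kdim 'rV[k]_n = n.
Proof.
have fW : fdim 'rV[k]_n by exists n, idfun.
have [f [fi fs]] := kdimP fW; have [g [g1 g2]] := lin_inv fi fs.
apply/eqP; rewrite eqn_leq (rV_inj_le fi) andbT.
by apply: (@rV_inj_le _ _ g) => x y e; rewrite -[x]g2 e g2.
Qed.
Lemma kdim_prod V W : fdim V -> fdim W -> kdim (V * W)%type = (kdim V + kdim W)%N.
Proof.
move=> fV fW; have [f [fi fs]] := kdimP fV; have [g [gi gs]] := kdimP fW.
have rl : linear (fun x : 'rV[k]_(kdim V) * 'rV[k]_(kdim W) => row_mx x.1 x.2).
  by move=> c x y /=; rewrite scale_row_mx add_row_mx.
rewrite -[RHS]kdim_rV; apply: (@kdim_eq _ _ (mklin rl \o pair_map f g)).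
- by move=> [x y] [x' y'] /= /eq_row_mx [/fi -> /gi ->].
- move=> u; have [x ex] := fs (lsubmx u); have [y ey] := gs (rsubmx u).
  by exists (x, y); rewrite /= ex ey hsubmxK.
- by exists _, idfun.
Qed.
Lemma kdim0 V : fdim V -> (kdim V = 0)%N <-> forall x : V, x = 0.
Proof.
move=> fV; have [f [fi fs]] := kdimP fV; split=> [e x|h].
  by apply: fi; move: (f x) (f 0); rewrite e => a b; apply/rowP => -[].
have fi2 : injective (\0 : {linear 'rV[k]_(kdim V) -> 'rV[k]_0}).
  move=> a b _; have [x <-] := fs a; have [y <-] := fs b; by rewrite (h x) (h y).
by apply/eqP; rewrite -leqn0; apply: rV_inj_le fi2.
Qed.
End FinDim.

Section Restrict.
Variables (k : fieldType) (Lam : falgType k).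
Implicit Types M N : lmodType Lam.

(** The type M with its module structure restricted to the base field; the
    scalar c acts through its image in the algebra. *)
Definition kres (M : lmodType Lam) : Type := M.
HB.instance Definition _ M := GRing.Zmodule.on (kres M).
Definition kscale M (c : k) (x : kres M) : kres M := (c%:A : Lam) *: (x : M).
Lemma kscaleA M a b (x : kres M) : kscale a (kscale b x) = kscale (a * b) x.
Proof. by rewrite /kscale scalerA mulr_algl scalerA. Qed.
Lemma kscale1 M : left_id 1 (@kscale M).
Proof. by move=> x; rewrite /kscale scale1r; exact: scale1r. Qed.
Lemma kscaleDr M : right_distributive (@kscale M) +%R.
Proof. by move=> a x y; exact: scalerDr. Qed.
Lemma kscaleDl M (x : kres M) : {morph (@kscale M)^~ x : a b / a + b}.
Proof. by move=> a b; rewrite /kscale scalerDl; exact: scalerDl. Qed.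
HB.instance Definition _ M := GRing.Zmodule_isLmodule.Build k (kres M)
  (@kscaleA M) (@kscale1 M) (@kscaleDr M) (@kscaleDl M).
Lemma kscaleE M (c : k) (x : kres M) : c *: x = (c%:A : Lam) *: (x : M).
Proof. by []. Qed.

Lemma kresf_lin M N (f : {linear M -> N}) : linear (f : kres M -> kres N).
Proof. by move=> c x y; rewrite !kscaleE linearP. Qed.
Definition kresf M N (f : {linear M -> N}) : {linear kres M -> kres N} := mklin (kresf_lin f).

Lemma fin_genP M : fin_gen M <-> fdim (kres M).
Proof.
split=> [[s sP]|/fdim_span [n [s sP]]].
  have fl : linear (fun u : {ffun 'I_(size s) -> Lam} => (\sum_i u i *: s`_i : kres M)).
    move=> c u v; rewrite kscaleE scaler_sumr -big_split /=; apply: eq_bigr => i _.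
    by rewrite !ffunE scalerDl scalerA mulr_algl.
  apply: (@fdim_quot _ _ _ (mklin fl)); last exact: fdim_vect.
  move=> m; have [c ->] := sP m; exists [ffun i => c (val i)] => /=.
  by apply: eq_bigr => i _; rewrite ffunE.
exists [seq s i | i <- enum 'I_n] => m.
have [c ->] := sP m.
exists (fun j => if insub j is Some i then (c i)%:A else 0).
rewrite size_map size_enum_ord; apply: eq_bigr => i _.
by rewrite valK (nth_map i) ?size_enum_ord // nth_ord_enum.
Qed.

Lemma fin_gen_inj M N (f : {linear M -> N}) : injective f -> fin_gen N -> fin_gen M.
Proof. by move=> fi /fin_genP h; apply/fin_genP; apply: (@fdim_inj _ _ _ (kresf f)). Qed.

(** This is where the finite dimension of the algebra enters: finitely
    generated modules are the finite-dimensional ones, so kernels remain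
    finitely generated. *)
Lemma fin_gen_ker M N (f : {linear M -> N}) : fin_gen M -> fin_gen (kerm f).
Proof. apply: fin_gen_inj; exact: kinj_inj. Qed.

Implicit Types X Y Z : ktwo Lam.
Lemma kmscale_sub1 X Y (c : k) (f : kmap X Y) : linear (fun x => (c%:A : Lam) *: m1 f x).
Proof. by move=> a x y; rewrite linearP scalerDr !scalerA mulr_algl mulr_algr. Qed.
Lemma kmscale_sub0 X Y (c : k) (f : kmap X Y) : linear (fun x => (c%:A : Lam) *: m0 f x).
Proof. by move=> a x y; rewrite linearP scalerDr !scalerA mulr_algl mulr_algr. Qed.
Lemma kmscale_subC X Y (c : k) (f : kmap X Y) x :
  mklin (kmscale_sub0 c f) (kd X x) = kd Y (mklin (kmscale_sub1 c f) x).
Proof. by rewrite /= mC linearZ. Qed.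
Definition kmscale X Y (c : k) (f : kmap X Y) : kmap X Y := KMap (kmscale_subC c f).
Lemma kmscaleA X Y a b (f : kmap X Y) : kmscale a (kmscale b f) = kmscale (a * b) f.
Proof. by apply: kmap_ext => x /=; rewrite scalerA mulr_algl scalerA. Qed.
Lemma kmscale1 X Y : left_id 1 (@kmscale X Y).
Proof. by move=> f; apply: kmap_ext => x /=; rewrite scale1r scale1r. Qed.
Lemma kmscaleDr X Y : right_distributive (@kmscale X Y) +%R.
Proof. by move=> a f g; apply: kmap_ext => x /=; rewrite ?mE scalerDr. Qed.
Lemma kmscaleDl X Y (f : kmap X Y) : {morph (@kmscale X Y)^~ f : a b / a + b}.
Proof. by move=> a b; apply: kmap_ext => x /=; rewrite ?mE /= !scalerDl. Qed.
HB.instance Definition _ X Y := GRing.Zmodule_isLmodule.Build k (kmap X Y)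
  (@kmscaleA X Y) (@kmscale1 X Y) (@kmscaleDr X Y) (@kmscaleDl X Y).
Lemma m1Z X Y (c : k) (f : kmap X Y) x : m1 (c *: f) x = (c%:A : Lam) *: m1 f x. Proof. by []. Qed.
Lemma m0Z X Y (c : k) (f : kmap X Y) x : m0 (c *: f) x = (c%:A : Lam) *: m0 f x. Proof. by []. Qed.

Lemma kcompZl X Y Z (c : k) (g : kmap Y Z) (f : kmap X Y) : (c *: g) \k f = c *: (g \k f).
Proof. exact: kmap_ext. Qed.
Lemma kcompZr X Y Z (c : k) (g : kmap Y Z) (f : kmap X Y) : g \k (c *: f) = c *: (g \k f).
Proof. by apply: kmap_ext => x; rewrite /= linearZ. Qed.
Lemma knullZ X Y (c : k) (f : kmap X Y) : knull f -> knull (c *: f).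
Proof.
move=> [h [h1 h0]].
have hl : linear (fun x => (c%:A : Lam) *: h x).
  by move=> a x y; rewrite linearP scalerDr !scalerA mulr_algl mulr_algr.
by exists (mklin hl); split=> x; rewrite ?m1Z ?m0Z ?h1 ?h0 //= linearZ.
Qed.
Lemma knull_sub X Y : submodule (@knull _ X Y).
Proof. by split; [exact: knull0 | move=> c f g hf hg; apply: knullD => //; apply: knullZ]. Qed.

Lemma lin_span_ext (P : lmodType Lam) : fin_gen P -> exists s : seq P,
  forall (Q : lmodType Lam) (f g : {linear P -> Q}), (forall i : 'I_(size s), f s`_i = g s`_i) ->
    f =1 g.
Proof.
move=> [s sP]; exists s => Q f g h x; have [c ->] := sP x.
by rewrite !linear_sum; apply: eq_bigr => i _; rewrite !linearZ h.
Qed.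

Lemma fdim_kmap X Y : fdim (kmap X Y).
Proof.
have [s1 s1P] := lin_span_ext (km1P X).1; have [s0 s0P] := lin_span_ext (k0P X).1.
have [n1 [b1 b1i]] := (fin_genP _).1 (km1P Y).1.
have [n0 [b0 b0i]] := (fin_genP _).1 (k0P Y).1.
pose F (f : kmap X Y) : 'M[k]_(size s1, n1) * 'M[k]_(size s0, n0) :=
  (\matrix_(i, j) b1 (m1 f s1`_i) 0 j, \matrix_(i, j) b0 (m0 f s0`_i) 0 j).
have Fl : linear F.
  move=> c f g; apply/pair_equal_spec; split; apply/matrixP => i j; rewrite !mxE.
    have -> : m1 (c *: f + g) s1`_i = c *: (m1 f s1`_i : kres _) + m1 g s1`_i by [].
    by rewrite linearP !mxE.
  have -> : m0 (c *: f + g) s0`_i = c *: (m0 f s0`_i : kres _) + m0 g s0`_i by [].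
  by rewrite linearP !mxE.
have [p [q qi]] := fdim_vect ('M[k]_(size s1, n1) * 'M[k]_(size s0, n0))%type.
exists p, (q \o mklin Fl) => f g /qi /= /pair_equal_spec [e1 e0].
apply: kmap_ext; [apply: s1P | apply: s0P] => i.
  by apply: b1i; apply/rowP => j; have /matrixP/(_ i j) := e1; rewrite !mxE.
by apply: b0i; apply/rowP => j; have /matrixP/(_ i j) := e0; rewrite !mxE.
Qed.

Lemma kmap_span X Y : exists n (s : 'I_n -> kmap X Y), forall f, exists c : 'I_n ->
  k, f = \sum_i c i *: s i.
Proof. exact: fdim_span (fdim_kmap X Y). Qed.

Definition khom X Y : lmodType k := quotm (@knull_sub X Y).
Definition kcl X Y : {linear kmap X Y -> khom X Y} := qpi (@knull_sub X Y).
Lemma fdim_khom X Y : fdim (khom X Y).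
Proof. apply: (@fdim_quot _ _ _ (kcl X Y)); [exact: qpi_surj | exact: fdim_kmap]. Qed.
End Restrict.

(** * The Krull-Schmidt property *)

Section KS.
Variables (k : fieldType) (Lam : falgType k).
Implicit Types X Y Z U V W A B : ktwo Lam.

Lemma khiso_lr X Y (f : kmap X Y) a b : a \k f ~~ kid X -> f \k b ~~ kid Y -> khiso f.
Proof.
move=> h1 h2; exists a; split=> //.
have e : a ~~ b by rewrite -(kcomp1r a) -h2 kcompA h1 kcomp1l.
by rewrite e.
Qed.
Lemma khiso_eq X Y (f g : kmap X Y) : f ~~ g -> khiso f -> khiso g.
Proof. by move=> e [f' [h1 h2]]; exists f'; split; rewrite -e. Qed.

Lemma kzeroP X : kiso X (kzero Lam) <-> knull (kid X).
Proof.
rewrite kisoE -khtp0; split=> [[f [g [h _]]]|h].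
  rewrite -h (_ : g \k f = 0) //.
  by apply: kmap_ext => x; apply: zmod0_lin.
exists 0, 0; split; first by rewrite kcomp0l; symmetry.
rewrite (_ : _ \k _ = kid _) //.
by apply: kmap_ext => x; apply/rowP => -[].
Qed.
Lemma ksum0 X Y : kiso Y (kzero Lam) -> kiso (ksum X Y) X.
Proof.
move=> /kzeroP/khtp0 h; apply/kisoE; exists (kfst _ _), (kinl _ _); split.
  rewrite -[Q0 in _ ~~ Q0]ksum_id.
  have -> : kinr X Y \k ksnd X Y = kinr X Y \k kid Y \k ksnd X Y by rewrite kcomp1r.
  by rewrite h kcomp0r kcomp0l addr0.
by rewrite kfst_inl.
Qed.
Lemma kret_zero X Y : kiso X (kzero Lam) -> kret X Y.
Proof.
move=> /kzeroP/khtp0 h; exists 0, 0; rewrite kcomp0l; by symmetry.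
Qed.

Definition kexp V (e : kmap V V) n : kmap V V := iter n (kcomp e) (kid V).
Lemma kexpSr V (e : kmap V V) n : kexp e n.+1 = kexp e n \k e.
Proof.
elim: n => [|n IH]; first by rewrite /kexp /= kcomp1r kcomp1l.
by rewrite -[LHS]/(e \k kexp e n.+1) {1}IH kcompA.
Qed.
Lemma kexpD V (e : kmap V V) n m : kexp e (n + m) = kexp e n \k kexp e m.
Proof.
elim: n => [|n IH]; first by rewrite kcomp1l.
by rewrite addSn -[LHS]/(e \k kexp e (n + m)) IH -[kexp e n.+1]/(e \k kexp e n) kcompA.
Qed.
Lemma kcomp_sumr X Y Z (I : Type) (r : seq I) (g : kmap Y Z) (F : I -> kmap X Y) :
  g \k (\sum_(i <- r) F i) = \sum_(i <- r) g \k F i.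
Proof. by elim/big_rec2: _ => [|i a b _ <-]; rewrite ?kcomp0r ?kcompDr. Qed.
(** The value at e of the polynomial with coefficients s, by the Horner
    scheme. *)
Definition khorner V (e : kmap V V) (s : seq k) : kmap V V :=
  foldr (fun c a => c *: kid V + e \k a) 0 s.
Lemma khorner_comm V (e : kmap V V) s : khorner e s \k e = e \k khorner e s.
Proof.
elim: s => [|c s IH] /=; first by rewrite kcomp0l kcomp0r.
by rewrite kcompDl kcompDr kcompZl kcompZr kcomp1l kcomp1r -kcompA IH.
Qed.
Lemma khornerE V (e : kmap V V) (v : nat -> k) n :
  \sum_(i < n) v i *: kexp e i = khorner e (mkseq v n).
Proof.
elim: n v => [|n IH] v; first by rewrite big_ord0.
rewrite big_ord_recl /= -[iota 1 n]/(iota (1 + 0) n) iotaDl -map_comp -[map _ _]/(mkseq (v \o S)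
  n) -IH.
rewrite kcomp_sumr; congr (_ + _); apply: eq_bigr => i _.
by rewrite -kcompZr.
Qed.

(** If e is a root of a nonzero polynomial, dividing by the lowest nonzero
    coefficient writes some power of e as the next power times a polynomial in
    e. *)
Lemma khorner_regular V (e : kmap V V) s r : has (fun c => c != 0) s ->
  kexp e r \k khorner e s = 0 ->
  exists r' (B : kmap V V), kexp e r' = kexp e r'.+1 \k B /\ B \k e = e \k B.
Proof.
elim: s r => [|c s IH] r //=.
case: (eqVneq c 0) => [-> /= h|c0 _] e0.
  by apply: (IH r.+1) => //; rewrite kexpSr -kcompA -[RHS]e0 scale0r add0r.
exists r, (- (c^-1 *: khorner e s)); split; last first.
  by rewrite kcompNl kcompNr kcompZl kcompZr khorner_comm.
move: e0; rewrite kcompDr kcompZr kcomp1r kcompA -kexpSr => /eqP; rewrite addr_eq0 => /eqP e0.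
by rewrite kcompNr kcompZr -scalerN -e0 scalerA mulVf ?scale1r.
Qed.

(** Endomorphisms of V form a finite-dimensional algebra, in which the powers
    of e are linearly dependent. *)
Lemma pi_regular V (e : kmap V V) : exists r (B : kmap V V),
  kexp e r = kexp e r.+1 \k B /\ B \k e = e \k B.
Proof.
have [n [s sP]] := kmap_span V V.
have [c cP] := choose_fun (fun i => sP (kexp e i)).
pose C : 'M[k]_(n.+1, n) := \matrix_(i, j) c i j.
have : kermx C != 0.
  by rewrite kermx_eq0 /row_free; apply/negP => /eqP h; have := rank_leq_col C; rewrite h ltnn.
case/rowV0Pn => u /sub_kermxP uC u0.
pose v i := if insub i is Some j then u 0 (j : 'I_n.+1) else 0.
apply: (@khorner_regular V e (mkseq v n.+1) 0).
  have [i hi] := rV0Pn _ u0; apply/hasP; exists (v i); last by rewrite /v valK.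
  by apply: map_f; rewrite mem_iota /= add0n ltn_ord.
rewrite kcomp1l -khornerE.
under eq_bigr => i _ do rewrite /v valK cP scaler_sumr.
rewrite exchange_big /= big1 // => j _.
under eq_bigr => i _ do rewrite scalerA.
have S0 : \sum_(i < n.+1) u 0 i * c i j = 0.
  have := congr1 (fun w : 'rV_n => w 0 j) uC; rewrite !mxE => h0; rewrite -[RHS]h0.
  by apply: eq_bigr => i _; rewrite mxE.
by rewrite -scaler_suml S0 scale0r.
Qed.

Lemma strongly_pi_regular V (e : kmap V V) : exists r (A : kmap V V),
  kexp e r.+1 = kexp e r.+1 \k kexp e r.+1 \k A /\ A \k e = e \k A.
Proof.
have [r [B [h c]]] := pi_regular e.
have cB n : kexp B n \k e = e \k kexp B n.
  elim: n => [|n IH]; first by rewrite kcomp1l kcomp1r.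
  by rewrite -[kexp B n.+1]/(B \k kexp B n) -kcompA IH kcompA c -kcompA.
have h1 m : kexp e r.+1 = kexp e (r.+1 + m) \k kexp B m.
  elim: m => [|m IH]; first by rewrite addn0 kcomp1r.
  rewrite {1}IH -[kexp B m.+1]/(B \k kexp B m) kcompA; congr (_ \k _).
  have hh j : kexp e (j + r) = kexp e (j + r).+1 \k B.
    by rewrite kexpD h kcompA -kexpD addnS.
  by rewrite (addnC r.+1 m.+1) addnS -hh addSnnS addnC.
exists r, (kexp B r.+1); split; last exact: cB.
by rewrite {1}(h1 r.+1) kexpD.
Qed.

(** A strict idempotent splits degreewise; its images are retracts of
    projective modules. *)
Lemma kidem_img V (p : kmap V V) : p \k p = p ->
  exists I (i : kmap I V) (q : kmap V I), q \k i = kid I /\ i \k q = p.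
Proof.
move=> pp.
have p1 x : m1 p (m1 p x) = m1 p x by rewrite -[X in _ = m1 X x]pp.
have p0 x : m0 p (m0 p x) = m0 p x by rewrite -[X in _ = m0 X x]pp.
pose q1 : {linear km1 V -> km1 V} := idfun \- m1 p.
pose q0 : {linear k0 V -> k0 V} := idfun \- m0 p.
have [r1 r1P] : exists r : {linear km1 V -> kerm q1}, forall x, kinj q1 (r x) = m1 p x.
  by apply: ker_lift => x; rewrite /q1 /= p1 subrr.
have [r0 r0P] : exists r : {linear k0 V -> kerm q0}, forall x, kinj q0 (r x) = m0 p x.
  by apply: ker_lift => x; rewrite /q0 /= p0 subrr.
have k1 x : m1 p (kinj q1 x) = kinj q1 x.
  by have /eqP := kinjK x; rewrite /= subr_eq0 => /eqP <-.
have k0' x : m0 p (kinj q0 x) = kinj q0 x.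
  by have /eqP := kinjK x; rewrite /= subr_eq0 => /eqP <-.
have rk1 x : r1 (kinj q1 x) = x by apply: (@kinj_inj _ _ _ q1); rewrite r1P k1.
have rk0 x : r0 (kinj q0 x) = x by apply: (@kinj_inj _ _ _ q0); rewrite r0P k0'.
have [d dP] : exists d : {linear kerm q1 -> kerm q0}, forall x, kinj q0 (d x) = kd V (kinj q1 x).
  exists (r0 \o kd V \o kinj q1) => x.
  by apply: etrans (r0P (kd V (kinj q1 x))) _; rewrite mC k1.
pose I := KTwo d (fg_projective_ret rk1 (km1P V)) (fg_projective_ret rk0 (k0P V)).
pose i : kmap I V := @KMap _ I V (kinj q1) (kinj q0) dP.
have qC x : r0 (kd V x) = kd I (r1 x).
  by apply: (@kinj_inj _ _ _ q0); rewrite r0P dP r1P mC.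
exists I, i, (@KMap _ V I r1 r0 qC); split; first exact: kmap_ext.
exact: kmap_ext.
Qed.

Lemma kidem_split V (p : kmap V V) : p \k p = p ->
  exists I K (i : kmap I V) (q : kmap V I) (i' : kmap K V) (q' : kmap V K),
   [/\ q \k i = kid I, i \k q = p, q' \k i' = kid K, i' \k q' = kid V - p & kiso V (ksum I K)].
Proof.
move=> pp; have [I [i [q [h1 h2]]]] := kidem_img pp.
have [|K [i' [q' [h3 h4]]]] := @kidem_img V (kid V - p).
  rewrite kcompDl !kcompDr !kcompNl !kcompNr !(kcomp1l, kcomp1r) pp; abel.
exists I, K, i, q, i', q'; split=> //.
have e1 : q' \k i = 0.
  rewrite -[q']kcomp1l -h3 -(kcompA q') h4 -!kcompA kcompDl kcompNl -h2 -!kcompA h1 !kcomp1r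
    kcomp1l subrr.
  by rewrite !kcomp0r.
have e2 : q \k i' = 0.
  rewrite -[i']kcomp1r -h3 (kcompA i') h4 kcompA kcompDr kcompNr -h2 kcompA h1 kcomp1l kcomp1r
    subrr.
  by rewrite kcomp0l.
apply/kisoE; exists (kinl _ _ \k q + kinr _ _ \k q'), (i \k kfst _ _ + i' \k ksnd _ _); split.
  rewrite kcompDl !kcompDr -!kcompA !(kcompA (kfst _ _)) !(kcompA (ksnd _ _)).
  by rewrite kfst_inl kfst_inr ksnd_inl ksnd_inr !kcomp0l !kcomp1l !kcomp0r addr0 add0r h2 h4
    addrC subrK.
rewrite kcompDl !kcompDr -!kcompA !(kcompA q) !(kcompA q') h1 h3 e1 e2 !kcomp0l !kcomp1l !kcomp0r
  addr0 add0r.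
by rewrite ksum_id.
Qed.

Definition kind V := indecomposable (@kiso Lam) (kzero Lam) (@ksum Lam) V.

(** Fitting's lemma. With E a power of e and E = E E A, where A commutes with
    e, the product E A is an idempotent; e is invertible on its image and
    nilpotent on its kernel. Working with chain maps rather than homotopy
    classes makes the idempotent strict. *)
Lemma fitting V (e : kmap V V) : exists n I K (i : kmap I V) (q : kmap V I) (i' : kmap K V) (q' :
  kmap V K),
  [/\ q \k i = kid I, q' \k i = 0, i \k q + i' \k q' = kid V & kexp e n \k i' = 0] /\
  [/\ kiso V (ksum I K) & kiso K (kzero Lam) -> khiso e].
Proof.
have [r [A [h c]]] := strongly_pi_regular e.
have cA n : A \k kexp e n = kexp e n \k A.
  elim: n => [|n IH]; first by rewrite kcomp1l kcomp1r.
  by rewrite -[kexp e n.+1]/(e \k kexp e n) kcompA c -kcompA IH kcompA.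
pose E := kexp e r.+1; pose p := E \k A.
have Ep : E \k p = E by rewrite /p kcompA -h.
have pp : p \k p = p.
  transitivity (E \k p \k A); last by rewrite Ep.
  by rewrite /p (kcompA (E \k A)) -(kcompA E A E) cA.
have [I [K [i [q [i' [q' [h1 h2 h3 h4 hV]]]]]]] := kidem_split pp.
exists r.+1, I, K, i, q, i', q'; split; split=> //.
- rewrite -[q']kcomp1l -h3 -(kcompA q') h4 -!kcompA kcompDl kcompNl -h2 -!kcompA h1 !kcomp1r
  kcomp1l subrr.
  by rewrite !kcomp0r.
- by rewrite h2 h4 addrC subrK.
- by rewrite -[i']kcomp1r -h3 (kcompA i') h4 kcompA kcompDr kcompNr kcomp1r -/E Ep subrr kcomp0l.
move=> /kzeroP/khtp0 h0.
have p1 : p ~~ kid V.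
  symmetry; have -> : kid V = (kid V - p) + p by rewrite subrK.
  by rewrite -{1}h4 -[i']kcomp1r h0 kcomp0r kcomp0l add0r.
apply: (@khiso_lr _ _ e (A \k kexp e r) (kexp e r \k A)).
  by rewrite -kcompA -kexpSr cA.
by rewrite kcompA.
Qed.

(** The endomorphism ring of an indecomposable is local. *)
Lemma ks_local V : kind V -> forall e : kmap V V, (exists n, kexp e n ~~ 0) \/ khiso e.
Proof.
move=> [_ ind] e.
have [n [I [K [i [q [i' [q' [[h1 _ h3 h4] [hV hK]]]]]]]]] := fitting e.
case: (ind _ _ hV) => [/kzeroP/khtp0 h0|]; last by right; apply: hK.
left; exists n; rewrite -[kexp e n]kcomp1r -h3 kcompDr !kcompA h4 kcomp0l addr0.
by rewrite -[i]kcomp1r h0 !(kcomp0r, kcomp0l).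
Qed.

Definition kgeo V (x : kmap V V) n : kmap V V := \sum_(i < n) kexp x i.
Lemma kgeoP V (x : kmap V V) n : (kid V - x) \k kgeo x n =
  kid V - kexp x n /\ kgeo x n \k (kid V - x) = kid V - kexp x n.
Proof.
rewrite /kgeo; elim: n => [|n [IH1 IH2]].
  by rewrite big_ord0 kcomp0r kcomp0l /kexp /= subrr.
rewrite big_ord_recr /=; split.
  rewrite kcompDr IH1 kcompDl kcompNl kcomp1l -[x \k kexp x n]/(kexp x n.+1); abel.
rewrite kcompDl IH2 kcompDr kcompNr kcomp1r -kexpSr; abel.
Qed.
Lemma khiso_1Bnil V (x : kmap V V) n : kexp x n ~~ 0 -> khiso (kid V - x).
Proof.
move=> h; have [h1 h2] := kgeoP x n.
apply: (@khiso_lr _ _ _ (kgeo x n) (kgeo x n)); by rewrite ?h1 ?h2 h oppr0 addr0.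
Qed.

Lemma ks_unit_or V : kind V -> forall x y : kmap V V, x + y ~~ kid V -> khiso x \/ khiso y.
Proof.
move=> indV x y e; case: (ks_local indV x) => [[n xn]|]; last by left.
right; apply: khiso_eq (khiso_1Bnil xn).
by rewrite -e addrAC subrr add0r.
Qed.
Lemma ks_retP V A : kind V -> (exists (a : kmap V A) (c : kmap A V), khiso (c \k a)) -> kret V A.
Proof. by move=> _ [a [c [g [h _]]]]; exists a, (g \k c); rewrite -kcompA. Qed.

Lemma ks_or V A B : kind V -> kret V (ksum A B) -> kret V A \/ kret V B.
Proof.
move=> indV [a [c h]].
have e : c \k (kinl A B \k kfst A B) \k a + c \k (kinr A B \k ksnd A B) \k a ~~ kid V.
  by rewrite -kcompDl -kcompDr ksum_id kcomp1r.
case: (ks_unit_or indV e) => hh; [left|right]; apply: (ks_retP indV).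
  by exists (kfst A B \k a), (c \k kinl A B); rewrite kcompA -(kcompA c).
by exists (ksnd A B \k a), (c \k kinr A B); rewrite kcompA -(kcompA c).
Qed.
(** Cancellation: the part of the identity of U that factors through V is
    nilpotent, since V is not a summand of U, so the part that factors through
    Z is invertible. *)
Lemma ks_exch V U Z : kind V -> ~ kret V U -> kret U (ksum V Z) -> kret U Z.
Proof.
move=> indV nV [a [c h]].
pose a1 := kfst V Z \k a; pose c1 := c \k kinl V Z.
pose a2 := ksnd V Z \k a; pose c2 := c \k kinr V Z.
have e : c1 \k a1 + c2 \k a2 ~~ kid U.
  have -> : c1 \k a1 = c \k (kinl V Z \k kfst V Z) \k a by rewrite /c1 /a1 !kcompA.
  have -> : c2 \k a2 = c \k (kinr V Z \k ksnd V Z) \k a by rewrite /c2 /a2 !kcompA.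
  by rewrite -kcompDl -kcompDr ksum_id kcomp1r.
case: (ks_local indV (a1 \k c1)) => [[n hn]|hh]; last first.
  by case: nV; apply: (ks_retP indV); exists c1, a1.
have hn' : kexp (c1 \k a1) n.+1 ~~ 0.
  have -> : kexp (c1 \k a1) n.+1 = c1 \k kexp (a1 \k c1) n \k a1.
    elim: {hn} n => [|n IH]; first by rewrite /kexp /= !kcomp1r.
    rewrite -[LHS]/((c1 \k a1) \k kexp (c1 \k a1) n.+1) IH -[kexp (a1 \k c1) n.+1]/((a1 \k c1) \k
      kexp (a1 \k c1) n).
    by rewrite !kcompA.
  by rewrite hn kcomp0r kcomp0l.
have : khiso (c2 \k a2).
  apply: khiso_eq (khiso_1Bnil hn').
  by rewrite -e addrAC subrr add0r.
by move=> [g [h1 _]]; exists a2, (g \k c2); rewrite -kcompA.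
Qed.
Lemma ks_pow V W n : kind V -> kret V (kpow W n) -> kret V W.
Proof.
move=> indV; elim: n => [|n IH] /=.
  move=> [a [c h]]; case: (indV.1); apply/kzeroP; apply/khtp0; rewrite -h.
  rewrite (_ : c \k a = 0) //.
  by apply: kmap_ext => x; apply: zmod0_lin.
by move=> /(ks_or indV) [].
Qed.
Lemma ks_indret V W : kind V -> kind W -> kret V W -> kiso V W.
Proof.
move=> [nV _] [nW indW] /kret_summand [A hA].
case: (indW _ _ hA) => // /ksum0 h.
by apply: kiso_sym; apply: kiso_trans hA (h _).
Qed.
End KS.

Section Measure.
Variables (k : fieldType) (Lam : falgType k).
Implicit Types X Y Z U V W A B : ktwo Lam.

Lemma qlift_inj (V W : lmodType k) (S : V -> Prop) (S' : W ->
  Prop) (HS : submodule S) (HS' : submodule S')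
  (t : {linear V -> W}) : (forall v, S' (t v) <-> S v) ->
  exists t' : {linear quotm HS -> quotm HS'}, injective t' /\ forall v,
    t' (qpi HS v) = qpi HS' (t v).
Proof.
move=> h.
have [t' tE] : exists t' : {linear quotm HS -> quotm HS'}, forall v,
  t' (qpi HS v) = (qpi HS' \o t) v.
  by apply: fact_surj (qpi_surj HS) _ => v /qpi_eq0 hv; apply/qpi_eq0/h.
exists t'; split=> //; apply: lin_inj => a; have [v <-] := qpi_surj HS a.
by rewrite tE /= => /qpi_eq0/h hv; apply/qpi_eq0.
Qed.

(** A size for inductions over direct sum decompositions: it drops strictly
    when a nonzero summand is split off. *)
Definition mu X : nat := kdim (khom X X).

Lemma kconj_lin X Y (f : kmap X Y) (g : kmap Y X) : linear (fun e : kmap X X => f \k e \k g).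
Proof. by move=> c a b; rewrite kcompDr kcompDl kcompZr kcompZl. Qed.
Lemma kconj_null X Y (f : kmap X Y) (g : kmap Y X) : g \k f ~~ kid X ->
  forall e, knull (f \k e \k g) <-> knull e.
Proof.
move=> h e; split=> he; last by apply/knull_r/knull_l.
apply/khtp0; have -> : e ~~ g \k (f \k e \k g) \k f.
  by rewrite !kcompA h kcomp1l -kcompA h kcomp1r.
by have /khtp0 -> := he; rewrite kcomp0r kcomp0l.
Qed.
Lemma mu_ret X Y : kret X Y -> (mu X <= mu Y)%N.
Proof.
move=> [f [g h]].
have [t [ti _]] := qlift_inj (knull_sub X X) (knull_sub Y Y) (t :=
  mklin (kconj_lin f g)) (kconj_null h).
exact: kdim_le ti (fdim_khom Y Y).
Qed.
Lemma mu_iso X Y : kiso X Y -> mu X = mu Y.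
Proof.
move=> h; apply/eqP; rewrite eqn_leq !mu_ret //; apply/kiso_ret => //; exact: kiso_sym.
Qed.
(** The diagonal blocks of the endomorphism ring of a direct sum. *)
Lemma mu_sum A B : (mu A + mu B <= mu (ksum A B))%N.
Proof.
have h1 : kfst A B \k kinl A B ~~ kid A by rewrite kfst_inl.
have h2 : ksnd A B \k kinr A B ~~ kid B by rewrite ksnd_inr.
have [t [ti tE]] := qlift_inj (knull_sub A A) (knull_sub (ksum A B) _) (t :=
  mklin (kconj_lin (kinl A B) (kfst A B))) (kconj_null h1).
have [u [ui uE]] := qlift_inj (knull_sub B B) (knull_sub (ksum A B) _) (t :=
  mklin (kconj_lin (kinr A B) (ksnd A B))) (kconj_null h2).
rewrite -kdim_prod; try exact: fdim_khom.
apply: (@kdim_le _ _ _ (pair_case t u)); last exact: fdim_khom.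
apply: lin_inj => -[a b]; have [f <-] := qpi_surj (knull_sub A A) a;
  have [g <-] := qpi_surj (knull_sub B B) b.
rewrite /= /pair_case /= tE uE -linearD => /qpi_eq0 /= hn.
apply/pair_equal_spec; split; apply/qpi_eq0.
  have := knull_r (kinl A B) (knull_l (kfst A B) hn).
  rewrite kcompDr kcompDl !kcompA kfst_inl kfst_inr kcomp1l !kcomp0l addr0.
  by rewrite -kcompA kfst_inl kcomp1r.
have := knull_r (kinr A B) (knull_l (ksnd A B) hn).
rewrite kcompDr kcompDl !kcompA ksnd_inl ksnd_inr kcomp1l !kcomp0l add0r.
by rewrite -kcompA ksnd_inr kcomp1r.
Qed.
Lemma mu0 X : mu X = 0%N <-> kiso X (kzero Lam).
Proof.
rewrite kzeroP; split=> [/(kdim0 (fdim_khom X X)) h|h].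
  by apply/(qpi_eq0 (knull_sub X X))/h.
apply/(kdim0 (fdim_khom X X)) => a; have [f <-] := qpi_surj (knull_sub X X) a.
by apply/qpi_eq0; rewrite -[f]kcomp1r; apply: knull_l.
Qed.
Lemma mu_gt0 X : ~ kiso X (kzero Lam) -> (0 < mu X)%N.
Proof. by move=> h; rewrite lt0n; apply/eqP => /mu0. Qed.

Lemma ks_exists_ind U : ~ kiso U (kzero Lam) -> exists V A, kind V /\ kiso U (ksum V A).
Proof.
have [n] := ubnP (mu U); elim: n U => // n IH U /ltnSE le nU.
case: (classic (kind U)) => [iU|niU].
  exists U, (kzero Lam); split=> //; apply: kiso_sym; apply: ksum0; exact: kiso_refl.
have [Y [Z [hYZ nY nZ]]] : exists Y Z, [/\ kiso U (ksum Y Z),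
  ~ kiso Y (kzero Lam) & ~ kiso Z (kzero Lam)].
  apply: NNPP => h; apply: niU; split=> // Y Z hYZ.
  case: (classic (kiso Y (kzero Lam))); first by left.
  case: (classic (kiso Z (kzero Lam))); first by right.
  by move=> a b; case: h; exists Y, Z.
have lt : (mu Y < n)%N.
  apply: leq_trans le; rewrite (mu_iso hYZ); apply: leq_trans (mu_sum Y Z).
  by rewrite -addn1 leq_add2l mu_gt0.
have [V [A [iV hV]]] := IH Y lt nY.
exists V, (ksum A Z); split=> //; apply: kiso_trans hYZ _.
apply: kiso_trans (ksum_iso hV (kiso_refl Z)) _.
exact/kiso_sym/ksumA.
Qed.

Lemma kbasic_iso U U' : kiso U U' -> kbasic U -> kbasic U'.
Proof. by move=> h b V V' W i1 i2 h'; apply: (b V V' W i1 i2); apply: kiso_trans h h'. Qed.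
Lemma kbasic_noret U V A : kbasic U -> kind V -> kiso U (ksum V A) -> ~ kret V A.
Proof.
move=> b iV hU /kret_summand [A' hA].
apply: (b V V A' iV iV _ (kiso_refl V)).
apply: kiso_trans hU _; apply: kiso_trans (ksum_iso (kiso_refl V) hA) _; exact: ksumA.
Qed.
Lemma kbasic_sub U V A : kbasic U -> kiso U (ksum V A) -> kbasic A.
Proof.
move=> b hU P Q W iP iQ hA.
apply: (b P Q (ksum W V) iP iQ).
apply: kiso_trans hU _; apply: kiso_trans (ksumC _ _) _.
by apply: kiso_trans (ksum_iso hA (kiso_refl V)) _; apply/kiso_sym/ksumA.
Qed.

Lemma ks_exch_pow V A Z n : kind V -> ~ kret V A -> kret A (ksum (kpow V n) Z) -> kret A Z.
Proof.
move=> iV nV; elim: n => [|n IH] h.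
  apply: kret_trans h (kret_trans (kiso_ret (ksumC _ _)) (kiso_ret (ksum0 _ (kiso_refl _)))).
apply: IH; apply: (ks_exch iV nV).
exact: kret_trans h (kiso_retV (ksumA _ _ _)).
Qed.
Lemma kpow_sum V W n : kret (kpow (ksum V W) n) (ksum (kpow V n) (kpow W n)).
Proof.
elim: n => [|n IH] /=; first exact: kret_suml.
apply: kret_trans (kret_sum (kret_refl _) IH) _.
set P := kpow V n; set Q := kpow W n.
apply: kiso_ret; apply: kiso_trans (kiso_sym (ksumA V W (ksum P Q))) _.
apply: kiso_trans (ksumA V P (ksum W Q)).
apply: ksum_iso; first exact: kiso_refl.
apply: kiso_trans (ksumA W P Q) _; apply: kiso_trans (kiso_sym (ksumA P W Q)).
by apply: ksum_iso; [exact: ksumC | exact: kiso_refl].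
Qed.
Lemma kpow_ret V W n : kret V W -> kret (kpow V n) (kpow W n).
Proof. by move=> h; elim: n => [|n IH] /=; [exact: kret_refl | exact: kret_sum]. Qed.

(** Split off an indecomposable summand V of U. It is a summand of W, and
    since U is basic it does not occur in the rest A of U, so it can be
    cancelled from all the copies of W; what remains is a power of the
    complement W1. *)
Lemma ks_basic_pow U W n : kbasic U -> kret U (kpow W n) -> kret U W.
Proof.
have [m] := ubnP (mu U); elim: m U W => // m IH U W /ltnSE le bU hU.
case: (classic (kiso U (kzero Lam))) => [/kret_zero //|nU].
have [V [A [iV hVA]]] := ks_exists_ind nU.
have VU : kret V U by apply: kiso_retl hVA.
have AU : kret A U by apply: kiso_retr hVA.
have /kret_summand [W1 hW] := ks_pow iV (kret_trans VU hU).
have nVA := kbasic_noret bU iV hVA.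
have AW1 : kret A W1.
  apply: (IH _ W1).
  - apply: leq_trans le; rewrite (mu_iso hVA); apply: leq_trans (mu_sum V A).
    by rewrite -add1n leq_add2r mu_gt0 //; case: iV.
  - exact: kbasic_sub bU hVA.
  - apply: (ks_exch_pow (n := n) iV nVA).
    apply: kret_trans AU (kret_trans hU (kret_trans (kpow_ret _ (kiso_ret hW)) (kpow_sum _ _ _))).
apply: kret_trans (kiso_ret hVA) (kret_trans (kret_sum (kret_refl V) AW1) (kiso_retV hW)).
Qed.
Lemma kbasic_add U W : kbasic U -> kadd W U -> kret U W.
Proof. by move=> b /kaddE [n h]; apply: ks_basic_pow b h. Qed.
Lemma kret_antisym U U' : kret U U' -> kret U' U -> kiso U U'.
Proof.
move=> /kret_summand [A hA] h2.
have : mu A = 0%N.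
  apply/eqP; rewrite -leqn0 -(leq_add2l (mu U)) addn0; apply: leq_trans (mu_sum U A) _.
  by rewrite -(mu_iso hA) mu_ret.
move/mu0 => h0; apply: kiso_sym; apply: kiso_trans hA _; exact: ksum0.
Qed.
Lemma kbasic_uniq U U' : kbasic U -> kbasic U' -> kadd U = kadd U' -> kiso U U'.
Proof.
move=> b b' e; apply: kret_antisym; apply: kbasic_add => //.
  by rewrite -e; apply: kadd_self.
by rewrite e; apply: kadd_self.
Qed.
Lemma kadd_isoE U U' : kiso U U' -> kadd U = kadd U'.
Proof.
move=> h; apply: kadd_sub.
  by apply: kadd_iso h _; apply: kadd_self.
by apply: kadd_iso (kiso_sym h) _; apply: kadd_self.
Qed.
(** Among the generators of add T take one of least size: a repeated summand
    could be dropped. *)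
Lemma kbasic_exists T : exists U, kbasic U /\ kadd U = kadd T.
Proof.
pose P n := decide (exists U, kadd U = kadd T /\ mu U = n).
have ex : exists n, P n by exists (mu T); apply/decideP; exists T.
case: (ex_minnP ex) => n /decideP [U [eU mU]] mn.
exists U; split=> // V V' W iV iV' hU hVV.
have : (mu U <= mu (ksum V W))%N.
  rewrite mU; apply: mn; apply/decideP; exists (ksum V W); split=> //.
  rewrite -eU (kadd_isoE hU); apply: kadd_sub; last first.
    apply: kadd_sum; last by apply: kadd_sumr.
    by apply: kadd_ret (kret_trans (kret_suml _ _) (kret_suml _ _)) (kadd_self _).
  have hV : kadd (ksum V W) V by apply: kadd_suml.
  apply: kadd_sum; last by apply: kadd_sumr.
  by apply: kadd_sum => //; apply: kadd_iso hVV hV.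
rewrite leqNgt => /negP; apply.
have -> : mu U = mu (ksum V' (ksum V W)).
  apply: mu_iso; apply: kiso_trans hU _; apply: kiso_trans (ksum_iso (ksumC V V') (kiso_refl W)) _.
  exact/kiso_sym/ksumA.
apply: leq_trans (mu_sum _ _); rewrite -add1n leq_add2r mu_gt0 //; by case: iV'.
Qed.
End Measure.

(** * Silting objects and complete cotorsion pairs *)

Section WcThick.
Variable R : nzRingType.
Implicit Types X Y Z U V W A B C : ktwo R.

(** Hom(X, N) = 0 and E(X, N) = 0 for the module N in degree 0, in terms of
    the differential of X. *)
Definition Wc (N : lmodType R) (X : ktwo R) : Prop :=
  (forall f : {linear k0 X -> N}, (forall x, f (kd X x) = 0) -> forall y, f y = 0) /\
  (forall g : {linear km1 X -> N}, exists f : {linear k0 X -> N}, forall x, g x = f (kd X x)).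

(** If both groups vanish on two terms of a conflation, they vanish on the
    third, by the long exact sequence of Hom(-, N). *)
Lemma Wc_thick (N : lmodType R) : is_thick (Wc N).
Proof.
apply/is_thickE.
have hret : forall X Y, kret X Y -> Wc N Y -> Wc N X.
  move=> X Y [a [c [h [h1 h0]]]] [iY sY]; split.
    move=> f fx y.
    have e : y = m0 c (m0 a y) - kd X (h y) by rewrite -h0 mE /= opprD opprK addNKr.
    rewrite e linearB fx ?subr0; apply: (iY (f \o m0 c)) => x /=; by rewrite mC fx.
  move=> g; have [F FP] := sY (g \o m1 c).
  exists ((F \o m0 a) \- (g \o h)) => x /=.
  have e : x = m1 c (m1 a x) - h (kd X x) by rewrite -h1 mE /= opprD opprK addNKr.
  have /= Fx := FP (m1 a x).
  by rewrite [in LHS]e linearB Fx mC.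
split; first split=> //.
- split; first by move=> f _ y; apply: zmod0_lin.
  by move=> g; exists \0 => x; apply: zmod0_lin.
- move=> X Y [iX sX] [iY sY]; split.
    move=> f h [x y]; rewrite lin_pair.
    have -> : f (pair_inl _ x) = 0.
      apply: (iX (f \o @pair_inl _ _ _)) => z /=.
      by rewrite -[RHS](h (z, 0)); congr (f _); apply/pair_equal_spec; rewrite /= linear0.
    rewrite add0r; apply: (iY (f \o @pair_inr _ _ _)) => z /=.
    by rewrite -[RHS](h (0, z)); congr (f _); apply/pair_equal_spec; rewrite /= linear0.
  move=> g; have [F FP] := sX (g \o @pair_inl _ _ _); have [G GP] := sY (g \o @pair_inr _ _ _).
  exists (pair_case F G) => -[x y].
  by have /= Fx := FP x; have /= Gy := GP y; rewrite [LHS]lin_pair Fx Gy.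
move=> A B C [e hB].
have hB1 : Wc N B -> Wc N (kext e) by apply: hret; exact: kiso_retV.
have hB2 : Wc N (kext e) -> Wc N B by apply: hret; exact/kiso_ret.
split.
- move=> [iA sA] /hB1 [iB sB]; split.
    move=> f h z; apply: (iB (f \o (lsnd (k0 A) (k0 C))) _ (0, z)) => -[x w]; exact: h.
  move=> g; have [F FP] := sB (g \o (lsnd (km1 A) (km1 C))).
  have F0 x : F (pair_inl _ x) = 0.
    apply: (iA (F \o @pair_inl _ _ _)) => y /=.
    have /= := FP (y, 0); rewrite linear0 => ->; congr (F _); apply/pair_equal_spec.
    by rewrite /= !linear0 addr0.
  exists (F \o @pair_inr _ _ _) => z /=.
  by have /= -> := FP (0, z); rewrite lin_pair F0 add0r.
- move=> [iA sA] [iC sC]; apply: hB2; split.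
    move=> f h.
    have f0 x : f (pair_inl _ x) = 0.
      apply: (iA (f \o @pair_inl _ _ _)) => y /=; rewrite -[RHS](h (y, 0)).
      by congr (f _); apply/pair_equal_spec; rewrite /= !linear0 addr0.
    move=> [x z]; rewrite lin_pair f0 add0r.
    apply: (iC (f \o @pair_inr _ _ _)) => y /=; rewrite -[RHS](h (0, y)) /=.
    by rewrite [RHS]lin_pair f0 add0r.
  move=> g; have [F FP] := sA (g \o @pair_inl _ _ _).
  have [G GP] := sC ((g \o @pair_inr _ _ _) \- (F \o e)).
  exists (pair_case F G) => -[x z]; rewrite [LHS]lin_pair.
  have /= Gz := GP z; have /= Fx := FP x.
  by rewrite /pair_case /= -Gz linearD /= -Fx; abel.
- move=> /hB1 [iB sB] [iC sC]; split.
    move=> f h y.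
    have [G GP] := sC (f \o e).
    have <- : pair_case f (\- G) (pair_inl (k0 C) y) = f y := pair_caseL _ _ _.
    apply: (iB (pair_case f (\- G))) => -[x z].
    have /= Gz := GP z; rewrite /= /pair_case /= linearD h Gz; abel.
  move=> g; have [F FP] := sB (g \o (lfst (km1 A) (km1 C))).
  exists (F \o @pair_inl _ _ _) => x /=.
  by have /= -> := FP (x, 0); congr (F _); apply/pair_equal_spec; rewrite /= !linear0 addr0.
Qed.

Definition kstalk (P : lmodType R) (hP : fg_projective P) : ktwo R :=
  @KTwo R (zmod0 R) P \0 (fg_projective0 R) hP.
Lemma Ev_stalk (P : lmodType R) (hP : fg_projective P) Y : Ev (kstalk hP) Y.
Proof.
move=> f; exists \0, \0 => x; rewrite (_ : x = 0); last exact: zmod0_eq.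
by rewrite /= !linear0 addr0.
Qed.
Lemma Ev_kreg Y : Ev (kreg R) Y.
Proof. exact: Ev_stalk. Qed.

(** Z is the cone of its own differential, a map between projective modules in
    degree 0. *)
Lemma confl_stalk Z : confl (kstalk (km1P Z)) (kstalk (k0P Z)) Z.
Proof.
exists (idfun : {linear km1 Z -> km1 Z}); apply: kiso_sym; apply/kisoE.
set E := kext _.
pose f0 : {linear k0 E -> k0 Z} := pair_case (\- kd Z) idfun.
have fC x : f0 (kd E x) = kd (kstalk (k0P Z)) ((\0 : {linear km1 E -> zmod0 R}) x).
  by case: x => x z; rewrite /= /pair_case /= add0r addNr.
exists (@KMap R E (kstalk (k0P Z)) \0 f0 fC); apply: kqis_hiso; split.
- by move=> y; exists (0, y), 0; rewrite /= /pair_case /= linear0 ?oppr0 add0r addr0.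
- move=> [x z] y; rewrite /= /pair_case /= => /eqP; rewrite addrC subr_eq0 => /eqP ez.
  exists (0, x); last by apply/rowP => -[].
  by apply/pair_equal_spec; rewrite /= ez add0r.
- move=> [x z] /pair_equal_spec [/= e1 e2] _; apply/pair_equal_spec; split;
  first by apply/rowP => -[].
  by rewrite -e1 add0r.
Qed.

Lemma kstalk_add (P : lmodType R) (hP : fg_projective P) : kadd (kreg R) (kstalk hP).
Proof.
have [n [r rs]] := fg_cover hP.1.
have [t tP] := proj_sect hP.2 rs.
have triv m (x : km1 (kpow (kreg R) m)) : kd _ x = 0.
  elim: m x => [|m IH] x /=; first exact: zmod0_eq.
  by apply/pair_equal_spec; split=> //; apply: IH.
have aC x : t (kd (kstalk hP) x) = kd (kpow (kreg R) n) ((\0 : {linear _ -> _}) x).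
  by rewrite triv /= linear0.
have cC x : r (kd (kpow (kreg R) n) x) = kd (kstalk hP) ((\0 : {linear _ -> _}) x).
  by rewrite triv /= linear0.
apply/kaddE; exists n, (@KMap R (kstalk hP) (kpow (kreg R) n) \0 t aC),
  (@KMap R (kpow (kreg R) n) (kstalk hP) \0 r cC).
rewrite (_ : _ \k _ = kid _) //; apply: kmap_ext => x /=; last exact: tP.
by apply/rowP => -[].
Qed.

Lemma thick_kreg (T : class (ktwo R)) : is_thick T -> T (kreg R) -> forall Z, T Z.
Proof.
move=> hT h Z; have [_ ht] := (is_thickE T).1 hT.
have st (P : lmodType R) (hP : fg_projective P) : T (kstalk hP).
  exact: thick_kadd hT h (kstalk_add hP).
have [h1 _ _] := ht _ _ _ (confl_stalk Z); exact: h1.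
Qed.

Lemma shift_triv U n j : (0 < j + n%:Z) -> forall x y : iter n (@shift R) U j, x = y.
Proof.
elim: n j => [|n IH] j; first by rewrite addr0; case: j => [[|n]|n] // _ x y; apply/rowP => -[].
by move=> h; apply: IH; rewrite -addrA.
Qed.
Lemma siltingE U : silting U <-> Ev U U /\ forall X, thick (@kadd R U) X.
Proof.
split=> [[h1 h2]|[h1 h2]]; split.
- by apply/EvE; apply: (h1 1%N).
- by move=> X; rewrite h2.
- case=> [|[|n]] // _; first exact/EvE.
  move=> f; exists (fun _ => \0) => i x; rewrite /= addr0 linear0.
  case: (eqVneq (i + 1) (Negz 0)) => e1.
    by apply: shift_triv; rewrite e1.
  case: (eqVneq (i + 1) (Posz 0)) => e2.
    by apply: shift_triv; rewrite e2.
  by rewrite (_ : x = 0) ?linear0 //; apply: ob_triv.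
- by apply: class_ext => X; split.
Qed.
End WcThick.

Section Silting.
Variables (k : fieldType) (Lam : falgType k).
Implicit Types X Y Z U V W A B C T : ktwo Lam.
Implicit Types p : (class (ktwo Lam) * class (ktwo Lam))%type.

(** Hom(U, B) is finite-dimensional, so a basis of it gives a map from a power
    of U through which every map from U to B factors. *)
Lemma univ_map U B : exists n (p : kmap (kpow U n) B), forall g : kmap U B,
  exists i : kmap U (kpow U n), p \k i = g.
Proof.
have [m [s sP]] := kmap_span U B.
have fam (l : seq (kmap U B)) : exists p : kmap (kpow U (size l)) B,
    forall j, (j < size l)%N -> exists i : kmap U (kpow U (size l)), p \k i = l`_j.
  elim: l => [|g l [p pP]]; first by exists 0.
  exists (g \k kfst _ _ + p \k ksnd _ _) => -[|j] /= hj.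
    exists (kinl _ _); rewrite kcompDl -!kcompA kfst_inl ksnd_inl kcomp1r kcomp0r addr0 //.
  have [i hi] := pP j hj; exists (kinr _ _ \k i).
  by rewrite kcompDl -!kcompA !(kcompA (kfst _ _)) !(kcompA (ksnd _ _)) kfst_inr ksnd_inr kcomp0l
    kcomp1l kcomp0r add0r.
have [p pP] := fam [seq s j | j <- enum 'I_m].
have [i iP] : exists i : 'I_m -> kmap U _, forall j, p \k i j = s j.
  apply: (@choose_fun _ _ (fun j b => p \k b = s j)) => j.
  have [|i hi] := pP j; first by rewrite size_map size_enum_ord.
  by exists i; rewrite hi (nth_map j) ?size_enum_ord // nth_ord_enum.
exists (size [seq s j | j <- enum 'I_m]), p => g; have [c ->] := sP g.
exists (\sum_j c j *: i j); rewrite kcomp_sumr; apply: eq_bigr => j _.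
by rewrite kcompZr iP.
Qed.

Definition kshift (P : lmodType Lam) (hP : fg_projective P) : ktwo Lam :=
  @KTwo Lam P (zmod0 Lam) \0 hP (fg_projective0 Lam).
Definition kto_shift U (P : lmodType Lam) (hP : fg_projective P) (f : {linear km1 U ->
  P}) : kmap U (kshift hP) :=
  @KMap Lam U (kshift hP) f \0 (fun=> erefl).

(** The universal extension: a power of U carries all classes in E(U, Z),
    hence kills them. *)
Lemma univ_ext U Z : Ev U U -> exists n Y, confl Z Y (kpow U n) /\ Ev U Y.
Proof.
move=> UU; have [n [p pP]] := univ_map U (kshift (k0P Z)).
pose e : {linear km1 (kpow U n) -> k0 Z} := m1 p.
exists n, (kext e); split; first exact: confl_ext.
move=> f.
have [h [h' hP]] := Ev_kaddr UU (kadd_self_pow U n) (snd \o f).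
have [i hi] := pP (kto_shift (k0P Z) ((fst \o f) \- (e \o h))).
have ie x : (f x).1 = e (h x) + e (m1 i x).
  by have /= := congr1 (fun g => m1 g x) hi => ->; rewrite addrC subrK.
exists (lpair \0 (h \+ m1 i)), (lpair \0 (h' \- m0 i)) => x.
rewrite [LHS]surjective_pairing; apply/pair_equal_spec; split=> /=.
  by rewrite linear0 add0r addr0 linearD ie.
by rewrite [LHS](hP x) linearD /= mC; abel.
Qed.

(** The cokernel N of the map induced on degree 0 cohomology by the universal
    map satisfies Hom(U, N) = 0, because a map from U to N lifts to B, as U
    has no extensions with the power of U, and then factors through the
    universal map, and E(U, N) = 0, because E(U, B) = 0. These conditions
    define a thick subcategory, so they hold for the regular module as well,
    and N = 0. Hence the universal map is a deflation; its cocone W has E(U,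
    W) = 0 because every map from U to B lifts. *)
Lemma approx_defl U B : Ev U U -> Ev U B -> (forall X, thick (kadd U) X) ->
  exists n W, confl W (kpow U n) B /\ Ev U W.
Proof.
move=> UU UB hth; have [n [p pP]] := univ_map U B; exists n.
have UUn : Ev U (kpow U n) := Ev_kaddr UU (kadd_self_pow U n).
pose q : {linear (k0 (kpow U n) * km1 B)%type -> k0 B} := pair_case (m0 p) (kd B).
pose S y := exists w, q w = y.
have HS : submodule S.
  split; first by exists 0; rewrite linear0.
  by move=> c _ _ [w <-] [w' <-]; exists (c *: w + w'); rewrite linearP.
pose N := quotm HS; pose pi : {linear k0 B -> N} := qpi HS.
have pq w : pi (q w) = 0 by apply/qpi_eq0; exists w.
have WU : Wc N U.
  split.
    move=> f fu.
    have [f' f'P] := proj_lift (k0P U).2 (fun y => @qpi_surj _ _ _ HS (f y)).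
    have [th thP] : exists th : {linear km1 U -> (k0 (kpow U n) * km1 B)%type}, forall x,
      q (th x) = (f' \o kd U) x.
      apply: proj_lift; [by case: (km1P U) | move=> x; apply/(qpi_eq0 HS)].
      by rewrite [LHS]f'P fu.
    have [h [h' hP]] := UUn (fst \o th).
    have gC x : (f' \- (m0 p \o h')) (kd U x) = kd B (((m1 p \o h) \+ (snd \o th)) x).
      have /= e := hP x; have /= := thP x; rewrite /q /= /pair_case /= e => <-.
      by rewrite !linearD /= mC; abel.
    have [i hi] := pP (KMap gC).
    move=> y; rewrite -f'P.
    have := congr1 (fun g => m0 g y) hi; rewrite /= => /esym/eqP; rewrite subr_eq => /eqP ->.
    rewrite -linearD; have -> (w : k0 (kpow U n)) : m0 p w = q (w, 0).
      by rewrite /q /= /pair_case /= linear0 addr0.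
    exact: pq.
  move=> g.
  have [g' g'P] := proj_lift (km1P U).2 (fun y => @qpi_surj _ _ _ HS (g y)).
  have [h [h' hP]] := UB g'.
  exists (pi \o h') => x; have e : pi (g' x) = g x := g'P x.
  have e2 : kd B (h x) = q (0, h x) by rewrite /q /= /pair_case /= linear0 add0r.
  have e3 : pi (kd B (h x) + h' (kd U x)) = pi (kd B (h x)) + pi (h' (kd U x)) := linearD _ _ _.
  by rewrite -e hP e3 e2 pq add0r.
have N0 (x : N) : x = 0.
  have [iN _] : Wc N (kreg Lam).
    apply: (hth (kreg Lam)); first exact: Wc_thick.
    by move=> V; apply: add_closed_kadd WU; case/is_thickE: (Wc_thick N).
  have := iN (regular_act x) _ (1 : Lam); rewrite /= /regular_act scale1r; apply.
  by move=> y; rewrite /= scale0r.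
have [W [e [phi [hphi ephi]]]] : exists W (e : {linear km1 B ->
  k0 W}) (phi : kmap (kpow U n) (kext e)),
    khiso phi /\ kext_p e \k phi = p.
  apply: kdefl => y; have /qpi_eq0 [[u b] <-] := N0 (pi y); by exists u, b.
exists W; split; first by exists e; apply/kisoE; exists phi.
have UE : Ev U (kext e).
  by apply: Ev_retr UUn; apply: kiso_ret; apply: kiso_sym; apply/kisoE; exists phi.
move=> f; have [h [h' hP]] := UE (@pair_inl _ _ _ \o f).
have gC x : (\- (snd \o h')) (kd U x) = kd B ((snd \o h) x).
  by have /(congr1 snd) /= /eqP := hP x; rewrite eq_sym addr_eq0 => /eqP ->.
have [i hi] := pP (KMap gC).
pose s := phi \k i.
have hs : kext_p e \k s = KMap gC by rewrite kcompA ephi.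
have s2 x : (m1 s x).2 = (h x).2 by exact: (congr1 (fun g => m1 g x) hs).
exists ((fst \o h) \- (fst \o m1 s)), ((fst \o h') \+ (fst \o m0 s)) => x.
have /= e1 := congr1 fst (hP x); have /= e2 := congr1 fst (mC s x).
change (f x = kd W ((h x).1 - (m1 s x).1) + ((h' (kd U x)).1 + (m0 s (kd U x)).1)).
rewrite linearB [LHS]e1 [(m0 s _).1]e2.
have -> : e (m1 s x).2 = e (h x).2 by congr (e _); exact: s2.
abel.
Qed.

(** Approximate B by a power of U, with cocone W, and W by another power of U.
    The second deflation and E(B, U) = 0 give E(B, W) = 0, so the first one
    splits. *)
Lemma silting_max U B : silting U -> Ev U B -> Ev B U -> kadd U B.
Proof.
move=> /siltingE [UU hth] UB BU.
have [n [W [hW UW]]] := approx_defl UU UB hth.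
have [m [W2 [hW2 _]]] := approx_defl UU UW hth.
have BW : Ev B W.
  by apply: confl_Eq hW2 _; apply: Ev_kaddr BU _; apply: kadd_self_pow.
have h := confl_split hW BW.
apply/kaddE; exists n; apply: kiso_retr h.
Qed.

Definition ev_perp (C : class (ktwo Lam)) : class (ktwo Lam) := fun Y => forall X, C X -> Ev X Y.
Definition ev_coperp (D : class (ktwo Lam)) : class (ktwo Lam) := fun X => forall Y, D Y -> Ev X Y.
Lemma cotorsion_perp p : cotorsion_pair p -> p.2 = ev_perp p.1 /\ p.1 = ev_coperp p.2.
Proof.
move=> [_ _ h2 h1]; split.
  rewrite h2; apply: class_ext => Y; split=> h X hX; move: (h X); rewrite EvE => hh; exact: hh.
rewrite h1; apply: class_ext => Y; split=> h X hX; move: (h X); rewrite EvE => hh; exact: hh.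
Qed.
Lemma ev_perp_closed (C : class (ktwo Lam)) : add_closed (ev_perp C).
Proof.
split; first by move=> X Y h hY Z hZ; apply: Ev_retr h _; apply: hY.
  by move=> Z _; apply: Ev_zeror.
by move=> X Y hX hY Z hZ; apply: Ev_sumr; [apply: hX | apply: hY].
Qed.
Lemma ev_coperp_closed (C : class (ktwo Lam)) : add_closed (ev_coperp C).
Proof.
split; first by move=> X Y h hY Z hZ; apply: Ev_retl h _; apply: hY.
  by move=> Z _; apply: Ev_zerol.
by move=> X Y hX hY Z hZ; apply: Ev_suml; [apply: hX | apply: hY].
Qed.
Lemma add_closed_additive (C : class (ktwo Lam)) : add_closed C ->
  additive_subcat (@kiso Lam) (kzero Lam) (@ksum Lam) C.
Proof. by move=> [h1 h2 h3]; split=> // X Y h; apply: h1; apply: kiso_retV. Qed.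

Definition silt_Y U : class (ktwo Lam) := fun Y => Ev U Y.
Definition silt_X U : class (ktwo Lam) := ev_coperp (silt_Y U).

(** One conflation is the universal extension of Z. For the other, Z is the
    cone of a map P -> Q of projectives in degree 0; the universal extension
    of P, pushed out along this map, is a conflation that ends in Z, and its
    middle term is an extension of a power of U by Q. *)
Lemma silt_complete U : Ev U U -> complete_cotorsion (silt_X U, silt_Y U).
Proof.
move=> UU; split; first split.
- by apply: add_closed_additive; apply: ev_coperp_closed.
- by apply: add_closed_additive; apply: Ev_closedr.
- apply: class_ext => Y; split=> /= h.
    by move=> X hX; apply/EvE; apply: hX.
  by apply/EvE; apply: h.
- apply: class_ext => X; split=> /= h Y hY; first by apply/EvE; apply: h.
  by apply/EvE; apply: h.
have Xpow n : silt_X U (kpow U n).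
  by move=> Y hY; apply: Ev_kaddl hY _; apply: kadd_self_pow.
move=> Z; split; last first.
  have [n [Y [h hY]]] := univ_ext Z UU.
  by exists Y, (kpow U n); split; [apply/conflE | exact: Xpow | exact: hY].
have [n [Y [h hY]]] := univ_ext (kstalk (km1P Z)) UU.
have [F hF1 hF2] := confl_pushout (confl_stalk Z) h.
exists Y, F; split; [by apply/conflE | | exact: hY].
by move=> Y' hY'; apply: confl_El hF1 _ _; [apply: Ev_stalk | apply: Xpow].
Qed.

Lemma silt_inter U : silting U -> inter (silt_X U) (silt_Y U) = kadd U.
Proof.
move=> hU; have [UU _] := (siltingE U).1 hU; apply: class_ext => V; split.
  by move=> [hX hY]; apply: silting_max => //; apply: hX.
move=> hV; split; last exact: Ev_kaddr hV.
by move=> Y hY; apply: Ev_kaddl hV.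
Qed.

Lemma complete_confl p : complete_cotorsion p -> forall Z, exists Y X, [/\ confl Z Y X,
  p.1 X & p.2 Y].
Proof. by move=> [_ h] Z; have [_ [Y [X [/conflE h1 h2 h3]]]] := h Z; exists Y, X. Qed.

(** U0 is in the first class, being an extension of U1 by the regular module,
    which has no extensions at all; U1 is in the second class because it
    inherits the vanishing of E(X, -) from U0. *)
Lemma cot_kreg p : complete_cotorsion p ->
  exists U0 U1, [/\ confl (kreg Lam) U0 U1, inter p.1 p.2 U0 & inter p.1 p.2 U1].
Proof.
move=> hp; have [e2 e1] := cotorsion_perp hp.1.
have [U0 [U1 [h h1 h0]]] := complete_confl hp (kreg Lam).
exists U0, U1; split=> //; split=> //.
  rewrite e1 => Y hY; apply: confl_El h _ _; first exact: Ev_kreg.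
  by move: h1; rewrite e1; apply.
rewrite e2 => X hX; apply: confl_Eq h _.
by move: h0; rewrite e2; apply.
Qed.

Lemma inter_closed p : cotorsion_pair p -> @add_closed Lam (inter p.1 p.2).
Proof.
move=> hp; have [e2 e1] := cotorsion_perp hp.
have [a1 a2 a3] : @add_closed Lam p.1 by rewrite e1; apply: ev_coperp_closed.
have [b1 b2 b3] : @add_closed Lam p.2 by rewrite e2; apply: ev_perp_closed.
split=> //; first by move=> X Y h [hX hY]; split; [apply: a1 h _ | apply: b1 h _].
by move=> X Y [? ?] [? ?]; split; [apply: a3 | apply: b3].
Qed.
Lemma inter_Ev p X Y : cotorsion_pair p -> inter p.1 p.2 X -> inter p.1 p.2 Y -> Ev X Y.
Proof. by move=> hp [hX _] [_ hY]; have [e2 e1] := cotorsion_perp hp; move: hY; rewrite e2;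
  apply. Qed.

Lemma cot_thick U0 U1 T : confl (kreg Lam) U0 U1 -> kadd T U0 -> kadd T U1 ->
  forall X, thick (kadd T) X.
Proof.
move=> h h0 h1; apply: (thick_kreg (thick_thick _)).
have [_ ht] := (is_thickE _).1 (thick_thick (kadd T)).
have [_ _ h3] := ht _ _ _ h; apply: h3; exact: thick_sub.
Qed.

Lemma cot_silting p U0 U1 : complete_cotorsion p -> confl (kreg Lam) U0 U1 ->
  inter p.1 p.2 U0 -> inter p.1 p.2 U1 ->
  silting (ksum U0 U1) /\ kadd (ksum U0 U1) = inter p.1 p.2.
Proof.
move=> hp h i0 i1; have cl := inter_closed hp.1.
have iT : inter p.1 p.2 (ksum U0 U1) by case: cl => _ _; apply.
have sT : silting (ksum U0 U1).
  apply/siltingE; split; first exact: inter_Ev hp.1 _ _.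
  apply: cot_thick h _ _.
    exact: kadd_suml.
  exact: kadd_sumr.
split=> //; apply: class_ext => V; split; first exact: add_closed_kadd.
by move=> iV; apply: silting_max => //; apply: inter_Ev hp.1 _ _.
Qed.

Lemma silting_add T U : kadd T = kadd U -> silting T -> silting U.
Proof.
move=> e /siltingE [TT hT]; apply/siltingE; rewrite -e; split=> //.
have h : kadd T U by rewrite e; apply: kadd_self.
exact: Ev_kaddl (Ev_kaddr TT h) h.
Qed.

Lemma cot_exists p : complete_cotorsion p -> exists U, Psi p U.
Proof.
move=> hp; have [U0 [U1 [h i0 i1]]] := cot_kreg hp.
have [sT eT] := cot_silting hp h i0 i1.
have [U [bU eU]] := kbasic_exists (ksum U0 U1).
by exists U; split=> //; [apply: silting_add sT | rewrite eU].
Qed.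

(** For X in the first class, embed X into an object U' of the second with
    cokernel in the first; then U' lies in the intersection, and vanishing on
    U' passes to X. *)
Lemma cot_Y p U : complete_cotorsion p -> kadd U = inter p.1 p.2 -> p.2 = silt_Y U.
Proof.
move=> hp eU; have [e2 e1] := cotorsion_perp hp.1.
have iU : inter p.1 p.2 U by rewrite -eU; apply: kadd_self.
apply: class_ext => Y; split; first by rewrite e2 => hY; apply: hY; case: iU.
move=> hY; rewrite e2 => X hX.
have [U' [X' [h hX' hU']]] := complete_confl hp X.
apply: (confl_Es h); apply: Ev_kaddl hY _; rewrite eU; split=> //.
by move: hX hX'; rewrite e1 => hX hX' Z hZ; apply: confl_El h _ _; [apply: hX | apply: hX'].
Qed.
Lemma cot_pair p U : complete_cotorsion p -> kadd U = inter p.1 p.2 -> p = (silt_X U, silt_Y U).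
Proof.
move=> hp eU; have e := cot_Y hp eU; have [e2 e1] := cotorsion_perp hp.1.
by case: p hp eU e e2 e1 => X Y /= _ _ -> _ ->.
Qed.

Lemma Psi_iso p U : complete_cotorsion p -> Psi p U -> Psi p = kiso U.
Proof.
move=> hp [bU sU aU]; apply: class_ext => V; split.
  by move=> [bV sV aV]; apply: kbasic_uniq => //; rewrite aU aV.
move=> h; split; first exact: kbasic_iso bU.
  by apply: silting_add sU; apply: kadd_isoE.
by rewrite -(kadd_isoE h).
Qed.

Lemma Psi_bij : bij_between (@complete_cotorsion Lam) (@basic_silting_classes Lam) (@Psi Lam).
Proof.
split.
- move=> p hp; have [U hU] := cot_exists hp; exists U; have [bU sU _] := hU; split=> //.
  exact: Psi_iso.
- move=> p q hp hq e; have [U hU] := cot_exists hp.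
  have hU' : Psi q U by rewrite -e.
  have [_ _ a] := hU; have [_ _ a'] := hU'.
  by rewrite (cot_pair hp a) (cot_pair hq a').
- move=> CC [U [bU sU ->]]; have [UU _] := (siltingE U).1 sU.
  exists (silt_X U, silt_Y U); first exact: silt_complete.
  apply: Psi_iso; first exact: silt_complete.
  by split=> //; rewrite /= silt_inter.
Qed.
End Silting.

Section ShiftMaps.
Variable R : nzRingType.
Implicit Types X Y Z U V W A B C : ktwo R.

(** Dual to the criterion for deflations: a complement of the image of the
    degree -1 term of B is projective, and is the degree -1 term of the cone.
    *)
Lemma kinfl B U (i : kmap B U) (r : {linear (k0 B * km1 U)%type -> km1 B}) :
  (forall x, r (kd B x, m1 i x) = x) -> exists C, confl B U C.
Proof.
move=> rP.
pose j : {linear km1 B -> (k0 B * km1 U)%type} := lpair (kd B) (m1 i).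
have [t tP] : exists t : {linear (k0 B * km1 U)%type -> kerm r}, forall w,
  kinj r (t w) = (idfun \- (j \o r)) w.
  by apply: ker_lift => w; rewrite linearB /= rP subrr.
have CP : fg_projective (kerm r).
  apply: (@fg_projective_ret _ _ _ (kinj r) t); last exact: fg_projective_sum (k0P B) (km1P U).
  by move=> x; apply: (@kinj_inj _ _ _ r); rewrite tP /= kinjK linear0 subr0.
pose cd0 : {linear (k0 B * km1 U)%type -> k0 U} := pair_case (\- m0 i) (kd U).
pose C := @KTwo R (kerm r) (k0 U) (cd0 \o kinj r) CP (k0P U).
pose e : {linear km1 C -> k0 B} := fst \o kinj r.
exists C; exists e; apply: kiso_sym; apply/kisoE.
pose f1 : {linear km1 (kext e) -> km1 U} := pair_case (m1 i) (snd \o kinj r).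
pose f0 : {linear k0 (kext e) -> k0 U} := pair_case (m0 i) idfun.
have fC x : f0 (kd (kext e) x) = kd U (f1 x).
  case: x => x z.
  change (m0 i (kd B x + (kinj r z).1) + (- m0 i (kinj r z).1 + kd U (kinj r z).2) =
    kd U (m1 i x + (kinj r z).2)).
  by rewrite !linearD mC; abel.
exists (KMap fC); apply: kqis_hiso; split.
- by move=> y; exists (0, y), 0; rewrite /= /pair_case /= !linear0 add0r addr0.
- move=> [b u] y /= e0; rewrite /pair_case /= in e0.
  pose x := r (b, y).
  have [z ez] : exists z, kinj r z = (b, y) - j x by apply: kinj_ex; rewrite linearB /= rP subrr.
  exists (x, z); last first.
    change (y = m1 i x + (kinj r z).2); rewrite ez /=; abel.
  apply/pair_equal_spec; split.
    change (b = kd B x + (kinj r z).1); rewrite ez /=; abel.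
  change (u = - m0 i (kinj r z).1 + kd U (kinj r z).2); rewrite ez /= !linearB /= mC -e0; abel.
- move=> [x z] /pair_equal_spec [e1 e2] e3.
  have {}e1 : kd B x + (kinj r z).1 = 0 := e1.
  have {}e3 : m1 i x + (kinj r z).2 = 0 := e3.
  have ez : kinj r z = - j x.
    rewrite [LHS]surjective_pairing; apply/pair_equal_spec; split; apply/eqP.
      by rewrite -addr_eq0 addrC; apply/eqP.
    by rewrite -addr_eq0 addrC; apply/eqP.
  have x0 : x = 0 by have := kinjK z; rewrite ez linearN /= rP => /eqP; rewrite oppr_eq0 => /eqP.
  rewrite x0; congr (_, _); apply: (@kinj_inj _ _ _ r); rewrite ez x0 !linear0 ?oppr0 //.
Qed.

Lemma confl_sum A B : confl A (ksum A B) B.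
Proof.
exists \0; apply: kiso_sym; apply: (@kext_split _ _ _ _ \0 \0) => z.
by rewrite /= linear0 addr0.
Qed.

(** Right minimality of the map from U1 to the shift of the regular module
    given by gam. *)
Definition rmin U1 (gam : {linear km1 U1 -> k0 (kreg R)}) := forall c : kmap U1 U1,
  (exists h : {linear k0 U1 -> k0 (kreg R)}, forall z, gam (m1 c z) = gam z + h (kd U1 z)) ->
    khiso c.

(** When E(X, U0) = 0 for the extension U0 of U1 by the regular module, gam is
    a right approximation for X: every extension of X by the regular module is
    pulled back along a map from X to U1. *)
Lemma gam_lift X U1 (gam : {linear km1 U1 -> k0 (kreg R)}) : Ev X (kext gam) ->
  forall a : {linear km1 X -> k0 (kreg R)}, exists (b : kmap X U1) (h : {linear k0 X ->
    k0 (kreg R)}),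
  forall x, a x = gam (m1 b x) + h (kd X x).
Proof.
move=> E a; have [h [h' hP]] := E (@pair_inl _ _ _ \o a).
have gC x : (\- (snd \o h')) (kd X x) = kd U1 ((snd \o h) x).
  by have /(congr1 snd) /= /eqP := hP x; rewrite eq_sym addr_eq0 => /eqP ->.
exists (KMap gC), (fst \o h') => x.
by have /(congr1 fst) /= -> := hP x; rewrite add0r.
Qed.
End ShiftMaps.

Section Beta.
Variables (k : fieldType) (Lam : falgType k).
Implicit Types X Y Z U V W A B C T : ktwo Lam.
Implicit Types p : (class (ktwo Lam) * class (ktwo Lam))%type.

Lemma betaE (C : class (ktwo Lam)) X : beta C X <-> C X /\ forall X' X'', confl X X' X'' ->
  C X' -> C X''.
Proof. by split=> -[h1 h2]; split=> // X' X'' h; apply: h2; apply/conflE. Qed.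

Lemma cot_Xclosed p : cotorsion_pair p -> @add_closed Lam p.1.
Proof. by move=> hp; have [_ ->] := cotorsion_perp hp; apply: ev_coperp_closed. Qed.
Lemma cot_Yclosed p : cotorsion_pair p -> @add_closed Lam p.2.
Proof. by move=> hp; have [-> _] := cotorsion_perp hp; apply: ev_perp_closed. Qed.
Lemma cot_Xext p A B C : cotorsion_pair p -> confl A B C -> p.1 A -> p.1 C -> p.1 B.
Proof.
move=> hp h; have [_ ->] := cotorsion_perp hp => hA hC Y hY.
by apply: (confl_El h); [apply: hA | apply: hC].
Qed.
Lemma cot_Xcocone p A B C : cotorsion_pair p -> confl A B C -> p.1 B -> p.1 A.
Proof.
move=> hp h; have [_ ->] := cotorsion_perp hp => hB Y hY.
by apply: (confl_Es h); apply: hB.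
Qed.
Lemma cot_Ycone p A B C : cotorsion_pair p -> confl A B C -> p.2 B -> p.2 C.
Proof.
move=> hp h; have [-> _] := cotorsion_perp hp => hB Y hY.
by apply: (confl_Eq h); apply: hB.
Qed.

(** The three octahedra reduce each closure property of beta to those of the
    first class, which is closed under extensions, cocones and summands. *)
Lemma beta_thick p : cotorsion_pair p -> is_thick (beta p.1).
Proof.
move=> hp; have [cr c0 cs] := cot_Xclosed hp.
have ext A B C : confl A B C -> beta p.1 A -> beta p.1 C -> beta p.1 B.
  move=> h /betaE [hA bA] /betaE [hC bC]; apply/betaE; split; first exact: cot_Xext hp h _ _.
  move=> X' X'' h' hX'; have [D h1 h2] := confl_oct h h'.
  by apply: (bC _ _ h2); apply: (bA _ _ h1).
apply/is_thickE; split; first split.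
- move=> X Y hr /betaE [hY bY]; apply/betaE; split; first exact: cr hr hY.
  have /kret_summand [A hA] := hr => X' X'' h hX'.
  have [F h1 h2] := confl_pushout h (confl_sum X A).
  apply: (bY F X''); first exact: confl_isoA (kiso_sym hA) h2.
  apply: (cot_Xext hp h1) => //; apply: cr hY.
  exact: kiso_retr hA.
- apply/betaE; split=> // X' X'' h hX'; apply: cr hX'.
  exact: kiso_retr (confl_split h (@Ev_zeror _ _)).
- by move=> X Y hX hY; apply: ext (confl_sum X Y) hX hY.
- move=> A B C h; split; last 1 first.
  + move=> /betaE [hB bB] /betaE [hC bC]; apply/betaE; split; first exact: cot_Xcocone hp h hB.
    move=> X' X'' h' hX'; have [F h1 h2] := confl_pushout h h'.
    by apply: (bB _ _ h1); apply: (cot_Xext hp h2).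
  + move=> /betaE [hA bA] /betaE [hB bB]; apply/betaE; split; first exact: bA h hB.
    move=> X' X'' h' hX'; have [F h1 h2] := confl_comp h h'.
    by apply: (bB _ _ h2); apply: (cot_Xext hp h1).
  + exact: ext.
Qed.

(** * The coresolution of the regular module and the thick subcategory beta *)

Section Rho.
Variables (p : (class (ktwo Lam) * class (ktwo Lam))%type) (U1 : ktwo Lam) (gam :
  {linear km1 U1 -> k0 (kreg Lam)}).
Hypotheses (hp : complete_cotorsion p) (i1 : inter p.1 p.2 U1) (i0 :
  inter p.1 p.2 (kext gam)) (gm : rmin gam).

Let XU0 X : p.1 X -> Ev X (kext gam).
Proof. by have [e2 _] := cotorsion_perp hp.1; move=> hX; have [_] := i0; rewrite e2; apply. Qed.

(** For a conflation U1 -> X' -> X'' with X' in the first class, gam extends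
    to a class on X' because E(-, A) is right exact, and the extended class
    lifts along gam to c : X' -> U1. The restriction of c to U1 commutes with
    gam, so it is invertible by minimality; the conflation splits and X'' is a
    summand of X'. *)
Lemma rho_beta : beta p.1 U1.
Proof.
apply/betaE; split; first by case: i1.
move=> X' X'' [e h] hX'.
have hE : p.1 (kext e) by have [cr _ _] := cot_Xclosed hp.1; apply: cr hX'; exact: kiso_retV.
have [c [l cl]] := gam_lift (XU0 hE) (gam \o (lfst (km1 U1) (km1 X''))).
pose c' := c \k kext_i e.
have [d [hd1 hd2]] : khiso c'.
  apply: gm; exists (\- (l \o @pair_inl _ _ _)) => z /=.
  have hc : gam z = gam (m1 c (pair_inl _ z)) + l (kd (kext e) (pair_inl _ z)) := cl (pair_inl _ z).
  have hk : kd (kext e) (pair_inl _ z) = pair_inl _ (kd U1 z).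
    by apply/pair_equal_spec; rewrite /= !linear0 addr0.
  by rewrite hc hk; abel.
(* The composite d c retracts the inclusion of U1 up to homotopy. *)
have [a [a1 a0]] := hd1.
pose r := d \k c.
have r1 x z : m1 r (x, z) = x + a (kd U1 x) + m1 r (0, z).
  have -> : m1 r (x, z) = m1 r (pair_inl _ x) + m1 r (pair_inr _ z) by rewrite -lin_pair.
  by congr (_ + _); rewrite -a1 mE /=; abel.
have r0 x z : m0 r (x, z) = x + kd U1 (a x) + m0 r (0, z).
  have -> : m0 r (x, z) = m0 r (pair_inl _ x) + m0 r (pair_inr _ z) by rewrite -lin_pair.
  by congr (_ + _); rewrite -a0 mE /=; abel.
have hs : kiso (kext e) (ksum U1 X'').
  apply: (@kext_split _ _ _ e ((m1 r \o @pair_inr _ _ _) \- (a \o e)) (\- (m0 r \o @pair_inr _ _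
    _))) => z /=.
  have := mC r (0, z); rewrite /= /kext_d /= linear0 add0r.
  have -> : m0 d (m0 c (e z, kd X'' z)) = m0 r (e z, kd X'' z) by [].
  rewrite r0 => e3.
  have -> : kd U1 (m1 d (m1 c (pair_inr (km1 U1) z)) - a (e z)) = kd U1 (m1 d (m1 c (0,
    z))) - kd U1 (a (e z)).
    exact: linearB.
  rewrite -e3 /=; abel.
have [cr _ _] := cot_Xclosed hp.1; apply: cr hE.
exact: kiso_retr hs.
Qed.

(** The canonical map from X to the shift of its degree -1 term is a split
    monomorphism in degree -1, and that term is a summand of a free module.
    The coordinates of this map are classes with values in the regular module,
    and they lift along gam to a map from X to a power of U1. *)
Lemma rho_infl X : p.1 X -> exists n C, confl X (kpow U1 n) C.
Proof.
move=> hX.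
pose F n := k0 (kpow (kreg Lam) n).
have main n (t : {linear km1 X -> F n}) (r : {linear F n -> km1 X}) :
    exists (i : kmap X (kpow U1 n)) (rho : {linear (k0 X * km1 (kpow U1 n))%type -> km1 X}),
    forall x, rho (kd X x, m1 i x) = r (t x).
  elim: n t r => [|n IH] t r.
    by exists 0, \0 => x; rewrite (_ : t x = 0) ?linear0 //; apply/rowP => -[].
  have [b [h bh]] := gam_lift (XU0 hX) (fst \o t).
  have [i [rho hrho]] := IH (snd \o t) (r \o @pair_inr _ _ _).
  pose r1 : {linear k0 (kreg Lam) -> km1 X} := r \o @pair_inl _ _ _.
  pose s : {linear (k0 X * km1 (kpow U1 n.+1))%type -> k0 (kreg Lam)} :=
    pair_case h (gam \o (lfst (km1 U1) (km1 (kpow U1 n)))).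
  pose u : {linear (k0 X * km1 (kpow U1 n.+1))%type -> (k0 X * km1 (kpow U1 n))%type} :=
    lpair (@fst _ _) ((lsnd (km1 U1) (km1 (kpow U1 n))) \o (lsnd (k0 X) (km1 (kpow U1 n.+1)))).
  exists (kinl _ _ \k b + kinr _ _ \k i), ((r1 \o s) \+ (rho \o u)) => x.
  have -> : m1 (kinl U1 (kpow U1 n) \k b + kinr U1 (kpow U1 n) \k i) x = (m1 b x, m1 i x).
    by rewrite mE; apply/pair_equal_spec; rewrite /= addr0 add0r.
  change (r1 (h (kd X x) + gam (m1 b x)) + rho (kd X x, m1 i x) = r (t x)).
  rewrite hrho [h _ + _]addrC -bh; apply: esym.
  by rewrite [t x in LHS]surjective_pairing; apply: lin_pair.
have /kaddE [n [a [c [h [_ h0]]]]] := kstalk_add (km1P X).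
have [i [rho hr]] := main n (m0 a) (m0 c).
have rP x : rho (kd X x, m1 i x) = x.
  rewrite hr; have := h0 x; rewrite mE /= => /eqP; rewrite subr_eq0 => /eqP //.
by have [C hC] := kinfl rP; exists n, C.
Qed.

(** Embed X into a power of U1, with cokernel in beta. As a quotient of a
    power of U1, the cokernel is also in the second class, and so its own
    embedding into a power of U1 splits. *)
Lemma beta_cores X : beta p.1 X ->
  exists U' U'', [/\ confl X U' U'', kadd U1 U', kadd U1 U'' & beta p.1 U''].
Proof.
have hth := beta_thick hp.1.
have bU V : kadd U1 V -> beta p.1 V by apply: (thick_kadd hth rho_beta).
have key Z : beta p.1 Z -> exists U' U'', [/\ confl Z U' U'', kadd U1 U' & beta p.1 U''].
  move=> hZ; have /betaE [hZ1 hZ2] := hZ.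
  have [n [C hC]] := rho_infl hZ1.
  have aU : kadd U1 (kpow U1 n) by apply: kadd_self_pow.
  exists (kpow U1 n), C; split=> //.
  have [_ ht] := (is_thickE _).1 hth; have [h1 _ _] := ht _ _ _ hC.
  by apply: h1 => //; apply: bU.
move=> hX; have [U' [U'' [h a b]]] := key _ hX; exists U', U''; split=> //.
have [V' [V'' [h' a' b']]] := key _ b.
have cl := cot_Yclosed hp.1.
have Y1 V : kadd U1 V -> p.2 V by apply: (add_closed_kadd cl); case: i1.
have Y2 : p.2 U'' by apply: (cot_Ycone hp.1 h); apply: Y1.
have E : Ev V'' U''.
  have [e2 _] := cotorsion_perp hp.1; move: Y2; rewrite e2; apply.
  by have /betaE [] := b'.
apply: kadd_ret a'; apply: kiso_retl (confl_split h' E).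
Qed.

Lemma beta_enough : enough_injectives (beta p.1).
Proof.
have hth := beta_thick hp.1.
move=> X hX; have [U' [U'' [h a b b']]] := beta_cores hX; exists U', U''; split=> //;
  first exact/conflE.
have bU' : beta p.1 U' by apply: (thick_kadd hth rho_beta).
split=> // Z /betaE [hZ _]; apply/EvE.
have [e2 _] := cotorsion_perp hp.1; have [_] := i1; rewrite e2 => h1.
by apply: Ev_kaddr a; apply: h1.
Qed.

Lemma beta_thick_rho V : kadd V = kadd U1 -> beta p.1 = thick (single V).
Proof.
move=> eV; have hth := beta_thick hp.1.
have bV : beta p.1 V by apply: (thick_kadd hth rho_beta); rewrite -eV; apply: kadd_self.
apply: class_ext => X; split; last first.
  by move=> hX; apply: hX => // _ ->.
move=> hX; have [U' [U'' [h a b _]]] := beta_cores hX.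
have tV W : kadd U1 W -> thick (single V) W.
  by rewrite -eV; apply: (thick_kadd (thick_thick _)); apply: thick_sub.
have [_ ht] := (is_thickE _).1 (thick_thick (single V)); have [_ _ h3] := ht _ _ _ h.
by apply: h3; apply: tV.
Qed.

Lemma beta_inj V : beta p.1 V -> (forall X, beta p.1 X -> Ev X V) -> kadd U1 V.
Proof.
move=> bV h; have [U' [U'' [hc a _ b]]] := beta_cores bV.
apply: kadd_ret a; exact: kiso_retl (confl_split hc (h _ b)).
Qed.
Lemma beta_inj_rev V X : kadd U1 V -> beta p.1 X -> Ev X V.
Proof.
move=> a /betaE [hX _]; have [e2 _] := cotorsion_perp hp.1; have [_] := i1; rewrite e2 => h1.
by apply: Ev_kaddr a; apply: h1.
Qed.
End Rho.
End Beta.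

(** * Existence of U_rho, and beta on complete cotorsion pairs *)

Section RhoExists.
Variables (k : fieldType) (Lam : falgType k).
Implicit Types X Y Z U V W A B C T : ktwo Lam.
Implicit Types p : (class (ktwo Lam) * class (ktwo Lam))%type.

Definition rho_datum U U1 (gam : {linear km1 U1 -> k0 (kreg Lam)}) :=
  [/\ kadd U U1, kadd U (kext gam) & rmin gam].

(** The triangle that defines U_rho, in coordinates: its middle term is the
    extension with class minus the connecting map, and right minimality of the
    connecting map becomes rmin. *)
Lemma rho_of U V : is_U_rho U V -> exists U0 U1 (f : kmap (kreg Lam) U0) (gam : {linear km1 U1 ->
  k0 (kreg Lam)}) (phi : kmap (kext gam) U0),
  [/\ rho_datum U gam, kadd V = kadd U1, khiso phi & phi \k kext_i gam ~~ f] /\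
  [/\ kadd U U0, forall e : kmap U0 U0, e \k f ~~ f -> khiso e
    & forall B (a : kmap (kreg Lam) B), kadd U B -> exists b : kmap U0 B, b \k f ~~ a].
Proof.
move=> [_ _ [U0 [U1 [f [pr [g [hd [[hU0 hf] mf] [[hU1 hg] mg] hV]]]]]]].
have [phi hphi ef] := distinguished_kext hd.
set gam := (\- cm g (Negz 0) : {linear km1 U1 -> k0 (kreg Lam)}) in phi hphi ef.
exists U0, U1, (of_c f), gam, phi; split; last first.
  split=> // [e he|B a hB].
    have := mf (to_c e); rewrite -of_hE of_comp of_cK => /(_ he) /is_hisoE.
    by rewrite of_cK.
  have [b] := hf B (to_c a) hB; rewrite -of_hE of_comp of_cK => hb.
  by exists (of_c b).
split=> //; split=> //.
  by apply: kadd_iso hU0; apply: kiso_sym; apply/kisoE; exists phi.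
move=> c [h hc].
have : is_hiso (to_c c).
  apply: mg; apply/hom_shiftE; exists \0, (\- h) => x.
  have e1 : cm g (Negz 0) (m1 c x) = - gam (m1 c x) by rewrite /gam /= opprK.
  have e2 : cm g (Negz 0) x = - gam x by rewrite /gam /= opprK.
  change (cm g (Negz 0) (m1 c x) - cm g (Negz 0) x = 0 + - h (kd U1 x)).
  rewrite e1 e2 hc; abel.
by move/khisoE.
Qed.

(** Take U1 of least size. If c commutes with gam up to homotopy, so do its
    powers, and by Fitting's lemma gam vanishes, up to homotopy, on the part K
    of U1 on which c is nilpotent. The complement I of K then does the job
    too, the extension by it being a retract of the extension by U1; by
    minimality of size K = 0, and c is invertible. *)
Lemma rho_min_exists (C D : class (ktwo Lam)) :
  (forall X Y, kret X Y -> C Y -> C X) -> (forall X Y, kret X Y -> D Y -> D X) ->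
  (exists U1 (gam : {linear km1 U1 -> k0 (kreg Lam)}), C U1 /\ D (kext gam)) ->
  exists U1 (gam : {linear km1 U1 -> k0 (kreg Lam)}), [/\ C U1, D (kext gam) & rmin gam].
Proof.
move=> hC hD [U0 [gam0 [b1 b0]]].
pose good U1 := exists gam : {linear km1 U1 -> k0 (kreg Lam)}, C U1 /\ D (kext gam).
pose P n := decide (exists U1, good U1 /\ mu U1 = n).
have ex : exists n, P n.
  by exists (mu U0); apply/decideP; exists U0; split=> //; exists gam0.
case: (ex_minnP ex) => n /decideP [U1 [[gam [a1 a0]] mU]] mn.
exists U1, gam; split=> // c [h hc].
have [m [I [K [i [q [i' [q' [[h1 h2 h3 h4] [hV hK]]]]]]]]] := fitting c.
apply: hK; apply/mu0/eqP; rewrite -leqn0 -(leq_add2l (mu I)) addn0.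
apply: leq_trans (mu_sum I K) _; rewrite -(mu_iso hV) mU; apply: mn; apply/decideP.
exists I; split=> //.
have retI : kret I U1 by exists i, q; rewrite h1.
exists (gam \o m1 i); split; first exact: hC retI a1.
apply: hD a0.
have [hn hnP] : exists hn : {linear k0 U1 -> k0 (kreg Lam)}, forall z,
  gam (m1 (kexp c m) z) = gam z + hn (kd U1 z).
  elim: (m) => [|j [hj hjP]]; first by exists \0 => z; rewrite /= addr0.
  exists (hj \+ (h \o m0 (kexp c j))) => z.
  change (gam (m1 c (m1 (kexp c j) z)) = gam z + (hj (kd U1 z) + h (m0 (kexp c j) (kd U1 z)))).
  by rewrite hc hjP mC addrA.
pose s : {linear k0 U1 -> k0 (kreg Lam)} := hn \o m0 i' \o m0 q'.
have dec z : gam z = gam (m1 i (m1 q z)) - s (kd U1 z).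
  have {1}-> : z = m1 i (m1 q z) + m1 i' (m1 q' z).
    by rewrite -[LHS]/(m1 (kid U1) z) -h3.
  rewrite linearD; congr (_ + _).
  have e4 : m1 (kexp c m) (m1 i' (m1 q' z)) = 0.
    by have := congr1 (fun g => m1 g (m1 q' z)) h4.
  have := hnP (m1 i' (m1 q' z)); rewrite e4 linear0 => /esym/eqP; rewrite addr_eq0 => /eqP ->.
  by rewrite /s /= !mC.
have aC x : (lpair (lfst (k0 (kreg Lam)) (k0 I)) (m0 i \o snd)) (kd (kext (gam \o m1 i)) x) =
    kd (kext gam) ((lpair (lfst (km1 (kreg Lam)) (km1 I)) (m1 i \o snd)) x).
  by case: x => x z; apply/pair_equal_spec; split=> //=; rewrite mC.
have bC x : (lpair (pair_case idfun s) (m0 q \o (lsnd (k0 (kreg Lam)) (k0 U1)))) (kd (kext gam) x) =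
    kd (kext (gam \o m1 i)) ((lpair (lfst (km1 (kreg Lam)) (km1 U1)) (m1 q \o snd)) x).
  case: x => x z; apply/pair_equal_spec; split; last by rewrite /= mC.
  by rewrite /= /pair_case /= [in LHS]dec !add0r subrK.
exists (@KMap _ (kext (gam \o m1 i)) (kext gam) _ _ aC), (@KMap _ (kext gam) (kext (gam \o m1 i))
  _ _ bC).
rewrite (_ : _ \k _ = kid _) //; apply: kmap_ext => -[x z]; apply/pair_equal_spec; split=> //.
- by have := congr1 (fun g => m1 g z) h1.
- have s0 : s (m0 i z) = 0.
    have e5 : m0 q' (m0 i z) = 0 := congr1 (fun g => m0 g z) h2.
    by rewrite /s /= e5 !linear0.
  by change (x + s (m0 i z) = x); rewrite s0 addr0.
- by have := congr1 (fun g => m0 g z) h1.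
Qed.

Lemma rho_datum_exists U : silting U -> exists U1 (gam : {linear km1 U1 ->
  k0 (kreg Lam)}), rho_datum U gam.
Proof.
move=> sU; have [UU _] := (siltingE U).1 sU.
apply: rho_min_exists; [exact: kadd_ret | exact: kadd_ret |].
have [U0 [U1 [[gam h] a0 a1]]] := cot_kreg (silt_complete UU).
have eI := silt_inter sU; rewrite /= eI in a0 a1.
exists U1, gam; split=> //; exact: kadd_iso h a0.
Qed.

(** An endomorphism e of the extension U0 that is the identity on the regular
    module induces c on the quotient U1 with gam c = gam, so c is invertible,
    and then so is e by the five lemma. *)
Lemma rho_left_min U1 (gam : {linear km1 U1 -> k0 (kreg Lam)}) : rmin gam ->
  forall e : kmap (kext gam) (kext gam), e \k kext_i gam ~~ kext_i gam -> khiso e.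
Proof.
move=> gm e [h [_ h0]].
have h0' (l : k0 (kreg Lam)) : m0 e (pair_inl _ l) = pair_inl _ l + kd (kext gam) (h l).
  by rewrite -h0 mE /=; abel.
(* Up to homotopy e may be assumed to fix the regular module strictly. *)
have [e' ee e0] : exists2 e' : kmap (kext gam) (kext gam), e' ~~ e & forall l,
  m0 e' (pair_inl _ l) = pair_inl _ l.
  pose H : {linear k0 (kext gam) -> km1 (kext gam)} := h \o (lfst (k0 (kreg Lam)) (k0 U1)).
  have eC x : (m0 e \- (kd (kext gam) \o H)) (kd (kext gam) x) =
    kd (kext gam) ((m1 e \- (H \o kd (kext gam))) x).
    by rewrite linearB /= mC.
  exists (KMap eC); first by symmetry; exists H; split=> x; rewrite mE /=; abel.
  move=> l; have -> : m0 (KMap eC) (pair_inl _ l) = m0 e (pair_inl _ l) - kd (kext gam) (h l) by [].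
  by rewrite h0' addrK.
apply: khiso_eq ee _.
have e1 (x : km1 (kreg Lam)) z : m1 e' (x, z) = m1 e' (0, z).
  by congr (m1 e' (_, z)); apply/rowP => -[].
have hkd z : m0 e' (kd (kext gam) (0, z)) = pair_inl _ (gam z) + m0 e' (pair_inr _ (kd U1 z)).
  have -> : kd (kext gam) (0, z) = (gam z, kd U1 z) by apply/pair_equal_spec; rewrite /= add0r.
  by rewrite lin_pair e0.
have cC z : (snd \o m0 e' \o @pair_inr _ _ _) (kd U1 z) = kd U1 ((snd \o m1 e' \o @pair_inr _ _
  _) z).
  by have := congr1 snd (mC e' (0, z)); rewrite hkd /= add0r.
pose c : kmap U1 U1 := KMap cC.
have hg z : gam (m1 c z) = gam z + (m0 e' (pair_inr _ (kd U1 z))).1.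
  have := congr1 fst (mC e' (0, z)); rewrite hkd => e3.
  have -> : gam (m1 c z) = (kd (kext gam) (m1 e' (0, z))).1.
    by rewrite /= /kext_d /= add0r.
  by rewrite -e3.
have hc : khiso c by apply: gm; exists (fst \o m0 e' \o @pair_inr _ _ _) => z; apply: hg.
have [s0 mid inj] := khiso_qis hc.
have triv (x y : km1 (kreg Lam)) : x = y by apply/rowP => -[].
apply: kqis_hiso; split.
- move=> [l y]; have [u [z ez]] := s0 y.
  pose w := m0 e' (pair_inr _ u).
  exists (l - w.1 - gam z, u), (0, z).
  have -> : m0 e' (l - w.1 - gam z, u) = pair_inl _ (l - w.1 - gam z) + w by rewrite lin_pair e0.
  apply/pair_equal_spec; split; rewrite /= ?add0r; last exact: ez.
  by abel.
- move=> [l u] [x z] e3.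
  have {}e3 : m0 e' (pair_inl _ l) + m0 e' (pair_inr _ u) = kd (kext gam) (x,
    z) by rewrite -lin_pair.
  rewrite e0 in e3.
  have e4 : l + (m0 e' (pair_inr _ u)).1 = gam z.
    by have /= := congr1 fst e3; rewrite add0r.
  have e5 : m0 c u = kd U1 z by have /= := congr1 snd e3; rewrite add0r.
  have [z1 ez1 ez2] := mid u z e5.
  exists (0, z1).
    apply/pair_equal_spec; split => //=; rewrite add0r.
    by apply: (addIr (m0 e' (pair_inr _ u)).1); rewrite e4 ez1 -hg ez2.
  by rewrite [RHS]surjective_pairing; apply/pair_equal_spec; split.
- move=> [x z] /pair_equal_spec [_ /= e2] e3.
  have -> : x = 0 by apply: triv.
  have -> : z = 0 by apply: inj => //; rewrite -[RHS](congr1 snd e3) e1.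
  by [].
Qed.

(** The conflation of a minimal datum is the required one. Since E(U1, B') = 0
    for B' in add U, maps from the regular module to B' extend to U0; since
    E(B', U0) = 0, maps from B' to its shift lift to U1. *)
Lemma rho_exists U : kbasic U -> silting U -> exists V, is_U_rho U V.
Proof.
move=> bU sU; have [UU _] := (siltingE U).1 sU.
have [U1 [gam [a1 a0 gm]]] := rho_datum_exists sU.
have [V [bV eV]] := kbasic_exists U1.
exists V; split=> //.
  apply/kret_summand; apply: kbasic_add => //; apply: kadd_trans a1 _; rewrite -eV;
    exact: kadd_self.
exists (kext gam), U1, (to_c (kext_i gam)), (to_c (kext_p gam)), (ev_c (\- gam)); split=> //.
- exact: kext_distinguished.
- split; last first.
    move=> e; rewrite -of_hE of_comp of_cK => /(rho_left_min gm) h.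
    exact/is_hisoE.
  split=> // B' a hB'.
  have E : Ev U1 B' := Ev_kaddl (Ev_kaddr UU hB') a1.
  have [h [h' hP]] := E (cm a (Posz 0) \o gam).
  pose b0 : {linear k0 (kext gam) -> k0 B'} := pair_case (cm a (Posz 0)) (\- h').
  pose b1 : {linear km1 (kext gam) -> km1 B'} := pair_case (cm a (Negz 0)) h.
  have bC x : b0 (kd (kext gam) x) = kd B' (b1 x).
    case: x => x z; have -> : x = 0 by apply/rowP => -[].
    change (cm a (Posz 0) (0 + gam z) + - h' (kd U1 z) = kd B' (cm a (Negz 0) (0 :
      zmod0 Lam) + h z)).
    rewrite !add0r linear0 add0r; have /= -> := hP z; by rewrite addrK.
  exists (to_c (KMap bC)); apply/of_hE; rewrite of_comp !of_cK.
  rewrite (_ : _ \k _ = of_c a) //; apply: kmap_ext => x; first by apply: pair_caseL.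
  exact: pair_caseL.
- split; first split=> //.
    move=> B' a hB'.
    have E : Ev B' (kext gam) := Ev_kaddr (Ev_kaddl UU hB') a0.
    have [b [h hb]] := gam_lift E (cm a (Negz 0)).
    exists (to_c (- b)); apply/hom_shiftE; exists \0, (\- h) => x.
    change (- gam (- m1 b x) - cm a (Negz 0) x = 0 + - h (kd B' x)).
    rewrite hb linearN opprK; abel.
  move=> e /hom_shiftE [h [h' hP]]; apply/is_hisoE; apply: gm; exists (\- h') => z.
  have e1 : - gam (cm e (Negz 0) z) - - gam z = 0 + h' (kd U1 z) := hP z.
  change (gam (cm e (Negz 0) z) = gam z + - h' (kd U1 z)).
  have -> : h' (kd U1 z) = - gam (cm e (Negz 0) z) - - gam z by rewrite e1 add0r.
  abel.
Qed.

Lemma rho_inter p U U1 (gam : {linear km1 U1 -> k0 (kreg Lam)}) : complete_cotorsion p ->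
  Psi p U -> rho_datum U gam ->
  inter p.1 p.2 U1 /\ inter p.1 p.2 (kext gam).
Proof. by move=> hp [_ _ <-] [a1 a0 _]. Qed.

Lemma beta_rho p U V : complete_cotorsion p -> Psi p U -> is_U_rho U V ->
  beta p.1 = thick (single V).
Proof.
move=> hp hU /rho_of [U0 [U1 [f [gam [phi [[hd eV _ _] _]]]]]].
have [i1 i0] := rho_inter hp hU hd; have [_ _ gm] := hd.
exact: (beta_thick_rho hp i1 i0 gm eV).
Qed.

Lemma thick_rho_beta p : complete_cotorsion p -> thick_rho (Psi p) = beta p.1.
Proof.
move=> hp; apply: class_ext => X; split.
  by move=> [U [V [hU hV h]]]; rewrite (beta_rho hp hU hV).
have [U hU] := cot_exists hp; have [bU sU _] := hU.
have [V hV] := rho_exists bU sU.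
by rewrite (beta_rho hp hU hV) => h; exists U, V.
Qed.

Lemma cot_rho p : complete_cotorsion p -> exists U1 (gam : {linear km1 U1 -> k0 (kreg Lam)}),
  [/\ inter p.1 p.2 U1, inter p.1 p.2 (kext gam) & rmin gam].
Proof.
move=> hp; have [U hU] := cot_exists hp; have [bU sU _] := hU.
have [U1 [gam hd]] := rho_datum_exists sU; have [i1 i0] := rho_inter hp hU hd.
by exists U1, gam; split=> //; case: hd.
Qed.

Lemma beta_in p : complete_cotorsion p -> thick_enough_inj (beta p.1).
Proof.
move=> hp; have [U1 [gam [i1 i0 gm]]] := cot_rho hp; split; first exact: (beta_thick hp.1).
exact: (beta_enough hp i1 i0 gm).
Qed.

(** E(U1, Y) = 0 forces E(U0, Y) = 0, since U0 is an extension of U1 by the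
    regular module. *)
Lemma cot_Y_rho p U1 (gam : {linear km1 U1 -> k0 (kreg Lam)}) : complete_cotorsion p ->
  inter p.1 p.2 U1 -> inter p.1 p.2 (kext gam) -> p.2 = silt_Y U1.
Proof.
move=> hp i1 i0; have h := confl_ext gam.
have [_ e] := cot_silting hp h i0 i1.
rewrite (cot_Y hp e); apply: class_ext => Y; split=> hY.
  by apply: Ev_retl hY; apply: kret_sumr.
apply: Ev_suml => //; apply: confl_El h _ hY; exact: Ev_kreg.
Qed.
(** The category beta determines its injectives add U1, hence the second
    class. *)
Lemma beta_injective p p' : complete_cotorsion p -> complete_cotorsion p' ->
  beta p.1 = beta p'.1 -> p = p'.
Proof.
move=> hp hp' eb.
have [U1 [gam [i1 i0 gm]]] := cot_rho hp; have [U1' [gam' [i1' i0' gm']]] := cot_rho hp'.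
have a : kadd U1 U1'.
  apply: (beta_inj hp i1 i0 gm); first by rewrite eb; apply: (rho_beta hp' i1' i0').
  by move=> X; rewrite eb => hX; apply: (beta_inj_rev hp' i1' _ hX); apply: kadd_self.
have a' : kadd U1' U1.
  apply: (beta_inj hp' i1' i0' gm'); first by rewrite -eb; apply: (rho_beta hp i1 i0).
  by move=> X; rewrite -eb => hX; apply: (beta_inj_rev hp i1 _ hX); apply: kadd_self.
have e2 : p.2 = p'.2.
  rewrite (cot_Y_rho hp i1 i0) (cot_Y_rho hp' i1' i0'); apply: class_ext => Y.
  by split=> hY; apply: Ev_kaddl hY _.
have [_ e1] := cotorsion_perp hp.1; have [_ e1'] := cotorsion_perp hp'.1.
have e3 : p.1 = p'.1 by rewrite e1 e1' e2.
by rewrite [p]surjective_pairing e3 e2 -surjective_pairing.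
Qed.
End RhoExists.

(** * Presilting families are bounded; surjectivity of beta *)

Section Sums.
Variable R : nzRingType.
Implicit Types X Y Z W A B C U V T : ktwo R.
Lemma confl_sums A B C A' B' C' : confl A B C -> confl A' B' C' ->
  confl (ksum A A') (ksum B B') (ksum C C').
Proof.
move=> [e h] [e' h']; exists (pair_map e e'); apply: kiso_trans (ksum_iso h h') _.
pose f1 : {linear km1 (ksum (kext e) (kext e')) -> km1 (kext (A := ksum A A') (C :=
  ksum C C') (pair_map e e'))} :=
  lpair (lpair (fst \o fst) (fst \o snd)) (lpair (snd \o fst) (snd \o snd)).
pose f0 : {linear k0 (ksum (kext e) (kext e')) -> k0 (kext (A := ksum A A') (C :=
  ksum C C') (pair_map e e'))} :=
  lpair (lpair (fst \o fst) (fst \o snd)) (lpair (snd \o fst) (snd \o snd)).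
have fC x : f0 (kd (ksum (kext e) (kext e')) x) = kd (kext (A := ksum A A') (C :=
  ksum C C') (pair_map e e')) (f1 x).
  by case: x => [[x z] [x' z']].
apply: (@kiso_bij _ _ _ (KMap fC)).
- by move=> [[x z] [x' z']] [[y w] [y' w']] [-> -> -> ->].
- by move=> [[x x'] [z z']]; exists ((x, z), (x', z')).
- by move=> [[x z] [x' z']] [[y w] [y' w']] [-> -> -> ->].
- by move=> [[x x'] [z z']]; exists ((x, z), (x', z')).
Qed.
Definition ksums (s : seq (ktwo R)) : ktwo R := foldr (@ksum R) (kzero R) s.
End Sums.

Section Count.
Variables (k : fieldType) (Lam : falgType k).
Implicit Types X Y Z U V W A B C T : ktwo Lam.

Lemma mkseqS (A : Type) (L : nat -> A) n : mkseq L n.+1 = L 0%N :: mkseq (fun i => L i.+1) n.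
Proof. by rewrite /mkseq /= -[iota 1 n]/(iota (1 + 0) n) iotaDl -map_comp. Qed.
Lemma ks_decomp U : exists n (L : nat -> ktwo Lam), (forall i, (i < n)%N ->
  kind (L i)) /\ kiso U (ksums (mkseq L n)).
Proof.
have [m] := ubnP (mu U); elim: m U => // m IH U /ltnSE le.
case: (classic (kiso U (kzero Lam))) => [h|nU]; first by exists 0%N, (fun=> U).
have [V [A [iV hVA]]] := ks_exists_ind nU.
have [|n [L [hL hA]]] := IH A.
  apply: leq_trans le; rewrite (mu_iso hVA); apply: leq_trans (mu_sum V A).
  by rewrite -add1n leq_add2r mu_gt0 //; case: iV.
exists n.+1, (fun i => if i is j.+1 then L j else V); split; first by case.
rewrite mkseqS.
exact: kiso_trans hVA (ksum_iso (kiso_refl V) hA).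
Qed.

Lemma ksums_ret (L : nat -> ktwo Lam) n i : (i < n)%N -> kret (L i) (ksums (mkseq L n)).
Proof.
elim: n L i => // n IH L i; rewrite mkseqS; case: i => [|i] lt; first exact: kret_suml.
exact: kret_trans (IH (fun i => L i.+1) i lt) (kret_sumr _ _).
Qed.
Lemma ks_or_sums V (L : nat -> ktwo Lam) n : kind V -> kret V (ksums (mkseq L n)) ->
  exists2 i, (i < n)%N & kret V (L i).
Proof.
move=> iV; elim: n L => [|n IH] L.
  by move=> /(ks_pow (n := 0%N) iV) h; case: (iV.1); apply: kret_antisym => //; apply: kret_zero;
    apply: kiso_refl.
rewrite mkseqS => /(ks_or iV) [h|/IH [i lt h]]; first by exists 0%N.
by exists i.+1.
Qed.

Lemma kadd_decomp U : exists n (L : nat -> ktwo Lam), (forall i, (i < n)%N -> kret (L i) U) /\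
  forall V, kadd U V -> exists2 s : seq nat, all (gtn n) s & kiso V (ksums [seq L i | i <- s]).
Proof.
have [n [L [hL hU]]] := ks_decomp U.
have retL i : (i < n)%N -> kret (L i) U.
  move=> lt; apply: kret_trans (kiso_retV hU).
  exact: ksums_ret.
exists n, L; split=> // V.
have [m] := ubnP (mu V); elim: m V => // m IH V /ltnSE le hV.
case: (classic (kiso V (kzero Lam))) => [h|nV]; first by exists [::].
have [A [B [iA hAB]]] := ks_exists_ind nV.
have AV : kret A V := kiso_retl hAB.
have BV : kret B V := kiso_retr hAB.
have /kaddE [q hq] := hV.
have AU := ks_pow iA (kret_trans AV hq).
have [i lt hi] := ks_or_sums iA (kret_trans AU (kiso_ret hU)).
have [||s hs hB] := IH B.
- apply: leq_trans le; rewrite (mu_iso hAB); apply: leq_trans (mu_sum A B).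
  by rewrite -add1n leq_add2r mu_gt0 //; case: iA.
- exact: kadd_ret BV hV.
exists (i :: s); first by rewrite /= lt.
by apply: kiso_trans hAB _; apply: ksum_iso => //; apply: ks_indret => //; apply: hL.
Qed.

(** For indecomposable T, the dimension of Hom(T, X) modulo the radical counts
    the occurrences of T in X, up to the factor kmult T. It is an additive
    function on objects that separates T from the other indecomposables. *)
Section Radical.
Variable T : ktwo Lam.
Hypothesis iT : kind T.
Definition krad X (f : kmap T X) := forall g : kmap X T, ~ khiso (g \k f).
Lemma krad_split X (f f' : kmap T X) : ~ krad (f + f') -> ~ krad f \/ ~ krad f'.
Proof.
move=> h; apply: NNPP => hn; apply: h => g [u [h1 _]].
have e : (u \k g) \k f + (u \k g) \k f' ~~ kid T by rewrite -kcompDr -kcompA.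
apply: hn; case: (ks_unit_or iT e) => hh; [left|right]; move/(_ (u \k g)); exact.
Qed.
Lemma krad_comp X Y (f : kmap T X) (u : kmap X Y) : krad f -> krad (u \k f).
Proof. by move=> h g; rewrite kcompA; apply: h. Qed.
Lemma krad_null X (f : kmap T X) : knull f -> krad f.
Proof.
move=> /khtp0 h g [u [h1 _]]; apply: (iT.1); apply/kzeroP/khtp0.
by rewrite -h1 h kcomp0r kcomp0r.
Qed.
Lemma krad_htp X (f f' : kmap T X) : f ~~ f' -> krad f -> krad f'.
Proof. by move=> e h g hg; apply: (h g); apply: khiso_eq hg; rewrite e. Qed.
Lemma krad_D X (f f' : kmap T X) : krad f -> krad f' -> krad (f + f').
Proof. by move=> h h'; apply: NNPP => /krad_split []. Qed.
Lemma krad_sub X : submodule (@krad X).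
Proof.
split; first by apply: krad_null; apply: knull0.
move=> c f f' h h'; apply: krad_D => // g.
by rewrite kcompZr -kcompZl; apply: h.
Qed.
Definition kmult X : nat := kdim (quotm (krad_sub X)).
Lemma fdim_rad X : fdim (quotm (krad_sub X)).
Proof. apply: (@fdim_quot _ _ _ (qpi (krad_sub X))); [exact: qpi_surj | exact: fdim_kmap]. Qed.

Lemma kdim_quot_eq (V' W' : lmodType k) (S : V' -> Prop) (HS : submodule S) (t : {linear V' ->
  W'}) :
  surjective t -> (forall v, t v = 0 <-> S v) -> fdim W' -> kdim (quotm HS) = kdim W'.
Proof.
move=> ts tk fW.
have [u uE] : exists u : {linear quotm HS -> W'}, forall v, u (qpi HS v) = t v.
  by apply: fact_surj (qpi_surj HS) _ => v /qpi_eq0/tk.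
apply: (@kdim_eq _ _ _ u) => //.
  by apply: lin_inj => a; have [v <-] := qpi_surj HS a; rewrite uE => /tk h; apply/qpi_eq0.
by move=> w; have [v <-] := ts w; exists (qpi HS v); apply: uE.
Qed.

Lemma kpost_lin X Y (u : kmap X Y) : linear (fun f : kmap T X => u \k f).
Proof. by move=> c f g; rewrite kcompDr kcompZr. Qed.

Lemma kmult_iso X Y : kiso X Y -> kmult X = kmult Y.
Proof.
move=> /kisoE [u [v [h1 h2]]].
apply: (@kdim_quot_eq _ _ _ _ (qpi (krad_sub Y) \o mklin (kpost_lin u))); last exact: fdim_rad.
  move=> y; have [f <-] := qpi_surj (krad_sub Y) y; exists (v \k f).
  apply/(qpi_eqE (krad_sub Y) (u \k (v \k f)) f); apply: krad_null.
  by change (u \k (v \k f) ~~ f); rewrite kcompA h2 kcomp1l.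
move=> f; rewrite /= qpi_eq0; split; last exact: krad_comp.
move=> h; apply: (krad_htp (f := v \k (u \k f))); last exact: krad_comp.
by rewrite kcompA h1 kcomp1l.
Qed.
Lemma kmult_sum A B : kmult (ksum A B) = (kmult A + kmult B)%N.
Proof.
rewrite -kdim_prod; try exact: fdim_rad.
apply: (@kdim_quot_eq _ _ _ _ (lpair (qpi (krad_sub A) \o mklin (kpost_lin (kfst A B))) (qpi
  (krad_sub B) \o mklin (kpost_lin (ksnd A B))))).
- move=> [a b]; have [f <-] := qpi_surj (krad_sub A) a; have [g <-] := qpi_surj (krad_sub B) b.
  exists (kinl A B \k f + kinr A B \k g); apply/pair_equal_spec; split=> /=; congr (qpi _ _).
    by rewrite kcompDr !kcompA kfst_inl kfst_inr kcomp0l kcomp1l addr0.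
  by rewrite kcompDr !kcompA ksnd_inl ksnd_inr kcomp0l kcomp1l add0r.
- move=> f; split.
    move=> /pair_equal_spec [/= /qpi_eq0 h1 /qpi_eq0 h2].
    rewrite -[f]kcomp1l -ksum_id kcompDl -!kcompA; apply: krad_D; exact: krad_comp.
  by move=> h; apply/pair_equal_spec; split; apply/qpi_eq0; apply: krad_comp.
- by apply: fdim_prod; apply: fdim_rad.
Qed.
Lemma kmult_self : (0 < kmult T)%N.
Proof.
rewrite lt0n; apply/eqP => /(kdim0 (fdim_rad T)) h.
have /qpi_eq0 h1 := h (qpi (krad_sub T) (kid T)).
by apply: (h1 (kid T)); exists (kid T); rewrite /kinvs !kcomp1l.
Qed.
Lemma kmult_other V : kind V -> ~ kiso T V -> kmult V = 0%N.
Proof.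
move=> iV nTV; apply/(kdim0 (fdim_rad V)) => a; have [f <-] := qpi_surj (krad_sub V) a.
apply/qpi_eq0 => g hg; apply: nTV; apply: ks_indret => //.
by apply: ks_retP => //; exists f, g.
Qed.
End Radical.

(** Bongartz completion: the universal extension of the regular module by a
    power of I. *)
Lemma bongartz I : Ev I I -> exists B n, [/\ confl (kreg Lam) B (kpow I n),
  silting (ksum B I) & Ev I B].
Proof.
move=> II; have [n [B [h hB]]] := univ_ext (kreg Lam) II; exists B, n; split=> //.
have BY Y : Ev I Y -> Ev B Y.
  move=> hY; apply: (confl_El h); first exact: Ev_kreg.
  by apply: Ev_kaddl hY _; apply: kadd_self_pow.
apply/siltingE; split.
  by apply: Ev_suml; apply: Ev_sumr => //; apply: BY.
apply: cot_thick h _ _; first exact: kadd_suml.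
by apply: kadd_pow; apply: kadd_sumr.
Qed.

(** An additive function F on objects, such as a multiplicity, is extended
    from add W to the first class of the cotorsion pair of W by an Euler
    characteristic: the index of P is the difference of the values of F at the
    two terms of a coresolution of P in add W. For V in add W, the conflation
    that presents V by projectives P and Q gives F(V) = index Q - index P, so
    F on add W is determined by finitely many indices. *)
Section Index.
Variables (W : ktwo Lam) (sW : silting W) (F : ktwo Lam -> nat).
Hypotheses (Fiso : forall X Y, kiso X Y -> F X = F Y) (Fsum :
  forall X Y, F (ksum X Y) = (F X + F Y)%N).

Definition kindex P (z : int) := exists A0 A1, [/\ confl P A0 A1, kadd W A0,
  kadd W A1 & z = (F A0)%:Z - (F A1)%:Z].

Let WW A B : kadd W A -> kadd W B -> Ev A B.
Proof. by move=> hA hB; have [h _] := (siltingE W).1 sW; apply: Ev_kaddl hA;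
  apply: Ev_kaddr hB. Qed.

Lemma kindex_ex P : silt_X W P -> exists z, kindex P z.
Proof.
move=> hP; have [h _] := (siltingE W).1 sW.
have [n [Y [hc hY]]] := univ_ext P h.
have aW : kadd W (kpow W n) by apply: kadd_self_pow.
exists ((F Y)%:Z - (F (kpow W n))%:Z), Y, (kpow W n); split=> //.
rewrite -(silt_inter sW); split=> // Z hZ; apply: (confl_El hc); first exact: hP.
exact: Ev_kaddl hZ aW.
Qed.
Lemma kindex_sum P Q z w : kindex P z -> kindex Q w -> kindex (ksum P Q) (z + w).
Proof.
move=> [A0 [A1 [h a0 a1 ->]]] [B0 [B1 [h' b0 b1 ->]]].
exists (ksum A0 B0), (ksum A1 B1); split; [exact: confl_sums | exact: kadd_sum | exact: kadd_sum |].
by rewrite !Fsum !PoszD; abel.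
Qed.
Lemma kindex_iso P Q z : kiso P Q -> kindex P z -> kindex Q z.
Proof. by move=> h [A0 [A1 [h' a0 a1 ->]]]; exists A0, A1; split=> //; apply: confl_isoA h h'. Qed.
(** The conflation of V followed by the coresolution of its degree 0 term
    splits at V, and so yields a coresolution of its degree -1 term; it is
    compared with the given one by a pushout, whose two conflations split. *)
Lemma kindexE V z1 z0 : kadd W V -> kindex (kstalk (km1P V)) z1 -> kindex (kstalk (k0P V)) z0 ->
  (F V)%:Z = z0 - z1.
Proof.
move=> aV [B0 [B1 [hB b0 b1 ->]]] [A0 [A1 [hA a0 a1 ->]]].
have [D h1 h2] := confl_oct (confl_stalk V) hA.
have hD := confl_split h2 (WW a1 aV).
have aD : kadd W D by apply: kadd_iso (kiso_sym hD) _; apply: kadd_sum.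
have [E h3 h4] := confl_pushout h1 hB.
have e1 := Fiso (confl_split h3 (WW b1 a0)); have e2 := Fiso (confl_split h4 (WW aD b0));
  have e3 := Fiso hD.
rewrite !Fsum in e1 e2 e3; rewrite e3 in e2.
have := congr1 Posz (etrans (esym e1) e2); rewrite !PoszD => e.
have -> : (F V)%:Z = ((F B0)%:Z + ((F V)%:Z + (F A1)%:Z)) - (F B0)%:Z - (F A1)%:Z by abel.
rewrite -e; abel.
Qed.
End Index.

(** Complete the family T_j to a silting object W, and let F_i be the
    multiplicity of T_i. The square matrix of the values F_i(T_j) is diagonal
    with nonzero entries, and it factors through the free group on the n
    indecomposable summands of the regular module: F_i(T_j) is the index of
    the degree 0 term of T_j minus that of the degree -1 term. Hence its rank
    is at most n. *)
Lemma count_presilting : exists n, forall m (T : 'I_m -> ktwo Lam),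
  (forall i, kind (T i)) -> (forall i j, Ev (T i) (T j)) -> (forall i j, i != j ->
    ~ kiso (T i) (T j)) -> (m <= n)%N.
Proof.
have [n [L [hL dec]]] := kadd_decomp (kreg Lam).
exists n => m T iT ET nT.
pose I := ksums [seq T i | i <- enum 'I_m].
have retI i : kret (T i) I.
  have : i \in enum 'I_m by rewrite mem_enum.
  rewrite /I; elim: (enum 'I_m) => // j s IH; rewrite in_cons => /orP [/eqP <-|/IH h] /=.
    exact: kret_suml.
  exact: kret_trans h (kret_sumr _ _).
have II : Ev I I.
  have El Y : (forall i, Ev (T i) Y) -> Ev I Y.
    by move=> h; rewrite /I; elim: (enum _) => [|i s IH] /=; [exact: Ev_zerol | apply: Ev_suml].
  apply: El => i; rewrite /I; elim: (enum _) => [|j s IH] /=; [exact: Ev_zeror | exact: Ev_sumr].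
have [B [q [_ sW _]]] := bongartz II; set W := ksum B I in sW.
have aW i : kadd W (T i).
  by apply: kadd_ret (kadd_self W); apply: kret_trans (retI i) (kret_sumr B I).
have XL P : kadd (kreg Lam) P -> silt_X W P.
  by move=> hP Z hZ; apply: Ev_kaddl hP; apply: Ev_kreg.
pose F i := kmult (iT i).
have Fiso i X Y : kiso X Y -> F i X = F i Y by apply: kmult_iso.
have Fsum i X Y : F i (ksum X Y) = (F i X + F i Y)%N by apply: kmult_sum.
have [g gP] : exists g : 'I_m -> nat -> int, forall i l, (l < n)%N -> kindex W (F i) (L l) (g i l).
  apply: (@choose_fun _ _ (fun i z => forall l, (l < n)%N -> kindex W (F i) (L l) (z l))) => i.
  apply: (@choose_fun _ _ (fun l z => (l < n)%N -> kindex W (F i) (L l) z)) => l.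
  case: (ltnP l n) => lt; last by exists 0.
  have [|z hz] := @kindex_ex W sW (F i) (L l); last by exists z.
  by apply: XL; apply: kadd_ret (hL l lt) (kadd_self _).
have gs i s : all (gtn n) s -> kindex W (F i) (ksums [seq L l | l <- s]) (\sum_(l <- s) g i l).
  elim: s => [_|l s IH /= /andP [lt hs]].
    rewrite big_nil; exists (kzero Lam), (kzero Lam); split; try exact: kadd_zero.
      exact: confl_isoB (ksum0 _ (kiso_refl _)) (confl_sum _ _).
    by rewrite subrr.
  by rewrite big_cons; apply: (@kindex_sum W (F i) (Fsum i)); [apply: gP | apply: IH].
have h i : exists s : seq nat * seq nat, [/\ all (gtn n) s.1, all (gtn n) s.2,
    kiso (kstalk (km1P (T i))) (ksums [seq L l | l <- s.1]) &
      kiso (kstalk (k0P (T i))) (ksums [seq L l | l <- s.2])].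
  have [s1 a1 h1] := dec _ (kstalk_add (km1P (T i))); have [s2 a2 h2] :=
    dec _ (kstalk_add (k0P (T i))).
  by exists (s1, s2).
have [s sP] := choose_fun h.
have main i j : (F i (T j))%:Z = \sum_(l < n) g i l * ((count_mem (l :
  nat) (s j).2)%:Z - (count_mem (l : nat) (s j).1)%:Z).
  have [a1 a2 h1 h2] := sP j.
  have cnt t : all (gtn n) t -> \sum_(l <- t) g i l = \sum_(l < n) g i l * (count_mem (l :
    nat) t)%:Z.
    elim: t => [_|x t IH /= /andP [lt ht]]; first by rewrite big_nil big1 // => l _; rewrite mulr0.
    rewrite big_cons IH // [in RHS](eq_bigr (fun l : 'I_n => g i l * (x == l)%:Z + g i l *
      (count_mem (l : nat) t)%:Z)); last first.
      by move=> l _; rewrite PoszD mulrDr.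
    rewrite big_split /=; congr (_ + _).
    rewrite (bigD1 (Ordinal lt)) //= eqxx mulr1 big1 ?addr0 // => l ne.
    by rewrite (_ : (x == l) = false) ?mulr0 //; apply: contraNF ne => /eqP e; apply/eqP/val_inj.
  have k1 := kindex_iso (kiso_sym h1) (gs i _ a1); have k2 := kindex_iso (kiso_sym h2) (gs i _ a2).
  rewrite (kindexE sW (Fiso i) (Fsum i) (aW j) k1 k2) !cnt // -sumrB.
  by apply: eq_bigr => l _; rewrite mulrBr.
pose M : 'M[rat]_m := \matrix_(i, j) (F i (T j))%:R.
pose G : 'M[rat]_(m, n) := \matrix_(i, l) (g i l)%:~R.
pose C : 'M[rat]_(n, m) := \matrix_(l, j) ((count_mem (l : nat) (s j).2)%:Z - (count_mem (l :
  nat) (s j).1)%:Z)%:~R.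
have MGC : M = G *m C.
  apply/matrixP => i j; rewrite !mxE.
  have -> : (F i (T j))%:R = ((F i (T j))%:Z)%:~R :> rat by [].
  rewrite main rmorph_sum /=; apply: eq_bigr => l _; by rewrite !mxE rmorphM.
have rM : \rank M = m.
  have -> : M = diag_mx (\row_i (F i (T i))%:R).
    apply/matrixP => i j; rewrite !mxE; case: (eqVneq i j) => [->|ne]; first by rewrite mulr1n.
    by rewrite mulr0n -[F i (T j)]/(kmult (iT i) (T j)) (kmult_other (iT i) (iT j)) //; apply: nT.
  apply/eqP; rewrite -/(row_free _) row_free_unit unitmxE det_diag unitfE.
  apply/prodf_neq0 => i _; rewrite mxE Num.Theory.pnatr_eq0 -lt0n; exact: kmult_self.
by rewrite -rM MGC; apply: mulmx_max_rank.
Qed.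

(** The injectives of T are pairwise without extensions, so by the bound on
    presilting families they form add I for a single object I. Let W be the
    Bongartz completion of I and let U1 be cut out of the conflation from the
    regular module to a power of I by minimality. Then U1 is in add I, and I
    itself is in add U1: as an object of the first class it embeds into a
    power of U1, and the embedding splits because I is injective in T. So T
    and the category beta of W both consist of the X with a conflation X -> J
    -> J' where J and J' are in add I. *)
Lemma beta_surjective (T : class (ktwo Lam)) : thick_enough_inj T ->
  exists2 p, complete_cotorsion p & beta p.1 = T.
Proof.
move=> [hT eT]; have [[tr t0 ts] tt] := (is_thickE T).1 hT.
pose Inj I := T I /\ forall X, T X -> Ev X I.
have clI : add_closed Inj.
  split; first by move=> X Y h [hY iY]; split; [apply: tr h hY | move=> Z hZ; apply: Ev_retr h _;
    apply: iY].
    by split=> // X _; apply: Ev_zeror.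
  by move=> X Y [hX iX] [hY iY]; split; [apply: ts | move=> Z hZ; apply: Ev_sumr;
    [apply: iX | apply: iY]].
have [n bnd] := count_presilting.
pose P m := decide (exists F : 'I_m -> ktwo Lam, [/\ forall i, kind (F i), forall i,
  Inj (F i) & forall i j, i != j -> ~ kiso (F i) (F j)]).
have ex : exists m, P m.
  by exists 0%N; apply/decideP; exists (fun=> kzero Lam); split; case.
have ub m : P m -> (m <= n)%N.
  move=> /decideP [F [h1 h2 h3]]; apply: (bnd m F) => // i j.
  by apply: (h2 j).2; case: (h2 i).
case: (ex_maxnP ex ub) => m /decideP [F [F1 F2 F3]] mx.
pose I := ksums [seq F i | i <- enum 'I_m].
have retI i : kret (F i) I.
  have : i \in enum 'I_m by rewrite mem_enum.
  rewrite /I; elim: (enum 'I_m) => // j s IH; rewrite in_cons => /orP [/eqP <-|/IH h] /=.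
    exact: kret_suml.
  exact: kret_trans h (kret_sumr _ _).
have iI : Inj I.
  by rewrite /I; elim: (enum _) => [|i s IH] /=; case: clI => c1 c2 c3 //; apply: c3.
have genI J : Inj J -> kadd I J.
  move=> iJ; have [r [L [hL hJ]]] := ks_decomp J.
  have LJ i : (i < r)%N -> kret (L i) J.
    move=> lt; apply: kret_trans (kiso_retV hJ).
    exact: ksums_ret.
  have LI i : (i < r)%N -> kadd I (L i).
    move=> lt; apply: NNPP => nL.
    have : (m.+1 <= m)%N; last by rewrite ltnn.
    apply: mx; apply/decideP; exists (fun j => if unlift ord0 j is Some j' then F j' else L i);
      split.
    - by move=> j; case: (unlift ord0 j) => [j'|]; [apply: F1 | apply: hL].
    - move=> j; case: (unlift ord0 j) => [j'|]; first exact: F2.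
      by case: clI => c1 _ _; apply: c1 (LJ i lt) iJ.
    - have nF j' : ~ kiso (F j') (L i).
        by move=> h; apply: nL; apply: kadd_iso h _; apply: kadd_ret (retI j') (kadd_self _).
      move=> j1 j2; case: unliftP => [j1'|] ->; case: unliftP => [j2'|] -> ne.
      + by apply: F3; apply: contraNneq ne => ->.
      + exact: nF.
      + by move=> h; apply: (nF j2'); apply: kiso_sym.
      + by rewrite eqxx in ne.
  apply: kadd_iso (kiso_sym hJ) _.
  have : forall i, i \in iota 0 r -> kadd I (L i) by move=> i; rewrite mem_iota => /LI.
  rewrite /mkseq; elim: (iota 0 r) => [|i s IH] h /=; first exact: kadd_zero.
  apply: kadd_sum; first by apply: h; rewrite mem_head.
  by apply: IH => j hj; apply: h; rewrite in_cons hj orbT.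
have II : Ev I I by apply: iI.2; case: iI.
have [B [q [hB sW IB]]] := bongartz II; set W := ksum B I in sW.
have [U1 [gam [a1 a0 gm]]] : exists U1 (gam : {linear km1 U1 ->
  k0 (kreg Lam)}), [/\ kadd I U1, kadd W (kext gam) & rmin gam].
  apply: rho_min_exists; [exact: kadd_ret | exact: kadd_ret |].
  have [gam h] := hB; exists (kpow I q), gam; split; first by apply: kadd_self_pow.
  by apply: kadd_iso h _; apply: kadd_suml.
have [WW _] := (siltingE W).1 sW.
pose p : (class (ktwo Lam) * class (ktwo Lam))%type := (silt_X W, silt_Y W).
have hp : complete_cotorsion p := silt_complete WW.
have ei : inter p.1 p.2 = kadd W := silt_inter sW.
have aWI J : kadd I J -> kadd W J.
  by apply: kadd_trans; apply: kadd_sumr.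
have i1 : inter p.1 p.2 U1 by rewrite ei; apply: aWI.
have i0 : inter p.1 p.2 (kext gam) by rewrite ei.
have iU1 : Inj U1 := add_closed_kadd clI iI a1.
have genU1 J : Inj J -> kadd U1 J.
  move=> iJ; have [pJ _] : inter p.1 p.2 J by rewrite ei; apply: aWI; apply: genI.
  have [r [C hC]] := rho_infl hp i0 pJ.
  have tC : T C.
    have [h1 _ _] := tt _ _ _ hC; apply: h1; first by case: iJ.
    by apply: (add_closed_kadd (And3 tr t0 ts) (U := U1)); [case: iU1 | apply: kadd_self_pow].
  apply/kaddE; exists r; apply: kiso_retl (confl_split hC (iJ.2 _ tC)).
exists p => //; apply: class_ext => X; split.
  rewrite (beta_thick_rho hp i1 i0 gm (erefl (kadd U1))) => h; apply: h => // _ ->.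
  by case: iU1.
move=> hX; have [J [X'' [/conflE h [tJ iJ] tX'']]] := eT X hX.
have jJ : Inj J by split=> // Z hZ; apply/EvE; apply: iJ.
have jX'' : Inj X''.
  by split=> // Z hZ; apply: (confl_Eq h); apply: jJ.2.
have hb := beta_thick hp.1.
have bU V : kadd U1 V -> beta p.1 V := thick_kadd hb (rho_beta hp i1 i0 gm).
have [_ ht] := (is_thickE _).1 hb; have [_ _ h3] := ht _ _ _ h.
by apply: h3; apply: bU; apply: genU1.
Qed.

Lemma beta_bij : bij_between (@complete_cotorsion Lam) (@thick_enough_inj Lam) (fun p => beta p.1).
Proof.
split; [exact: beta_in | by move=> p p' hp hp'; apply: beta_injective |].
by move=> T /beta_surjective [p hp e]; exists p.
Qed.

Lemma thick_rho_bij : bij_between (@basic_silting_classes Lam) (@thick_enough_inj Lam)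
  (@thick_rho Lam).
Proof.
have [P1 P2 P3] := @Psi_bij k Lam; have [b1 b2 b3] := beta_bij.
split.
- by move=> C hC; have [p hp <-] := P3 C hC; rewrite (thick_rho_beta hp); apply: b1.
- move=> C D hC hD; have [p hp <-] := P3 C hC; have [q hq <-] := P3 D hD.
  by rewrite (thick_rho_beta hp) (thick_rho_beta hq) => e; rewrite (b2 _ _ hp hq e).
- move=> T hT; have [p hp <-] := b3 T hT; exists (Psi p); first exact: P1.
  exact: thick_rho_beta.
Qed.
End Count.

(** * The module category *)

Section ModuleBasics.
Variable R : nzRingType.
Implicit Types X Y Z U V W : ktwo R.
Implicit Types M N L : lmodType R.

Definition coker_map X N (pi : {linear k0 X -> N}) :=
  surjective pi /\ forall x, pi x = 0 <-> exists y, kd X y = x.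

Lemma coker_lift X Y N (pi : {linear k0 Y -> N}) (f : {linear k0 X -> N}) :
  coker_map pi -> (forall x, f (kd X x) = 0) -> exists s : kmap X Y, forall x, pi (m0 s x) = f x.
Proof.
move=> [ps pk] hf.
have [s0 s0P] := proj_lift (k0P X).2 (fun x => ps (f x)).
have [s1 s1P] : exists s1 : {linear km1 X -> km1 Y}, forall x, kd Y (s1 x) = (s0 \o kd X) x.
  by apply: proj_lift; [case: (km1P X) | move=> x; apply/pk; rewrite /= s0P hf].
by exists (KMap (fun x => esym (s1P x))).
Qed.

Lemma H0_map X Y N N' (pi : {linear k0 X -> N}) (pi' : {linear k0 Y -> N'}) (f : kmap X Y) :
  coker_map pi -> coker_map pi' -> exists g : {linear N -> N'}, forall x, g (pi x) = pi' (m0 f x).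
Proof.
move=> [ps pk] [ps' pk']; apply: (fact_surj (f := pi' \o m0 f) ps) => x /pk [y <-] /=.
by apply/pk'; rewrite mC; exists (m1 f y).
Qed.

(** E(X, N) = 0 for the module N placed in degree 0. *)
Definition Evm X N := forall f : {linear km1 X -> N}, exists h : {linear k0 X ->
  N}, forall x, f x = h (kd X x).
(** Hom(X, N) = 0 for the module N placed in degree 0. *)
Definition Hom0 X N := forall f : {linear k0 X -> N}, (forall x, f (kd X x) = 0) ->
  forall y, f y = 0.

(** E(X, -) only sees degree 0 cohomology: a map into the cokernel N lifts to
    Y, and a map whose image dies in N lies in the image of the differential.
    *)
Lemma Evm_coker X Y N (pi : {linear k0 Y -> N}) : coker_map pi -> (Evm X N <-> Ev X Y).
Proof.
move=> hpi; have [ps pk] := hpi; split=> H f.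
  have [h hP] := H (pi \o f).
  have [h' h'P] := proj_lift (k0P X).2 (fun x => ps (h x)).
  have [s sP] : exists s : {linear km1 X -> km1 Y}, forall x, kd Y (s x) = (f \- (h' \o kd X)) x.
    apply: proj_lift; [by case: (km1P X) | move=> x; apply/pk].
    have e : pi (f x) = h (kd X x) := hP x.
    by rewrite linearB /= e h'P subrr.
  by exists s, h' => x; rewrite sP /= subrK.
have [f' f'P] := proj_lift (km1P X).2 (fun x => ps (f x)).
have [h [h' hP]] := H f'; exists (pi \o h') => x.
rewrite -f'P hP linearD (_ : pi (kd Y _) = 0) ?add0r //; apply/pk; by exists (h x).
Qed.
Lemma Evm_surj X N N' (q : {linear N -> N'}) : surjective q -> Evm X N -> Evm X N'.
Proof.
move=> qs H f; have [f' f'P] := proj_lift (km1P X).2 (fun x => qs (f x)).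
by have [h hP] := H f'; exists (q \o h) => x; rewrite -f'P hP.
Qed.

Definition mpow (M : fgmod R) n : fgmod R := iter n (mod_sum M) (mod_zero R).
Lemma mod_retE (M N : fgmod R) : mod_add M N <->
  exists n (a : {linear N -> mpow M n}) (c : {linear mpow M n -> N}), forall x, c (a x) = x.
Proof.
split=> [[n [X' [f [g gf fg]]]]|[n [a [c ca]]]].
  have gl : linear g.
    move=> z x y; apply: (can_inj gf); by rewrite linearP !fg.
  exists n, (mklin gl \o @pair_inl _ _ _), ((lfst N X') \o f) => x.
  by rewrite /= fg.
exists n.
have [r rP] : exists r : {linear mpow M n -> kerm c}, forall w,
  kinj c (r w) = (idfun \- (a \o c)) w.
  by apply: ker_lift => w; rewrite linearB /= ca subrr.
have K : fin_gen (kerm c).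
  apply: (fin_gen_surj (r := r) _ (fgmodP (mpow M n))) => y; exists (kinj c y).
  by apply: (@kinj_inj _ _ _ c); rewrite rP /= kinjK linear0 subr0.
exists (FgMod K), (lpair c r : {linear mpow M n -> mod_sum N (FgMod K)}).
exists (fun w => a w.1 + kinj c w.2).
  move=> x; change (a (c x) + kinj c (r x) = x); rewrite rP /=.
  by rewrite addrC subrK.
move=> [y z]; have e : c (a y + kinj c z) = y by rewrite linearD ca kinjK addr0.
apply/pair_equal_spec; split=> //.
apply: (@kinj_inj _ _ _ c); rewrite rP; change (a y + kinj c z - a (c (a y + kinj c z)) = kinj c z).
by rewrite e addrC addKr.
Qed.

Lemma FacE (M N : fgmod R) : Fac M N <-> exists n (q : {linear mpow M n -> N}), surjective q.
Proof.
split=> [[M' /mod_retE [n [a [c ca]]] [q qs]]|[n [q qs]]].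
  by exists n, (q \o c) => y; have [x <-] := qs y; exists (a x); rewrite /= ca.
exists (mpow M n); last by exists q.
by apply/mod_retE; exists n, idfun, idfun.
Qed.
Lemma mod_add_self (M : fgmod R) : mod_add M M.
Proof.
apply/mod_retE; exists 1%N, (@pair_inl _ _ _), (lfst M (mpow M 0)) => x //.
Qed.
Lemma mod_add_Fac (M N : fgmod R) : mod_add M N -> Fac M N.
Proof. by move=> h; exists N => //; exists idfun => y; exists y. Qed.

Lemma coker_sum X Y N N' (pi : {linear k0 X -> N}) (pi' : {linear k0 Y -> N'}) :
  coker_map pi -> coker_map pi' -> coker_map (X := ksum X Y) (N := (N * N')%type) (pair_map pi pi').
Proof.
move=> [ps pk] [ps' pk']; split.
  move=> [y y']; have [x <-] := ps y; have [x' <-] := ps' y'; by exists (x, x').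
move=> [x x']; split.
  by move=> /pair_equal_spec [/= /pk [y <-] /pk' [y' <-]]; exists (y, y').
by move=> [[y y'] /pair_equal_spec [/= <- <-]]; apply/pair_equal_spec; split=> /=; [apply/pk;
  exists y | apply/pk'; exists y'].
Qed.
Lemma coker_pow X (M : fgmod R) n : is_H0 X M -> is_H0 (kpow X n) (mpow M n).
Proof.
move=> [pi hpi]; elim: n => [|n [pi' hpi']].
  exists \0; split; first by move=> y; exists 0; apply: zmod0_eq.
  by move=> x; split=> _; [exists 0 |]; apply: zmod0_eq.
by exists (pair_map pi pi'); apply: coker_sum.
Qed.
Lemma H0_add U V (M N : fgmod R) : is_H0 U M -> kadd U V -> is_H0 V N -> mod_add M N.
Proof.
move=> hM /kaddE [n [a [c [h [_ h0]]]]] [pi hpi]; have [pi' hpi'] := coker_pow n hM.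
have [a' a'P] := H0_map a hpi hpi'; have [c' c'P] := H0_map c hpi' hpi.
apply/mod_retE; exists n, a', c' => x; have [y <-] := hpi.1 x.
rewrite a'P c'P; apply/eqP; rewrite -subr_eq0 -linearB; apply/eqP/hpi.2; exists (h y).
by rewrite -h0 mE.
Qed.

Lemma perp_pow (M N : fgmod R) : (forall f : {linear M -> N}, f =1 \0) ->
  forall n (f : {linear mpow M n -> N}), f =1 \0.
Proof.
move=> h; elim=> [|n IH] f x.
  have -> : x = 0 := zmod0_eq x 0.
  exact: (linear0 f).
case: x => x y; rewrite lin_pair.
have e1 : f (pair_inl _ x) = 0 := h (f \o @pair_inl _ _ _) x.
have e2 : f (pair_inr _ y) = 0 := IH (f \o @pair_inr _ _ _) y.
by rewrite [X in X + _]e1 [X in _ + X]e2 addr0.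
Qed.
Lemma perp_add (M M' N : fgmod R) : mod_add M M' -> (forall f : {linear M -> N}, f =1 \0) ->
  forall f : {linear M' -> N}, f =1 \0.
Proof.
move=> /mod_retE [n [a [c ca]]] h f x; rewrite -(ca x); exact: (perp_pow h (f \o c) (a x)).
Qed.
Lemma perp_Fac (M : fgmod R) : perp (Fac M) = perp (single M).
Proof.
apply: class_ext => N; split=> h.
  by move=> _ -> f; apply: h; apply: mod_add_Fac; apply: mod_add_self.
move=> M' /FacE [n [q qs]] f x; have [y <-] := qs x.
exact: (perp_pow (h M erefl) (f \o q) y).
Qed.

Lemma WcE (C : class (ktwo R)) (N : fgmod R) : Wcat C N <-> forall X, C X -> Wc N X.
Proof.
split=> h X hX; have [h1 h2] := h X hX; split.
- by move=> f fx y; apply: (h1 f \0) => x /=; rewrite fx.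
- by move=> g; have [f fP] := h2 g; exists f => x; rewrite -fP.
- move=> f f' e y; apply/eqP; rewrite -subr_eq0; apply/eqP.
  apply: (h1 (f \- f')) => x /=; have /= -> := e x; by rewrite subrr.
- by move=> g; have [f fP] := h2 g; exists f => x; rewrite /= fP.
Qed.
Lemma Wc_rho V U1 N : kadd V = kadd U1 -> Wc N V <-> Wc N U1.
Proof.
move=> e; split=> h; apply: (thick_kadd (Wc_thick N) h).
  by rewrite e; apply: kadd_self.
by rewrite -e; apply: kadd_self.
Qed.
Lemma Wcat_thick V (N : fgmod R) : Wcat (thick (single V)) N <-> Wc N V.
Proof.
rewrite WcE; split=> h; first by apply: h; apply: thick_sub.
by move=> X hX; apply: (hX _ (Wc_thick N)) => _ ->.
Qed.
End ModuleBasics.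

Section ModuleSide.
Variables (k : fieldType) (Lam : falgType k).
Implicit Types X Y Z V W A B C T : ktwo Lam.

Lemma presentation (N : fgmod Lam) : exists Y, is_H0 Y N.
Proof.
have [n [r rs]] := fg_cover (fgmodP N).
have [m [q qs]] := fg_cover (fin_gen_ker r (k0P _).1).
exists (KTwo (kinj r \o q) (k0P _) (k0P _)), r; split=> // x; split.
  by move=> /kinj_ex [z <-]; have [y <-] := qs z; exists y.
by move=> [y <-]; apply: kinjK.
Qed.
Lemma H0_exists X : exists N : fgmod Lam, is_H0 X N.
Proof.
have HS : submodule (fun x => exists y, kd X y = x).
  split; first by exists 0; rewrite linear0.
  by move=> c _ _ [y <-] [y' <-]; exists (c *: y + y'); rewrite linearP.
have fg : fin_gen (quotm HS) by apply: (fin_gen_surj (qpi_surj HS)); case: (k0P X).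
exists (FgMod fg), (qpi HS); split; first exact: qpi_surj.
by move=> x; apply: qpi_eq0.
Qed.

Section Fix.
Variables (U U1 : ktwo Lam) (gam : {linear km1 U1 -> k0 (kreg Lam)}) (M : fgmod Lam).
Hypotheses (UU : Ev U U) (hd : rho_datum U gam) (hM : is_H0 U M).

Lemma Fac_Evm (N : fgmod Lam) : Fac M N -> Evm U N.
Proof.
move=> /FacE [n [q qs]]; apply: Evm_surj qs _; have [pi hpi] := coker_pow n hM.
apply/(Evm_coker U hpi); exact: Ev_kaddr UU (kadd_self_pow U n).
Qed.
Lemma Evm_add V W (N : fgmod Lam) : kadd V W -> Evm V N -> Evm W N.
Proof. by have [Y [pi hpi]] := presentation N; rewrite !(Evm_coker _ hpi) => h h';
  apply: Ev_kaddl h' h. Qed.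
(** If E(U1, N) = 0, every map from the regular module to N extends to U0. So
    N is a quotient of a power of H^0(U0), with one factor for each generator.
    *)
Lemma Evm_Fac (N : fgmod Lam) : Evm U1 N -> Fac M N.
Proof.
have [_ a0 _] := hd; have [Y [pi hpi]] := presentation N; rewrite (Evm_coker _ hpi) => hY.
have [s sP] := fgmodP N.
pose U0 := kext gam.
have ext (y : N) : exists psi : kmap U0 Y, exists u, pi (m0 psi u) = y.
  have [y0 ey] := hpi.1 y.
  have [h [h' hP]] := hY (regular_act y0 \o gam).
  pose b0 : {linear k0 U0 -> k0 Y} := pair_case (regular_act y0) (\- h').
  pose b1 : {linear km1 U0 -> km1 Y} := h \o (lsnd (km1 (kreg Lam)) (km1 U1)).
  have bC x : b0 (kd U0 x) = kd Y (b1 x).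
    case: x => x z; have e : regular_act y0 (gam z) = kd Y (h z) + h' (kd U1 z) := hP z.
    change (regular_act y0 (0 + gam z) + - h' (kd U1 z) = kd Y (h z)).
    by rewrite add0r e addrK.
  exists (KMap bC), (1, 0).
  have -> : m0 (KMap bC) (1, 0) = regular_act y0 (1 : Lam^o) + - h' 0 by [].
  by rewrite linear0 ?oppr0 addr0 /regular_act scale1r.
have fam (l : seq N) : exists psi : kmap (kpow U0 (size l)) Y, forall j, (j < size l)%N ->
  exists u, pi (m0 psi u) = l`_j.
  elim: l => [|y l [psi pP]]; first by exists 0.
  have [phi [u hu]] := ext y.
  exists (phi \k kfst _ _ + psi \k ksnd _ _) => -[|j] /= hj.
    exists (u, 0); change (pi (m0 phi u + m0 psi 0) = y).
    by rewrite [m0 psi 0]linear0 addr0.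
  have [w hw] := pP j hj; exists (0, w).
  change (pi (m0 phi 0 + m0 psi w) = l`_j).
  by rewrite [m0 phi 0]linear0 add0r.
have [psi pP] := fam s.
pose V := kpow U0 (size s).
have [N' hN'] := H0_exists V; have [pi' hpi'] := hN'.
have [g gP] := H0_map psi hpi' hpi.
exists N'; first by apply: (H0_add hM _ hN'); apply: kadd_pow.
exists g => y.
have [u uP] := choose_fun (fun i : 'I_(size s) => pP i (ltn_ord i)).
have [c ->] := sP y; exists (pi' (\sum_(i < size s) c i *: u i)).
rewrite gP !linear_sum; apply: eq_bigr => i _.
by rewrite !linearZ /= uP.
Qed.
(** The torsion class is already cut out by U1 alone. *)
Lemma FacP (N : fgmod Lam) : Fac M N <-> Evm U1 N.
Proof.
split; last exact: Evm_Fac.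
by move/Fac_Evm; apply: Evm_add; case: hd.
Qed.

Lemma H0_image_Y : H0_image (silt_Y U) = Fac M.
Proof.
apply: class_ext => N; split.
  move=> [Y hY [pi hpi]]; apply/FacP.
  by apply: (@Evm_add U); [case: hd | apply/(Evm_coker U hpi)].
move=> /Fac_Evm h; have [Y hY] := presentation N; have [pi hpi] := hY.
by exists Y => //; apply/(Evm_coker U hpi).
Qed.

Lemma Wc_Fac (N : fgmod Lam) : Wc N U1 <-> Fac M N /\ Hom0 U1 N.
Proof. by rewrite FacP; split=> -[h1 h2]; split. Qed.

(** Suppose that N is in alpha and f : U1 -> N. Extended by zero to the
    regular module, f gives g : H^0(U0) -> N, whose kernel lies in Fac M and
    hence has no extensions with U1. Correcting the inclusion of the degree 0
    term of U1 by a map to the kernel therefore gives a morphism from U1 to U0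
    over f. It induces an endomorphism c of U1 with f c = f that is killed by
    gam; by minimality 1 - c is invertible, and f = 0. Conversely, if Hom(U1,
    N) = 0, a map from U1 to the kernel K of g : L -> N that becomes trivial
    in E(U1, L) is trivial in E(U1, K). *)
Lemma alphaP D (N : fgmod Lam) : alpha (Fac M, D) N <-> Fac M N /\ Hom0 U1 N.
Proof.
split=> [[hN hK]|[hN hz]]; split=> //.
- move=> f fd; have [a1 a0 gm] := hd.
  pose U0 := kext gam.
  have [M0 hM0] := H0_exists U0; have [pi hpi] := hM0; have [ps pk] := hpi.
  have FM0 : Fac M M0 by apply: mod_add_Fac; apply: (H0_add hM a0 hM0).
  have [g gP] : exists g : {linear M0 -> N}, forall x, g (pi x) = f x.2.
    apply: (fact_surj (f := f \o (lsnd (k0 (kreg Lam)) (k0 U1))) ps) => x /pk [y <-] /=.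
    exact: fd.
  pose K : fgmod Lam := FgMod (fin_gen_ker g (fgmodP M0)).
  have FK : Fac M K.
    apply: (hK M0 g FM0 K (kinj g)); split; first exact: kinj_inj.
    by move=> n; split=> [/kinj_ex //|[z <-]]; apply: kinjK.
  have EK := (FacP K).1 FK.
  pose t0 : {linear k0 U1 -> M0} := pi \o @pair_inr _ _ _.
  have gt0 u : g (t0 u) = f u by rewrite /t0 /= gP.
  have [ph phP] : exists ph : {linear km1 U1 -> kerm g}, forall x, kinj g (ph x) = (t0 \o kd U1) x.
    by apply: ker_lift => x; rewrite /= -/(t0 _) gt0 fd.
  have [h hP] := EK ph.
  pose t1 : {linear k0 U1 -> M0} := t0 \- (kinj g \o h).
  have t1d x : t1 (kd U1 x) = 0.
    have -> : t1 (kd U1 x) = t0 (kd U1 x) - kinj g (h (kd U1 x)) by [].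
    by rewrite -hP phP subrr.
  have [s sP] := coker_lift hpi t1d.
  pose c := kext_p gam \k s.
  have fc y : f (m0 c y) = f y.
    have -> : f (m0 c y) = g (pi (m0 s y)) by rewrite gP.
    rewrite sP; have -> : t1 y = t0 y - kinj g (h y) by [].
    by rewrite linearB gt0 kinjK subr0.
  have hc : khiso (kid U1 - c).
    apply: gm; exists (\- ((lfst (k0 (kreg Lam)) (k0 U1)) \o m0 s)) => z.
    have e : (m0 s (kd U1 z)).1 = gam (m1 s z).2.
      by have := congr1 fst (mC s z); rewrite /= add0r.
    change (gam (z - (m1 s z).2) = gam z + - (m0 s (kd U1 z)).1).
    by rewrite e linearB.
  move=> y; have [s0 _ _] := khiso_qis hc; have [x0 [y1 ->]] := s0 y.
  rewrite linearD fd addr0.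
  have -> : m0 (kid U1 - c) x0 = x0 - m0 c x0 by [].
  by rewrite linearB fc subrr.
- move=> L g FL K j [ji jk]; apply/FacP => ph.
  have [h hP] := (FacP L).1 FL (j \o ph).
  have gh y : g (h y) = 0.
    apply: (hz (g \o h)) => x /=; have e : j (ph x) = h (kd U1 x) := hP x.
    by rewrite -e; apply/jk; exists (ph x).
  have [h' h'P] : exists h' : {linear k0 U1 -> K}, forall y, j (h' y) = h y.
    by apply: lin_fact => // y; apply/jk.
  exists h' => x; apply: ji; rewrite h'P; exact: hP.
Qed.
End Fix.

(** The module approximation f' of the regular module and the map f2 induced
    by f on degree 0 cohomology are both minimal left approximations, so they
    factor through each other, and both factorisations are onto. Hence the
    cokernels of f' and of f2 receive maps to L at the same time; the cokernel
    of f2 is the degree 0 cohomology of U1. *)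
Lemma M_rho_perp U (M N L : fgmod Lam) : Ev U U -> is_H0 U M -> is_M_rho M N ->
  forall U0 U1 (f : kmap (kreg Lam) U0) (gam : {linear km1 U1 ->
    k0 (kreg Lam)}) (phi : kmap (kext gam) U0),
  khiso phi -> phi \k kext_i gam ~~ f -> kadd U U0 ->
  (forall e : kmap U0 U0, e \k f ~~ f -> khiso e) ->
  (forall B (a : kmap (kreg Lam) B), kadd U B -> exists b : kmap U0 B, b \k f ~~ a) ->
  perp (single N) L <-> Hom0 U1 L.
Proof.
move=> UU hM [_ [M0' [M1' [f' [g' [[aM0' appr] mini gs ex eN]]]]]] U0 U1 f gam phi hphi ef aU0 mf
  af.
have [M0 hM0] := H0_exists U0; have [pi hpi] := hM0; have [ps pk] := hpi.
have aM0 : mod_add M M0 := H0_add hM aU0 hM0.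
pose f2 : {linear mod_regular Lam -> M0} := pi \o m0 f.
(* The regular module is concentrated in degree 0, so homotopic maps out of it
   agree on degree 0 cohomology. *)
have htpE X (g1 g2 : kmap (kreg Lam) X) (Q : lmodType Lam) (q : {linear k0 X -> Q}) :
   (forall y, q (kd X y) = 0) -> g1 ~~ g2 -> forall x, q (m0 g1 x) = q (m0 g2 x).
  move=> qd [h [_ h0]] x; apply/eqP; rewrite -subr_eq0 -linearB; apply/eqP.
  by rewrite -[RHS](qd (h x)) -h0 mE.
have pd y : pi (kd U0 y) = 0 by apply/pk; exists y.
have st1 : perp (single N) L <-> perp (single M1') L.
  split=> h _ ->; apply: perp_add (h _ erefl).
    by rewrite eN; apply: mod_add_self.
  by rewrite -eN; apply: mod_add_self.
have st2 : perp (single M1') L <-> forall q : {linear M0' -> L}, (forall x, q (f' x) = 0) ->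
  forall y, q y = 0.
  split=> [h q qf|h _ -> q x].
    have [q' q'P] : exists q' : {linear M1' -> L}, forall a, q' (g' a) = q a.
      by apply: fact_surj gs _ => a /ex [x <-].
    by move=> y; rewrite -q'P; apply: (h _ erefl).
  have [y <-] := gs x; apply: (h (q \o g')) => z /=.
  by rewrite (_ : g' (f' z) = 0) ?linear0 //; apply/ex; exists z.
have [a haa] := appr M0 f2 aM0.
have {}haa x : a (f' x) = f2 x := haa x.
have [b hb] : exists b : {linear M0 -> M0'}, forall x, b (f2 x) = f' x.
  have /mod_retE [n [i [r ri]]] := aM0'.
  have [pin hpin] := coker_pow n hM.
  have [y0 ey0] := hpin.1 (i (f' 1)).
  pose s0 : {linear k0 (kreg Lam) -> k0 (kpow U n)} := regular_act y0.
  have sC x : s0 (kd (kreg Lam) x) = kd (kpow U n) ((\0 : {linear zmod0 Lam -> _}) x).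
    by rewrite /= !linear0.
  pose s : kmap (kreg Lam) (kpow U n) := @KMap _ (kreg Lam) _ \0 s0 sC.
  have [b' hb'] := af _ s (kadd_self_pow U n).
  have [b2 b2P] := H0_map b' hpi hpin.
  exists (r \o b2) => x; rewrite /= b2P.
  have -> : pin (m0 b' (m0 f x)) = pin (m0 s x).
    by apply: (htpE _ (b' \k f) s) => // y; apply/hpin.2; exists y.
  have -> : pin (m0 s x) = i (f' x).
    have -> : m0 s x = (x : Lam) *: y0 by [].
    rewrite linearZ /= ey0 -!linearZ; congr (i (f' _)); exact: mulr1.
  exact: ri.
have sba y : exists x, b (a x) = y.
  have [g _ gK] := mini (b \o a) (fun x => etrans (congr1 b (haa x)) (hb x)).
  by exists (g y); apply: gK.
have sab y : exists x, a (b x) = y.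
  have [x0 <-] := ps y.
  have [e eP] : exists e : kmap U0 U0, forall x, pi (m0 e x) = ((a \o b) \o pi) x.
    by apply: (coker_lift hpi) => x /=; rewrite pd !linear0.
  have he : khiso e.
    apply: mf.
    have [h hP] : exists h : {linear k0 (kreg Lam) -> km1 U0}, forall x,
      kd U0 (h x) = m0 (e \k f - f) x.
      apply: proj_lift; [by case: (k0P (kreg Lam)) | move=> x; apply/pk].
      have -> : m0 (e \k f - f) x = m0 e (m0 f x) - m0 f x by [].
      rewrite linearB eP /= -/(f2 x) hb haa; exact: subrr.
    exists h; split=> x; last by rewrite hP.
    by rewrite (_ : x = 0) ?linear0 //; exact: zmod0_eq.
  have [s0 _ _] := khiso_qis he; have [x1 [y1 ->]] := s0 x0.
  by exists (pi x1); rewrite linearD pd addr0 eP.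
have st3 : (forall q : {linear M0' -> L}, (forall x, q (f' x) = 0) -> forall y, q y = 0) <->
   (forall q : {linear M0 -> L}, (forall x, q (f2 x) = 0) -> forall y, q y = 0).
  split=> h q qf y.
    have [x <-] := sab y; apply: (h (q \o a)) => z /=; by rewrite haa qf.
  have [x <-] := sba y; apply: (h (q \o b)) => z /=; by rewrite -[b _]/(b (f2 z)) hb qf.
rewrite st1 st2 st3.
have [phi' hinv] := hphi; have [hi1 hi2] := hinv.
split=> h.
  move=> q qd.
  pose q2 : {linear k0 (kext gam) -> L} := q \o (lsnd (k0 (kreg Lam)) (k0 U1)).
  have q2d x : q2 (kd (kext gam) x) = 0 by apply: qd.
  have [q3 q3P] : exists q3 : {linear M0 -> L}, forall x, q3 (pi x) = q2 (m0 phi' x).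
    apply: (fact_surj (f := q2 \o m0 phi') ps) => x /pk [y <-].
    by change (q2 (m0 phi' (kd U0 y)) = 0); rewrite mC q2d.
  move=> y.
  have [h3 [_ h30]] := hi1.
  have e4 : m0 phi' (m0 phi (0, y)) - (0, y) = kd (kext gam) (h3 (0, y)) by rewrite -h30 mE.
  have -> : q y = q2 (m0 phi' (m0 phi (0, y))).
    apply/eqP; rewrite eq_sym -subr_eq0 -[q y]/(q2 (0, y)) -linearB e4 q2d eqxx //.
  rewrite -q3P; apply: h => x; rewrite /f2 /= q3P.
  have -> : q2 (m0 phi' (m0 f x)) = q2 (m0 (kext_i gam) x).
    apply: (htpE _ (phi' \k f) (kext_i gam)) => //.
    by rewrite -ef kcompA hi1 kcomp1l.
  by rewrite /q2 /= linear0.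
move=> q qf y; have [x <-] := ps y.
have [s0 _ _] := khiso_qis hphi; have [[l u] [y1 ->]] := s0 x.
rewrite linearD pd addr0 lin_pair linearD linearD.
have el l' : q (pi (m0 phi (pair_inl _ l'))) = 0.
  have -> : q (pi (m0 phi (pair_inl _ l'))) = (q \o pi) (m0 (phi \k kext_i gam) l') by [].
  rewrite (htpE _ (phi \k kext_i gam) f _ (q \o pi)) // => [|z] /=; first exact: qf.
  by rewrite pd linear0.
rewrite el add0r.
apply: (h (q \o pi \o m0 phi \o @pair_inr _ _ _)) => z.
have := mC phi (0, z); have -> : kd (kext gam) (0, z) = (gam z, kd U1 z).
  by apply/pair_equal_spec; rewrite /= add0r.
rewrite lin_pair => e5.
change (q (pi (m0 phi (pair_inr _ (kd U1 z)))) = 0).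
rewrite -[LHS]add0r -[X in X + _](el (gam z)) -(linearD q) -(linearD pi) e5 pd; exact: (linear0 q).
Qed.
End ModuleSide.

Theorem corollary1p1 (k : fieldType) (Lam : falgType k) :
  [/\ bij_between (@complete_cotorsion Lam) (@basic_silting_classes Lam)
        (@Psi Lam),
      bij_between (@complete_cotorsion Lam) (@thick_enough_inj Lam)
        (fun p => beta p.1)
    & bij_between (@basic_silting_classes Lam) (@thick_enough_inj Lam)
        (@thick_rho Lam)]
  /\
  (forall (X Y : class (ktwo Lam)) (U : ktwo Lam),
     complete_cotorsion (X, Y) -> Psi (X, Y) U ->
     (forall V : ktwo Lam, is_U_rho U V -> beta X = thick (single V))
     /\
     (forall M : fgmod Lam, is_H0 U M ->
        [/\ Phi (X, Y) = (Fac M, perp (single M)),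
            Wcat (beta X) = alpha (Phi (X, Y))
          & forall (V : ktwo Lam) (N : fgmod Lam),
              is_U_rho U V -> is_M_rho M N ->
              Wcat (thick (single V)) = inter (perp (single N)) (Fac M)
              /\ inter (perp (single N)) (Fac M)
                 = alpha (Fac M, perp (single M))])).
Proof.
split; first by split; [exact: Psi_bij | exact: beta_bij | exact: thick_rho_bij].
move=> X Y U hp hU; have bV V (hV : is_U_rho U V) := beta_rho hp hU hV.
split=> // M hM.
have [bU sU aU] := hU; have [UU _] := (siltingE U).1 sU.
have [W1 [gam0 hd0]] := rho_datum_exists sU.
have PE : Phi (X, Y) = (Fac M, perp (single M)).
  by rewrite /Phi (cot_Y hp aU) (H0_image_Y UU hd0 hM) perp_Fac.
have key V : is_U_rho U V -> Wcat (thick (single V)) = alpha (Fac M, perp (single M)).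
  move=> hV; have [U0 [U1 [f [gam [phi [[hd aV _ _] _]]]]]] := rho_of hV.
  apply: class_ext => L; rewrite Wcat_thick (Wc_rho _ aV) (Wc_Fac UU hd hM).
  by rewrite (alphaP UU hd hM).
split=> //.
  by rewrite PE; have [V hV] := rho_exists bU sU; rewrite (bV V hV) (key V hV).
move=> V N hV hN; rewrite (key V hV).
have [U0 [U1 [f [gam [phi [[hd aV hphi ef] [aU0 mf af]]]]]]] := rho_of hV.
suff -> : alpha (Fac M, perp (single M)) = inter (perp (single N)) (Fac M) by [].
apply: class_ext => L; rewrite (alphaP UU hd hM) /inter.
by rewrite (M_rho_perp L UU hM hN hphi ef aU0 mf af); split=> -[].
Qed.
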